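(* Let $k$ be a perfect field with algebraic closure $\overline{k}$. The functor $F\mapsto(F^{\mathrm{diag}},F(\overline{k})_{\overline{k}})$ from the category of transitive affine groupoids over $\overline{k}$ to the category of Galois extended $\overline{k}$-groups is an equivalence of categories.
   Context: Groupoids. A groupoid over $\overline{k}$ is a groupoid object $F$ in $k$-schemes with object of objects $\mathrm{Spec}(\overline{k})$, with source $d_1$, target $d_0$ and composition $\circ$; morphisms are the identity on $\mathrm{Spec}(\overline{k})$. It is transitive affine if $(d_0,d_1):F\to\mathrm{Spec}(\overline{k})\times_k\mathrm{Spec}(\overline{k})$ is affine and faithfully flat. $F^{\mathrm{diag}}$ is the equaliser of $d_0,d_1$, an affine $\overline{k}$-group (not necessarily of finite type). $F$ is regarded as a $\overline{k}$-scheme by $d_0$. $\sigma$-morphisms. For $\overline{k}$-schemes $Z,Z'$ and $\sigma\in\mathrm{Gal}(\overline{k}/k)$, a $\sigma$-morphism $Z\to Z'$ is a $k$-morphism forming a commutative square with the structural morphisms and $\mathrm{Spec}(\sigma^{-1})$, equivalently a $\overline{k}$-morphism $\mathrm{Spec}(\sigma)^*Z\to Z'$; it induces a map $Z(\overline{k})_{\overline{k}}\to Z'(\overline{k})_{\overline{k}}$ on sets of $\overline{k}$-points over $\overline{k}$. $\sigma$-automorphisms of a $\overline{k}$-group are required to respect the group structure. Topologies. For an affine $\overline{k}$-scheme $Z$, $Z(\overline{k})_{\overline{k}}$ has the Krull topology, with basic open sets the sets of points at which finitely many given functions take given values in $\overline{k}$; $\mathrm{Gal}(\overline{k}/k)$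 has its Krull topology. A topological extension $1\to E''\to E\to E'\to1$ consists of continuous homomorphisms with $E''\to E$ a topological isomorphism onto the kernel of $E\to E'$ and $E\to E'$ having continuous sections locally on $E'$. An action of a topological group $M$ on a $k$-scheme $Z$ is continuous if the map $M\times|Z|\to|Z|$ is continuous and, for every section $f$ of $\mathcal{O}_Z$ on an open set, the family of germs at $z$ of the pullbacks of $f$ by $m$ is, near each point $(m_0,z_0)$ of $M\times|Z|$ where it is defined, given by the germs at $z$ of a single section of $\mathcal{O}_Z$ near $z_0$ (i.e. the action of $M$ as a discrete group factors through an action of the locally ringed space with underlying space $M$ and structure sheaf the constant sheaf $k$). Galois extended groups. A Galois extended $\overline{k}$-group $(D,E)$ consists of an affine $\overline{k}$-group $D$, a topological extension $1\to D(\overline{k})_{\overline{k}}\to E\to\mathrm{Gal}(\overline{k}/k)\to1$, and a continuous action of $E$ on the underlying $k$-scheme of $D$ with $e$ above $\sigma$ acting as a $\sigma$-automorphism $a_e$ of the $\overline{k}$-group $D$, such that: (a) the automorphism of $D(\overline{k})_{\overline{k}}$ induced by $a_e$ is conjugation by $e$; (b) for $e\in D(\overline{k})_{\overline{k}}$, $a_e$ is conjugation of $D$ by $e$. A morphism $(D,E)\to(D',E')$ is a pair $(h,l)$ with $h:D\to D'$ a $\overline{k}$-homomorphism and $l:E\to E'$ a continuous homomorphism over $\mathrm{Gal}(\overline{k}/k)$, restricting to the map induced by $h$ on $D(\overline{k})_{\overline{k}}$, with $h\circ a_e=a'_{l(e)}\circ h$ for every $e\in E$. The functor. For $u\in F(\overline{k})_{\overline{k}}$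 define $\gamma(u)\in\mathrm{Gal}(\overline{k}/k)$ by $d_1(u)=\mathrm{Spec}(\gamma(u))$. The product in $F(\overline{k})_{\overline{k}}$ is $uv=u\circ{}^{\gamma(u)}v$, where ${}^\sigma v=v\circ\mathrm{Spec}(\sigma)$; with the Krull topology this is a topological group, and $\gamma$ makes it an extension of $\mathrm{Gal}(\overline{k}/k)$ by $F^{\mathrm{diag}}(\overline{k})_{\overline{k}}$. An element $v$ of $F(\overline{k})_{\overline{k}}$ acts on $F^{\mathrm{diag}}$ by the $\gamma(v)$-automorphism $\mathrm{Spec}(\gamma(v))^*F^{\mathrm{diag}}\to F^{\mathrm{diag}}$ given by conjugation $d\mapsto v\circ d\circ v^{-1}$. A morphism $F\to F'$ is sent to the pair of its restriction to the diagonals and the map it induces on $\overline{k}$-points over $\overline{k}$. *)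

(* Defs.v *)
From HB Require Import structures.
From mathcomp Require Import all_boot all_algebra all_field.
From mathcomp Require Import boolp classical_sets functions filter.
From mathcomp Require Import topology_structure product_topology.
From mathcomp Require Import subspace_topology.

Set Implicit Arguments.
Unset Strict Implicit.
Unset Printing Implicit Defensive.

Import GRing.Theory.
Local Open Scope classical_set_scope.
Local Open Scope ring_scope.
Local Open Scope quotient_scope.

(* Every scheme here is affine: a groupoid F that is affine over              *)
(* Spec kbar x_k Spec kbar is itself an affine scheme. An affine scheme is    *)
(* represented by its ring of functions, and a morphism Z -> Z' by the ring   *)
(* morphism O(Z') -> O(Z) in the opposite direction. Group and groupoid       *)
(* structures are given on R-valued points, naturally in the ring R.          *)

Record category := Category {
  ob :> Type;
  hom : ob -> ob -> Type;
  idm : forall x, hom x x;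
  compm : forall x y z, hom y z -> hom x y -> hom x z;
  compm1 : forall x y (f : hom x y), compm f (idm x) = f;
  comp1m : forall x y (f : hom x y), compm (idm y) f = f;
  compmA : forall x y z t (f : hom z t) (g : hom y z) (h : hom x y),
    compm f (compm g h) = compm (compm f g) h }.

Record functor (C D : category) := Functor {
  fob :> C -> D;
  fmap : forall x y, hom x y -> hom (fob x) (fob y);
  fmap1 : forall x, fmap (idm x) = idm (fob x);
  fmapM : forall x y z (f : hom y z) (g : hom x y),
    fmap (compm f g) = compm (fmap f) (fmap g) }.

Definition id_functor (C : category) : functor C C :=
  @Functor C C id (fun _ _ f => f) (fun _ => erefl) (fun _ _ _ _ _ => erefl).

Section FunctorComp.
Variables (C D E : category) (G : functor D E) (F : functor C D).

Fact fcomp1 x : fmap G (fmap F (idm x)) = idm (G (F x)).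
Proof. by rewrite !fmap1. Qed.

Fact fcompM x y z (f : hom y z) (g : hom x y) :
  fmap G (fmap F (compm f g)) = compm (fmap G (fmap F f)) (fmap G (fmap F g)).
Proof. by rewrite !fmapM. Qed.

Definition comp_functor : functor C E := Functor fcomp1 fcompM.
End FunctorComp.

Definition isomorphism (C : category) (x y : C) (f : hom x y) :=
  exists g : hom y x, compm g f = idm x /\ compm f g = idm y.

Definition naturally_isomorphic (C D : category) (F G : functor C D) :=
  exists eta : forall x, hom (F x) (G x),
    (forall x y (f : hom x y),
       compm (fmap G f) (eta x) = compm (eta y) (fmap F f)) /\
    (forall x, isomorphism (eta x)).

Definition is_equivalence (C D : category) (F : functor C D) :=
  exists G : functor D C,
    naturally_isomorphic (comp_functor G F) (id_functor C) /\
    naturally_isomorphic (comp_functor F G) (id_functor D).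

Definition rid (A : pzSemiRingType) : {rmorphism A -> A} := idfun.

Definition rcomp (A B C : pzSemiRingType) (g : {rmorphism B -> C})
  (f : {rmorphism A -> B}) : {rmorphism A -> C} := g \o f.

Lemma rmorph_ext (A B : pzSemiRingType) (f g : {rmorphism A -> B}) :
  f =1 g -> f = g.
Proof.
case: f g => [f cf] [g cg] /= /funext fg; subst g; congr GRing.RMorphism.Pack.
case: cf cg => [[f1] [f2]] [[g1] [g2]].
by rewrite (Prop_irrelevance f1 g1) (Prop_irrelevance f2 g2).
Qed.

Section InverseMorphism.
Variables (A B : pzRingType) (f : {rmorphism A -> B}) (bij_f : bijective f).

Fact inv_subproof : {g : B -> A | cancel f g /\ cancel g f}.
Proof. by apply: cid; case: bij_f => g fK gK; exists g. Qed.

Definition rinv_fun : B -> A := sval inv_subproof.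

Lemma rinvK : cancel f rinv_fun. Proof. exact: (svalP inv_subproof).1. Qed.
Lemma rinvKV : cancel rinv_fun f. Proof. exact: (svalP inv_subproof).2. Qed.

Fact rinv_is_zmod : zmod_morphism rinv_fun.
Proof. exact: can2_zmod_morphism rinvK rinvKV. Qed.
Fact rinv_is_monoid : monoid_morphism rinv_fun.
Proof. exact: can2_monoid_morphism rinvK rinvKV. Qed.

HB.instance Definition _ :=
  GRing.isZmodMorphism.Build B A rinv_fun rinv_is_zmod.
HB.instance Definition _ :=
  GRing.isMonoidMorphism.Build B A rinv_fun rinv_is_monoid.

Definition rinv : {rmorphism B -> A} := rinv_fun.
End InverseMorphism.

Inductive rexpr (X : Type) :=
  | RVar of X
  | RZero | ROne
  | RAdd of rexpr X & rexpr X
  | RMul of rexpr X & rexpr X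
  | ROpp of rexpr X.

HB.instance Definition _ X := gen_eqMixin (rexpr X).
HB.instance Definition _ X := gen_choiceMixin (rexpr X).

Fixpoint reval (X : Type) (R : comPzRingType) (v : X -> R) (e : rexpr X) : R :=
  match e with
  | RVar x => v x
  | RZero => 0
  | ROne => 1
  | RAdd e1 e2 => reval v e1 + reval v e2
  | RMul e1 e2 => reval v e1 * reval v e2
  | ROpp e1 => - reval v e1
  end.

(* The commutative ring generated by X, two ring expressions being equal when *)
(* they take the same value at every P-admissible X -> R, for every R. When P *)
(* consists of ring equations between the values at X, this is the ring       *)
(* presented by the generators X and the relations P.                         *)
Section PresentedRing.
Variables (X : Type) (P : forall R : comPzRingType, (X -> R) -> Prop).

Definition rexpr_eqv : rel (rexpr X) := fun e f =>
  `[< forall (R : comPzRingType) (v : X -> R), P v -> reval v e = reval v f >].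

Fact rexpr_eqv_is_equiv : equiv_class_of rexpr_eqv.
Proof.
split=> [e|e f|e f g]; first exact/asboolP.
  by apply/asbool_equiv_eq; split=> h R v Pv; rewrite h.
by move=> /asboolP fe /asboolP eg; apply/asboolP => R v Pv; rewrite fe ?eg.
Qed.

Canonical rexpr_equiv := EquivRelPack rexpr_eqv_is_equiv.

Definition presented := {eq_quot rexpr_equiv}.
HB.instance Definition _ := Choice.on presented.

Definition pr_of (e : rexpr X) : presented := \pi e.
Definition pr_eval (R : comPzRingType) (v : X -> R) (a : presented) : R :=
  reval v (repr a).

Lemma pr_evalE (R : comPzRingType) (v : X -> R) e :
  P v -> pr_eval v (pr_of e) = reval v e.
Proof.
move=> Pv; rewrite /pr_eval.
have /eqmodP/asboolP/(_ _ _ Pv) // : repr (pr_of e) = e %[mod presented].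
by rewrite reprK.
Qed.

Lemma presentedP (a b : presented) :
  (forall (R : comPzRingType) (v : X -> R), P v -> pr_eval v a = pr_eval v b) ->
  a = b.
Proof. by move=> h; rewrite -(reprK a) -(reprK b); apply/eqmodP/asboolP. Qed.

Definition pr_zero := pr_of (RZero X).
Definition pr_one := pr_of (ROne X).
Definition pr_add (a b : presented) := pr_of (RAdd (repr a) (repr b)).
Definition pr_mul (a b : presented) := pr_of (RMul (repr a) (repr b)).
Definition pr_opp (a : presented) := pr_of (ROpp (repr a)).

Section Eval.
Variables (R : comPzRingType) (v : X -> R) (Pv : P v).
Lemma pr_eval0 : pr_eval v pr_zero = 0. Proof. exact: pr_evalE. Qed.
Lemma pr_eval1 : pr_eval v pr_one = 1. Proof. exact: pr_evalE. Qed.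
Lemma pr_evalD a b : pr_eval v (pr_add a b) = pr_eval v a + pr_eval v b.
Proof. exact: pr_evalE. Qed.
Lemma pr_evalM a b : pr_eval v (pr_mul a b) = pr_eval v a * pr_eval v b.
Proof. exact: pr_evalE. Qed.
Lemma pr_evalN a : pr_eval v (pr_opp a) = - pr_eval v a.
Proof. exact: pr_evalE. Qed.
Definition pr_evals := (pr_eval0, pr_eval1, pr_evalD, pr_evalM, pr_evalN).
End Eval.

Fact pr_addA : associative pr_add.
Proof.
by move=> a b c; apply: presentedP => R v Pv; rewrite !pr_evals // addrA.
Qed.
Fact pr_addC : commutative pr_add.
Proof.
by move=> a b; apply: presentedP => R v Pv; rewrite !pr_evals // addrC.
Qed.
Fact pr_add0 : left_id pr_zero pr_add.
Proof.
by move=> a; apply: presentedP => R v Pv; rewrite !pr_evals // add0r.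
Qed.
Fact pr_addN : left_inverse pr_zero pr_opp pr_add.
Proof.
by move=> a; apply: presentedP => R v Pv; rewrite !pr_evals // addNr.
Qed.
Fact pr_mulA : associative pr_mul.
Proof.
by move=> a b c; apply: presentedP => R v Pv; rewrite !pr_evals // mulrA.
Qed.
Fact pr_mulC : commutative pr_mul.
Proof.
by move=> a b; apply: presentedP => R v Pv; rewrite !pr_evals // mulrC.
Qed.
Fact pr_mul1 : left_id pr_one pr_mul.
Proof.
by move=> a; apply: presentedP => R v Pv; rewrite !pr_evals // mul1r.
Qed.
Fact pr_mulD : left_distributive pr_mul pr_add.
Proof.
by move=> a b c; apply: presentedP => R v Pv; rewrite !pr_evals // mulrDl.
Qed.

HB.instance Definition _ :=
  GRing.isZmodule.Build presented pr_addA pr_addC pr_add0 pr_addN.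
HB.instance Definition _ :=
  GRing.Zmodule_isComPzRing.Build presented pr_mulA pr_mulC pr_mul1 pr_mulD.

Definition pr_gen (x : X) : presented := pr_of (RVar x).

Section Lift.
Variables (R : comPzRingType) (v : X -> R) (Pv : P v).

Fact pr_eval_is_zmod : zmod_morphism (pr_eval v).
Proof. by move=> a b; rewrite (pr_evalD Pv) (pr_evalN Pv). Qed.
Fact pr_eval_is_monoid : monoid_morphism (pr_eval v).
Proof. by split=> [|a b]; [exact: pr_eval1|exact: pr_evalM]. Qed.

Definition pr_lift : {rmorphism presented -> R} :=
  HB.pack (pr_eval v)
    (GRing.isZmodMorphism.Build presented R (pr_eval v) pr_eval_is_zmod)
    (GRing.isMonoidMorphism.Build presented R (pr_eval v) pr_eval_is_monoid).

Lemma pr_liftE x : pr_lift (pr_gen x) = v x. Proof. exact: pr_evalE. Qed.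
End Lift.

Lemma pr_reval (e : rexpr X) : reval pr_gen e = pr_of e.
Proof.
elim: e => //= [e -> f ->|e -> f ->|e ->];
  by apply: presentedP => R v Pv; rewrite ?(pr_evals Pv) !(pr_evalE _ Pv).
Qed.

Lemma pr_hom_ext (R : comPzRingType) (f g : {rmorphism presented -> R}) :
  (forall x, f (pr_gen x) = g (pr_gen x)) -> f = g.
Proof.
move=> fg; apply: rmorph_ext => a; rewrite -(reprK a) -[\pi _]pr_reval.
by elim: (repr a) => //= [||e he e' he'|e he e' he'|e he];
  rewrite ?rmorph0 ?rmorph1 ?rmorphD ?rmorphM ?rmorphN ?he ?he'.
Qed.
End PresentedRing.

Section Tensor.
Variables (K A B : comPzRingType).
Variables (a : {rmorphism K -> A}) (b : {rmorphism K -> B}).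

Definition tensor_rel (R : comPzRingType) (v : A + B -> R) : Prop :=
  exists (f : {rmorphism A -> R}) (g : {rmorphism B -> R}),
    [/\ forall c, f (a c) = g (b c),
        forall x, v (inl x) = f x & forall y, v (inr y) = g y].

(* A (x)_K B, the coproduct of the K-algebras A and B. *)
Definition tensor : comPzRingType := presented tensor_rel.

Definition tensor_inl_fun (x : A) : tensor := pr_gen tensor_rel (inl x).
Definition tensor_inr_fun (y : B) : tensor := pr_gen tensor_rel (inr y).

Fact tensor_inl_is_zmod : zmod_morphism tensor_inl_fun.
Proof.
move=> x y; apply: presentedP => R v Pv; case: (Pv) => f [g [_ vf _]].
by rewrite (pr_evalD Pv) (pr_evalN Pv) !(pr_evalE _ Pv) /= !vf rmorphB.
Qed.
Fact tensor_inl_is_monoid : monoid_morphism tensor_inl_fun.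
Proof.
split=> [|x y]; apply: presentedP => R v Pv; case: (Pv) => f [g [_ vf _]].
  by rewrite (pr_eval1 Pv) (pr_evalE _ Pv) /= vf rmorph1.
by rewrite (pr_evalM Pv) !(pr_evalE _ Pv) /= !vf rmorphM.
Qed.
Fact tensor_inr_is_zmod : zmod_morphism tensor_inr_fun.
Proof.
move=> x y; apply: presentedP => R v Pv; case: (Pv) => f [g [_ _ vg]].
by rewrite (pr_evalD Pv) (pr_evalN Pv) !(pr_evalE _ Pv) /= !vg rmorphB.
Qed.
Fact tensor_inr_is_monoid : monoid_morphism tensor_inr_fun.
Proof.
split=> [|x y]; apply: presentedP => R v Pv; case: (Pv) => f [g [_ _ vg]].
  by rewrite (pr_eval1 Pv) (pr_evalE _ Pv) /= vg rmorph1.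
by rewrite (pr_evalM Pv) !(pr_evalE _ Pv) /= !vg rmorphM.
Qed.

HB.instance Definition _ :=
  GRing.isZmodMorphism.Build A tensor tensor_inl_fun tensor_inl_is_zmod.
HB.instance Definition _ :=
  GRing.isMonoidMorphism.Build A tensor tensor_inl_fun tensor_inl_is_monoid.
HB.instance Definition _ :=
  GRing.isZmodMorphism.Build B tensor tensor_inr_fun tensor_inr_is_zmod.
HB.instance Definition _ :=
  GRing.isMonoidMorphism.Build B tensor tensor_inr_fun tensor_inr_is_monoid.

Definition tensor_inl : {rmorphism A -> tensor} := tensor_inl_fun.
Definition tensor_inr : {rmorphism B -> tensor} := tensor_inr_fun.

Lemma tensor_comm c : tensor_inl (a c) = tensor_inr (b c).
Proof.
apply: presentedP => R v Pv; case: (Pv) => f [g [fg vf vg]].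
by rewrite !(pr_evalE _ Pv) /= vf vg.
Qed.

Lemma tensor_hom_ext (R : comPzRingType) (f g : {rmorphism tensor -> R}) :
  (forall x, f (tensor_inl x) = g (tensor_inl x)) ->
  (forall y, f (tensor_inr y) = g (tensor_inr y)) -> f = g.
Proof. by move=> fl fr; apply: pr_hom_ext => -[x|y]; [exact: fl|exact: fr]. Qed.

Section Lift.
Variables (R : comPzRingType) (f : {rmorphism A -> R}) (g : {rmorphism B -> R}).
Hypothesis fg : forall c, f (a c) = g (b c).

Definition tensor_val (s : A + B) : R :=
  match s with inl x => f x | inr y => g y end.

Fact tensor_val_rel : tensor_rel tensor_val.
Proof. by exists f, g. Qed.

Definition tensor_lift : {rmorphism tensor -> R} := pr_lift tensor_val_rel.

Lemma tensor_liftl x : tensor_lift (tensor_inl x) = f x.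
Proof. exact: pr_liftE. Qed.

Lemma tensor_liftr y : tensor_lift (tensor_inr y) = g y.
Proof. exact: pr_liftE. Qed.
End Lift.
End Tensor.

Section Coequaliser.
Variables (K A : comPzRingType) (a b : {rmorphism K -> A}).

Definition coeq_rel (R : comPzRingType) (v : A -> R) : Prop :=
  exists f : {rmorphism A -> R}, (forall c, f (a c) = f (b c)) /\ v =1 f.

Definition coeq : comPzRingType := presented coeq_rel.

Definition coeq_fun : A -> coeq := @pr_gen A coeq_rel.

Fact coeq_fun_is_zmod : zmod_morphism coeq_fun.
Proof.
move=> x y; apply: presentedP => R v Pv; case: (Pv) => f [_ vf].
by rewrite (pr_evalD Pv) (pr_evalN Pv) !(pr_evalE _ Pv) /= !vf rmorphB.
Qed.
Fact coeq_fun_is_monoid : monoid_morphism coeq_fun.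
Proof.
split=> [|x y]; apply: presentedP => R v Pv; case: (Pv) => f [_ vf].
  by rewrite (pr_eval1 Pv) (pr_evalE _ Pv) /= vf rmorph1.
by rewrite (pr_evalM Pv) !(pr_evalE _ Pv) /= !vf rmorphM.
Qed.

HB.instance Definition _ :=
  GRing.isZmodMorphism.Build A coeq coeq_fun coeq_fun_is_zmod.
HB.instance Definition _ :=
  GRing.isMonoidMorphism.Build A coeq coeq_fun coeq_fun_is_monoid.

Definition coeq_map : {rmorphism A -> coeq} := coeq_fun.

Lemma coeq_mapE c : coeq_map (a c) = coeq_map (b c).
Proof.
apply: presentedP => R v Pv; case: (Pv) => f [fE vf].
by rewrite !(pr_evalE _ Pv) /= !vf.
Qed.

Section Lift.
Variables (R : comPzRingType) (f : {rmorphism A -> R}).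
Hypothesis fE : forall c, f (a c) = f (b c).

Fact coeq_val_rel : coeq_rel f. Proof. by exists f. Qed.

Definition coeq_lift : {rmorphism coeq -> R} := pr_lift coeq_val_rel.

Lemma coeq_liftE x : coeq_lift (coeq_map x) = f x.
Proof. exact: pr_liftE. Qed.
End Lift.

Lemma coeq_hom_ext (R : comPzRingType) (f g : {rmorphism coeq -> R}) :
  (forall x, f (coeq_map x) = g (coeq_map x)) -> f = g.
Proof. exact: pr_hom_ext. Qed.
End Coequaliser.

Section Spectrum.
Variable B : comPzRingType.

Record spec := Spec {
  prime_set : set B;
  prime0 : prime_set 0;
  primeD : forall x y, prime_set x -> prime_set y -> prime_set (x + y);
  primeMl : forall x y, prime_set y -> prime_set (x * y);
  prime1 : ~ prime_set 1;
  primeM : forall x y, prime_set (x * y) -> prime_set x \/ prime_set y }.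

HB.instance Definition _ := gen_eqMixin spec.
HB.instance Definition _ := gen_choiceMixin spec.

Definition zariski_open : set_system spec :=
  [set U | exists I : set B, U = [set p : spec | ~ (I `<=` prime_set p)]].

Fact zariski_openT : zariski_open setT.
Proof.
exists setT; apply/seteqP; split=> // p _ /= Tp.
exact: (@prime1 p) (Tp 1 I).
Qed.

Fact zariski_openI : setI_closed zariski_open.
Proof.
move=> U V [I ->] [J ->].
exists [set z | exists x y, [/\ I x, J y & z = x * y]].
apply/seteqP; split=> [p [nI nJ] IJp|p nIJ].
  have [x /not_implyP[Ix px]] : exists x, ~ (I x -> prime_set p x).
    by apply: contrapT => /forallNP h; apply: nI => x; apply: contrapT.
  have [y /not_implyP[Jy py]] : exists y, ~ (J y -> prime_set p y).
    by apply: contrapT => /forallNP h; apply: nJ => y; apply: contrapT.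
  by have [|//|//] := @primeM p x y; apply: IJp; exists x, y.
split=> /= h; apply: nIJ => _ [x [y [Ix Jy ->]]].
  by rewrite mulrC; apply/primeMl/h.
exact/primeMl/h.
Qed.

Fact zariski_open_bigU (T : Type) (f : T -> set spec) :
  (forall i, zariski_open (f i)) -> zariski_open (\bigcup_i f i).
Proof.
move=> /(_ _)/cid fE; exists (\bigcup_i sval (fE i)).
apply/seteqP; split=> [p [i _]|p /= np].
  rewrite (svalP (fE i)) /= => np h; apply: np => x Ix.
  by apply: h; exists i.
apply: contrapT => nf; apply: np => x [i _ Ix].
apply: contrapT => npx; apply: nf; exists i => //.
by rewrite (svalP (fE i)) /= => /(_ x Ix).
Qed.

HB.instance Definition _ := isOpenTopological.Build spec
  zariski_openT zariski_openI zariski_open_bigU.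

(* The fraction a / s in the local ring of B at p, as the set of all pairs    *)
(* (b, t) with t outside p and b / t = a / s.                                 *)
Definition germ_frac (p : spec) (a s : B) : set (B * B) :=
  [set bt | ~ prime_set p bt.2 /\
     exists u, ~ prime_set p u /\ u * (a * bt.2) = u * (bt.1 * s)].

(* Sections over U of the structure sheaf: families of germs that are locally *)
(* given by a fraction.                                                       *)
Definition is_section (U : set spec) (f : spec -> set (B * B)) :=
  forall p, U p -> exists (V : set spec) (a s : B),
    [/\ open V, V p, V `<=` U &
        forall q, V q -> ~ prime_set q s /\ f q = germ_frac q a s].
End Spectrum.

Section SpectrumMap.
Variables (A B : comPzRingType) (f : {rmorphism A -> B}).

Definition spec_map (p : spec B) : spec A.
Proof.
apply: (@Spec A [set x | prime_set p (f x)]) => /=.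
- by rewrite rmorph0; exact: prime0.
- by move=> x y; rewrite rmorphD; exact: primeD.
- by move=> x y; rewrite rmorphM; exact: primeMl.
- by rewrite rmorph1; exact: prime1.
- by move=> x y; rewrite rmorphM; exact: primeM.
Defined.

(* The map on stalks A_(f^-1 p) -> B_p sending a / s to f a / f s. *)
Definition germ_pull (p : spec B) (G : set (A * A)) : set (B * B) :=
  [set bt | exists a s, G (a, s) /\ germ_frac p (f a) (f s) bt].
End SpectrumMap.

Section Flat.
Variables (R S : comPzRingType) (phi : {rmorphism R -> S}).

(* \sum_i a_i (x) m_i = 0 in S (x)_R M, where s lists the pairs (a_i, m_i):   *)
(* the sum is killed by every R-balanced biadditive map.                      *)
Definition tensor_sum_eq0 (M : lmodType R) (s : seq (S * M)) :=
  forall (Q : zmodType) (beta : S -> M -> Q),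
    (forall m, {morph beta^~ m : a b / a + b}) ->
    (forall a, {morph beta a : m n / m + n}) ->
    (forall a r m, beta (a * phi r) m = beta a (r *: m)) ->
    \sum_(am <- s) beta am.1 am.2 = 0.

Definition flat :=
  forall (M N : lmodType R) (f : {linear M -> N}), injective f ->
  forall s : seq (S * M),
    tensor_sum_eq0 [seq (am.1, f am.2) | am <- s] -> tensor_sum_eq0 s.

Definition faithfully_flat :=
  flat /\ forall p : spec R, exists q : spec S, spec_map phi q = p.
End Flat.

(* Open sets of the topology of pointwise convergence, X -> Y being discrete  *)
(* in each coordinate.                                                        *)
Section Krull.
Variables (T X Y : Type) (ev : T -> X -> Y).

Definition krull_open : set_system T :=
  [set U | forall z, U z -> exists s : seq X,
     forall w, map (ev w) s = map (ev z) s -> U w].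

Fact krull_openT : krull_open setT. Proof. by move=> z _; exists [::]. Qed.

Fact krull_openI : setI_closed krull_open.
Proof.
move=> U V oU oV z [/oU[s sU] /oV[t tV]]; exists (s ++ t) => w.
rewrite !map_cat => wz; split; [apply: sU|apply: tV].
  by have /(congr1 (take (size s))) := wz; rewrite !take_size_cat ?size_map.
by have /(congr1 (drop (size s))) := wz; rewrite !drop_size_cat ?size_map.
Qed.

Fact krull_open_bigU (I : Type) (f : I -> set T) :
  (forall i, krull_open (f i)) -> krull_open (\bigcup_i f i).
Proof.
move=> of_ z [i _ fz]; have [s sf] := of_ i z fz.
by exists s => w /sf fw; exists i.
Qed.
End Krull.

Local Open Scope group_scope.

#[short(type="groupTopType")]
HB.structure Definition GroupTop := {G of Group G & Topological G}.

Definition is_topological_group (G : groupTopType) :=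
  continuous (fun xy : G * G => xy.1 * xy.2) /\
  continuous (fun x : G => x^-1).

Section TopologicalExtension.
Variables (G'' G G' : groupTopType) (i : G'' -> G) (p : G -> G').

Record topological_extension : Prop := {
  te_group'' : is_topological_group G'';
  te_group : is_topological_group G;
  te_group' : is_topological_group G';
  te_inclM : {morph i : x y / x * y};
  te_projM : {morph p : x y / x * y};
  te_incl_cont : continuous i;
  te_proj_cont : continuous p;
  te_incl_inj : injective i;
  te_exact : forall x, p x = 1 <-> exists z, i z = x;
  te_incl_open : forall U : set G'', open U ->
    exists V : set G, open V /\ U = i @^-1` V;
  te_section : forall s : G', exists (U : set G') (q : G' -> G),
    [/\ open U, U s, {within U, continuous q} & forall t, U t -> p (q t) = t] }.
End TopologicalExtension.

Local Close Scope group_scope.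

Definition perfect_field (k : fieldType) :=
  forall p : {poly k}, irreducible_poly p -> separable_poly p.

Section GaloisExtendedGroups.
Variables (k : fieldType) (kbar : closedFieldType).
Variable iota : {rmorphism k -> kbar}.

Record gal := Gal {
  gal_hom :> {rmorphism kbar -> kbar};
  gal_bij : bijective gal_hom;
  gal_fix : forall c, gal_hom (iota c) = iota c }.

Lemma gal_ext (s t : gal) : s =1 t -> s = t.
Proof.
case: s t => [s bs fs] [t bt ft] /= /rmorph_ext st; subst t.
by rewrite (Prop_irrelevance bs bt) (Prop_irrelevance fs ft).
Qed.

HB.instance Definition _ := gen_eqMixin gal.
HB.instance Definition _ := gen_choiceMixin gal.

Definition gal_one : gal :=
  @Gal (rid kbar) (Bijective (frefl id) (frefl id)) (fun=> erefl).

Definition gal_mul (s t : gal) : gal.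
Proof.
apply: (@Gal (rcomp s t)) => [|c]; last by rewrite /= !gal_fix.
exact: bij_comp (gal_bij s) (gal_bij t).
Defined.

Definition gal_inv (s : gal) : gal.
Proof.
apply: (@Gal (rinv (gal_bij s))) => [|c].
  by exists s; [exact: rinvKV|exact: rinvK].
exact: canLR (rinvK (gal_bij s)) (esym (gal_fix s c)).
Defined.

Fact gal_mulA : associative gal_mul.
Proof. by move=> s t u; exact: gal_ext. Qed.
Fact gal_mul1 : left_id gal_one gal_mul.
Proof. by move=> s; exact: gal_ext. Qed.
Fact gal_mulr1 : right_id gal_one gal_mul.
Proof. by move=> s; exact: gal_ext. Qed.
Fact gal_mulV : left_inverse gal_one gal_inv gal_mul.
Proof. by move=> s; apply: gal_ext => x /=; exact: rinvK. Qed.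
Fact gal_mulrV : right_inverse gal_one gal_inv gal_mul.
Proof. by move=> s; apply: gal_ext => x /=; exact: rinvKV. Qed.

HB.instance Definition _ :=
  isGroup.Build gal gal_mulA gal_mul1 gal_mulr1 gal_mulV gal_mulrV.

Definition gal_fun (s : gal) : kbar -> kbar := s.

HB.instance Definition _ := isOpenTopological.Build gal
  (krull_openT gal_fun) (@krull_openI _ _ _ gal_fun)
  (@krull_open_bigU _ _ _ gal_fun).

Lemma galVK (s : gal) : cancel s (s^-1)%g. Proof. exact: rinvK. Qed.
Lemma galKV (s : gal) : cancel (s^-1)%g s. Proof. exact: rinvKV. Qed.

(* The points of Z = Spec B, with structural morphism str : kbar -> B, in the *)
(* kbar-algebra (R, x).                                                       *)
Record pt (B : comPzRingType) (str : {rmorphism kbar -> B})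
    (R : comPzRingType) (x : {rmorphism kbar -> R}) := Pt {
  pt_hom :> {rmorphism B -> R};
  pt_str : forall c, pt_hom (str c) = x c }.

Section Points.
Variables (B : comPzRingType) (str : {rmorphism kbar -> B}).

Lemma pt_ext (R : comPzRingType) (x : {rmorphism kbar -> R}) (u v : pt str x) :
  u =1 v -> u = v.
Proof.
case: u v => [u hu] [v hv] /= /rmorph_ext uv; subst v.
by rewrite (Prop_irrelevance hu hv).
Qed.

Definition pt_map (R S : comPzRingType) (f : {rmorphism R -> S})
    (x : {rmorphism kbar -> R}) (u : pt str x) : pt str (rcomp f x) :=
  @Pt _ str _ (rcomp f x) (rcomp f u) (fun c => congr1 f (pt_str u c)).

Definition kpt := pt str (rid kbar).

(* A kbar-point over kbar, seen over the kbar-algebra (R, x). *)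
Definition kpt_const (z : kpt) (R : comPzRingType) (x : {rmorphism kbar -> R}) :
    pt str x :=
  @Pt _ str _ x (rcomp x z) (fun c => congr1 x (pt_str z c)).

HB.instance Definition _ := gen_eqMixin kpt.
HB.instance Definition _ := gen_choiceMixin kpt.
Definition pt_fun (z : kpt) : B -> kbar := z.

HB.instance Definition _ := isOpenTopological.Build kpt
  (krull_openT pt_fun) (@krull_openI _ _ _ pt_fun)
  (@krull_open_bigU _ _ _ pt_fun).
End Points.

(* phi is the ring morphism of a s-morphism Spec B -> Spec B'. *)
Definition sigma_morphism (s : gal) (B B' : comPzRingType)
    (str : {rmorphism kbar -> B}) (str' : {rmorphism kbar -> B'})
    (phi : {rmorphism B' -> B}) :=
  forall c, phi (str' c) = str ((s^-1)%g c).

Section SigmaMorphism.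
Variables (s : gal) (B B' : comPzRingType).
Variables (str : {rmorphism kbar -> B}) (str' : {rmorphism kbar -> B'}).
Variables (phi : {rmorphism B' -> B}) (h : sigma_morphism s str str' phi).

Definition sigma_pt (R : comPzRingType) (x : {rmorphism kbar -> R})
    (u : pt str x) : pt str' (rcomp x (s^-1)%g).
Proof. by apply: (@Pt _ _ _ _ (rcomp u phi)) => c; rewrite /= h pt_str. Defined.

Definition sigma_kpt (z : kpt str) : kpt str'.
Proof.
by apply: (@Pt _ _ _ _ (rcomp s (rcomp z phi))) => c;
  rewrite /= h pt_str /= galKV.
Defined.
End SigmaMorphism.

Record affine_group := AffineGroup {
  ag_ring :> comPzRingType;
  ag_str : {rmorphism kbar -> ag_ring};
  ag_mul : forall (R : comPzRingType) (x : {rmorphism kbar -> R}),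
    pt ag_str x -> pt ag_str x -> pt ag_str x;
  ag_one : forall (R : comPzRingType) (x : {rmorphism kbar -> R}), pt ag_str x;
  ag_inv : forall (R : comPzRingType) (x : {rmorphism kbar -> R}),
    pt ag_str x -> pt ag_str x;
  ag_mulA : forall R x, associative (@ag_mul R x);
  ag_mul1 : forall R x, left_id (@ag_one R x) (@ag_mul R x);
  ag_mulr1 : forall R x, right_id (@ag_one R x) (@ag_mul R x);
  ag_mulV : forall R x, left_inverse (@ag_one R x) (@ag_inv R x) (@ag_mul R x);
  ag_mulrV : forall R x,
    right_inverse (@ag_one R x) (@ag_inv R x) (@ag_mul R x);
  ag_nat_mul : forall (R S : comPzRingType) (f : {rmorphism R -> S})
    (x : {rmorphism kbar -> R}) (u v : pt ag_str x),
    pt_map f (ag_mul u v) = ag_mul (pt_map f u) (pt_map f v) }.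

Definition ag_kpt (D : affine_group) := kpt (ag_str D).

HB.instance Definition _ (D : affine_group) := Topological.on (ag_kpt D).
HB.instance Definition _ (D : affine_group) := isGroup.Build (ag_kpt D)
  (@ag_mulA D kbar (rid kbar)) (@ag_mul1 D kbar (rid kbar))
  (@ag_mulr1 D kbar (rid kbar)) (@ag_mulV D kbar (rid kbar))
  (@ag_mulrV D kbar (rid kbar)).

Definition ag_conj (D : affine_group) (R : comPzRingType)
    (x : {rmorphism kbar -> R}) (w u : pt (ag_str D) x) :=
  ag_mul (ag_mul w u) (ag_inv w).

(* The ring morphism h is that of a morphism D -> D' of kbar-groups. *)
Section GroupHom.
Variables (D D' : affine_group) (h : {rmorphism D' -> D}).

Definition is_kbar_hom := forall c, h (ag_str D' c) = ag_str D c.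

Definition hom_pt (hk : is_kbar_hom) (R : comPzRingType)
    (x : {rmorphism kbar -> R}) (u : pt (ag_str D) x) : pt (ag_str D') x.
Proof. by apply: (@Pt _ _ _ _ (rcomp u h)) => c; rewrite /= hk pt_str. Defined.

Definition is_group_hom (hk : is_kbar_hom) :=
  forall (R : comPzRingType) (x : {rmorphism kbar -> R})
    (u v : pt (ag_str D) x),
    hom_pt hk (ag_mul u v) = ag_mul (hom_pt hk u) (hom_pt hk v).
End GroupHom.

Record sigma_automorphism (s : gal) (D : affine_group)
    (phi : {rmorphism D -> D}) : Prop := {
  sa_sigma : sigma_morphism s (ag_str D) (ag_str D) phi;
  sa_bij : bijective phi;
  sa_mul : forall (R : comPzRingType) (x : {rmorphism kbar -> R})
    (u v : pt (ag_str D) x),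
    sigma_pt sa_sigma (ag_mul u v) =
      ag_mul (sigma_pt sa_sigma u) (sigma_pt sa_sigma v) }.

(* act m is the ring morphism of the action of m on the scheme Spec B. *)
Record continuous_action (M : groupTopType) (B : comPzRingType)
    (act : M -> {rmorphism B -> B}) : Prop := {
  ca_one : forall b, act 1%g b = b;
  ca_mul : forall m n b, act (m * n)%g b = act n (act m b);
  ca_space : continuous (fun mz : M * spec B => spec_map (act mz.1) mz.2);
  ca_sheaf : forall (U : set (spec B)) (f : spec B -> set (B * B)),
    open U -> is_section U f ->
    forall (m0 : M) (z0 : spec B), U (spec_map (act m0) z0) ->
    exists (N : set M) (V : set (spec B)) (g : spec B -> set (B * B)),
      [/\ open N, N m0, open V, V z0 & is_section V g /\
        forall m z, N m -> V z ->
          U (spec_map (act m) z) /\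
          germ_pull (act m) z (f (spec_map (act m) z)) = g z] }.

Record extended_data := ExtendedData {
  ed_D : affine_group;
  ed_E : groupTopType;
  ed_incl : ag_kpt ed_D -> ed_E;
  ed_proj : ed_E -> gal;
  ed_act : ed_E -> {rmorphism ed_D -> ed_D} }.

Record is_galois_extended (X : extended_data) : Prop := {
  ge_ext : topological_extension (@ed_incl X) (@ed_proj X);
  ge_act : continuous_action (@ed_act X);
  ge_fix : forall (e : ed_E X) c,
    ed_act e (ag_str (ed_D X) (iota c)) = ag_str (ed_D X) (iota c);
  ge_sigma : forall e : ed_E X, sigma_automorphism (ed_proj e) (ed_act e);
  ge_conj : forall (e : ed_E X) (z : ag_kpt (ed_D X)),
    ed_incl (sigma_kpt (sa_sigma (ge_sigma e)) z : ag_kpt (ed_D X)) =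
      (e * ed_incl z * e^-1)%g;
  ge_inner : forall (z : ag_kpt (ed_D X)) (R : comPzRingType)
    (x : {rmorphism kbar -> R}) (u : pt (ag_str (ed_D X)) x) b,
    u (ed_act (ed_incl z) b) = ag_conj (kpt_const z x) u b }.

Record extended_hom (X Y : extended_data) := ExtendedHom {
  eh_D : {rmorphism ed_D Y -> ed_D X};
  eh_E : ed_E X -> ed_E Y;
  eh_kbar : is_kbar_hom eh_D;
  eh_group : is_group_hom eh_kbar;
  eh_mul : {morph eh_E : x y / (x * y)%g};
  eh_cont : continuous eh_E;
  eh_proj : forall e, ed_proj (eh_E e) = ed_proj e;
  eh_incl : forall z : ag_kpt (ed_D X),
    eh_E (ed_incl z) = ed_incl (hom_pt eh_kbar z : ag_kpt (ed_D Y));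
  eh_act : forall e b, ed_act e (eh_D b) = eh_D (ed_act (eh_E e) b) }.

Lemma extended_hom_ext X Y (f g : extended_hom X Y) :
  eh_D f =1 eh_D g -> eh_E f =1 eh_E g -> f = g.
Proof.
case: f g => [f1 f2 a1 a2 a3 a4 a5 a6 a7] [g1 g2 b1 b2 b3 b4 b5 b6 b7] /=.
move=> /rmorph_ext e1 /funext e2; subst g1 g2.
have e := Prop_irrelevance a1 b1; subst b1.
congr ExtendedHom; exact: Prop_irrelevance.
Qed.

Section ExtendedHomId.
Variable X : extended_data.

Fact extended_id_kbar : is_kbar_hom (rid (ed_D X)). Proof. by []. Qed.

Fact extended_id_pt (R : comPzRingType) (x : {rmorphism kbar -> R})
  (u : pt (ag_str (ed_D X)) x) : hom_pt extended_id_kbar u = u.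
Proof. exact: pt_ext. Qed.

Fact extended_id_group : is_group_hom extended_id_kbar.
Proof. by move=> R x u v; rewrite !extended_id_pt. Qed.

Fact extended_id_cont : continuous (@id (ed_E X)).
Proof. by move=> x; exact: cvg_id. Qed.

Fact extended_id_incl (z : ag_kpt (ed_D X)) :
  ed_incl z = ed_incl (hom_pt extended_id_kbar z : ag_kpt (ed_D X)).
Proof. by rewrite extended_id_pt. Qed.

Definition extended_id : extended_hom X X :=
  ExtendedHom extended_id_group (fun _ _ => erefl) extended_id_cont
    (fun=> erefl) extended_id_incl (fun _ _ => erefl).
End ExtendedHomId.

Section ExtendedHomComp.
Variables (X Y Z : extended_data) (f : extended_hom Y Z) (g : extended_hom X Y).

Definition extended_comp_D := rcomp (eh_D g) (eh_D f).
Definition extended_comp_E := eh_E f \o eh_E g.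

Fact extended_comp_kbar : is_kbar_hom extended_comp_D.
Proof. by move=> c; rewrite /= (eh_kbar f) (eh_kbar g). Qed.

Fact extended_comp_pt (R : comPzRingType) (x : {rmorphism kbar -> R})
  (u : pt (ag_str (ed_D X)) x) :
  hom_pt extended_comp_kbar u = hom_pt (eh_kbar f) (hom_pt (eh_kbar g) u).
Proof. exact: pt_ext. Qed.

Fact extended_comp_group : is_group_hom extended_comp_kbar.
Proof.
by move=> R x u v; rewrite !extended_comp_pt (eh_group g) (eh_group f).
Qed.

Fact extended_comp_mul : {morph extended_comp_E : x y / (x * y)%g}.
Proof. by move=> x y; rewrite /extended_comp_E /= (eh_mul g) (eh_mul f). Qed.

Fact extended_comp_cont : continuous extended_comp_E.
Proof. by move=> x; apply: continuous_comp; exact: eh_cont. Qed.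

Fact extended_comp_proj e : ed_proj (extended_comp_E e) = ed_proj e.
Proof. by rewrite /extended_comp_E /= (eh_proj f) (eh_proj g). Qed.

Fact extended_comp_incl (z : ag_kpt (ed_D X)) :
  extended_comp_E (ed_incl z) =
    ed_incl (hom_pt extended_comp_kbar z : ag_kpt (ed_D Z)).
Proof.
by rewrite /extended_comp_E /= (eh_incl g) (eh_incl f) extended_comp_pt.
Qed.

Fact extended_comp_act e b :
  ed_act e (extended_comp_D b) = extended_comp_D (ed_act (extended_comp_E e) b).
Proof. by rewrite /= (eh_act g) (eh_act f). Qed.

Definition extended_comp : extended_hom X Z :=
  ExtendedHom extended_comp_group extended_comp_mul extended_comp_cont
    extended_comp_proj extended_comp_incl extended_comp_act.
End ExtendedHomComp.

Record galois_extended := GaloisExtended {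
  ge_data :> extended_data;
  ge_axioms : is_galois_extended ge_data }.

Definition galois_extended_cat : category.
Proof.
apply: (@Category galois_extended (fun X Y => extended_hom X Y)
  (fun X => extended_id X)
  (fun X Y Z (f : extended_hom Y Z) g => extended_comp f g));
  by move=> *; apply: extended_hom_ext.
Defined.

(* The R-valued arrows y -> x, for R-valued points x, y of Spec kbar. *)
Record arrow (A : comPzRingType) (d0 d1 : {rmorphism kbar -> A})
    (R : comPzRingType) (x y : {rmorphism kbar -> R}) := Arrow {
  ar_hom :> {rmorphism A -> R};
  ar_target : forall c, ar_hom (d0 c) = x c;
  ar_source : forall c, ar_hom (d1 c) = y c }.

Section Arrows.
Variables (A : comPzRingType) (d0 d1 : {rmorphism kbar -> A}).

Lemma arrow_ext (R : comPzRingType) (x y : {rmorphism kbar -> R})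
  (u v : arrow d0 d1 x y) : u =1 v -> u = v.
Proof.
case: u v => [u hu hu'] [v hv hv'] /= /rmorph_ext uv; subst v.
by rewrite (Prop_irrelevance hu hv) (Prop_irrelevance hu' hv').
Qed.

Definition arrow_map (R S : comPzRingType) (f : {rmorphism R -> S})
    (x y : {rmorphism kbar -> R}) (u : arrow d0 d1 x y) :
    arrow d0 d1 (rcomp f x) (rcomp f y) :=
  @Arrow _ d0 d1 _ (rcomp f x) (rcomp f y) (rcomp f u)
    (fun c => congr1 f (ar_target u c)) (fun c => congr1 f (ar_source u c)).
End Arrows.

(* No k-algebra structure on R is needed: by gr_k each R-valued arrow         *)
(* determines one. Identities and inverses are preserved by base change as    *)
(* soon as composition is.                                                    *)
Record groupoid := Groupoid {
  gr_ring :> comPzRingType;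
  gr_d0 : {rmorphism kbar -> gr_ring};
  gr_d1 : {rmorphism kbar -> gr_ring};
  gr_k : forall c, gr_d0 (iota c) = gr_d1 (iota c);
  gr_comp : forall (R : comPzRingType) (x y z : {rmorphism kbar -> R}),
    arrow gr_d0 gr_d1 x y -> arrow gr_d0 gr_d1 y z -> arrow gr_d0 gr_d1 x z;
  gr_id : forall (R : comPzRingType) (x : {rmorphism kbar -> R}),
    arrow gr_d0 gr_d1 x x;
  gr_inv : forall (R : comPzRingType) (x y : {rmorphism kbar -> R}),
    arrow gr_d0 gr_d1 x y -> arrow gr_d0 gr_d1 y x;
  gr_compA : forall (R : comPzRingType) (x y z t : {rmorphism kbar -> R})
    (u : arrow gr_d0 gr_d1 x y) (v : arrow gr_d0 gr_d1 y z)
    (w : arrow gr_d0 gr_d1 z t),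
    gr_comp u (gr_comp v w) = gr_comp (gr_comp u v) w;
  gr_compl1 : forall (R : comPzRingType) (x y : {rmorphism kbar -> R})
    (u : arrow gr_d0 gr_d1 x y), gr_comp (gr_id x) u = u;
  gr_compr1 : forall (R : comPzRingType) (x y : {rmorphism kbar -> R})
    (u : arrow gr_d0 gr_d1 x y), gr_comp u (gr_id y) = u;
  gr_compV : forall (R : comPzRingType) (x y : {rmorphism kbar -> R})
    (u : arrow gr_d0 gr_d1 x y), gr_comp (gr_inv u) u = gr_id y;
  gr_comprV : forall (R : comPzRingType) (x y : {rmorphism kbar -> R})
    (u : arrow gr_d0 gr_d1 x y), gr_comp u (gr_inv u) = gr_id x;
  gr_nat_comp : forall (R S : comPzRingType) (f : {rmorphism R -> S})
    (x y z : {rmorphism kbar -> R})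
    (u : arrow gr_d0 gr_d1 x y) (v : arrow gr_d0 gr_d1 y z),
    arrow_map f (gr_comp u v) = gr_comp (arrow_map f u) (arrow_map f v) }.

Definition gr_arrow (F : groupoid) (R : comPzRingType) :=
  @arrow F (gr_d0 F) (gr_d1 F) R.

(* (d0, d1) : F -> Spec kbar x_k Spec kbar is faithfully flat. *)
Definition is_transitive (F : groupoid) :=
  faithfully_flat (tensor_lift (@gr_k F)).

(* phi is the ring morphism of F -> F'. *)
Section GroupoidHom.
Variables (F F' : groupoid) (phi : {rmorphism F' -> F}).

Definition over_kbar :=
  (forall c, phi (gr_d0 F' c) = gr_d0 F c) /\
  (forall c, phi (gr_d1 F' c) = gr_d1 F c).

Definition hom_arrow (hk : over_kbar) (R : comPzRingType)
    (x y : {rmorphism kbar -> R}) (u : gr_arrow F x y) : gr_arrow F' x y.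
Proof.
apply: (@Arrow _ _ _ _ _ _ (rcomp u phi)) => c.
  by rewrite /= hk.1 ar_target.
by rewrite /= hk.2 ar_source.
Defined.
End GroupoidHom.

Record groupoid_hom (F F' : groupoid) := GroupoidHom {
  gh_hom :> {rmorphism F' -> F};
  gh_kbar : over_kbar gh_hom;
  gh_comp : forall (R : comPzRingType) (x y z : {rmorphism kbar -> R})
    (u : gr_arrow F x y) (v : gr_arrow F y z),
    hom_arrow gh_kbar (gr_comp u v) =
      gr_comp (hom_arrow gh_kbar u) (hom_arrow gh_kbar v) }.

Lemma groupoid_hom_ext F F' (f g : groupoid_hom F F') : f =1 g -> f = g.
Proof.
case: f g => [f hf cf] [g hg cg] /= /rmorph_ext e; subst g.
have e := Prop_irrelevance hf hg; subst hg.
by congr GroupoidHom; exact: Prop_irrelevance.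
Qed.

Section GroupoidHomId.
Variable F : groupoid.

Fact groupoid_id_kbar : over_kbar (rid F). Proof. by []. Qed.

Fact groupoid_id_comp (R : comPzRingType) (x y z : {rmorphism kbar -> R})
  (u : gr_arrow F x y) (v : gr_arrow F y z) :
  hom_arrow groupoid_id_kbar (gr_comp u v) =
    gr_comp (hom_arrow groupoid_id_kbar u) (hom_arrow groupoid_id_kbar v).
Proof.
have idE x' y' (w : gr_arrow F x' y') : hom_arrow groupoid_id_kbar w = w.
  exact: arrow_ext.
by rewrite !idE.
Qed.

Definition groupoid_id : groupoid_hom F F := GroupoidHom groupoid_id_comp.
End GroupoidHomId.

Section GroupoidHomComp.
Variables (F1 F2 F3 : groupoid).
Variables (f : groupoid_hom F2 F3) (g : groupoid_hom F1 F2).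

Fact groupoid_comp_kbar : over_kbar (rcomp g f).
Proof.
by split=> c; rewrite /= ?(gh_kbar f).1 ?(gh_kbar g).1 ?(gh_kbar f).2
  ?(gh_kbar g).2.
Qed.

Fact groupoid_comp_comp (R : comPzRingType) (x y z : {rmorphism kbar -> R})
  (u : gr_arrow F1 x y) (v : gr_arrow F1 y z) :
  hom_arrow groupoid_comp_kbar (gr_comp u v) =
    gr_comp (hom_arrow groupoid_comp_kbar u) (hom_arrow groupoid_comp_kbar v).
Proof.
have compE x' y' (w : gr_arrow F1 x' y') : hom_arrow groupoid_comp_kbar w =
    hom_arrow (gh_kbar f) (hom_arrow (gh_kbar g) w).
  exact: arrow_ext.
by rewrite !compE (gh_comp g) (gh_comp f).
Qed.

Definition groupoid_hom_comp : groupoid_hom F1 F3 :=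
  GroupoidHom groupoid_comp_comp.
End GroupoidHomComp.

Record transitive_groupoid := TransitiveGroupoid {
  tg_groupoid :> groupoid;
  tg_transitive : is_transitive tg_groupoid }.

Definition transitive_groupoid_cat : category.
Proof.
apply: (@Category transitive_groupoid (fun F F' => groupoid_hom F F')
  (fun F => groupoid_id F)
  (fun F1 F2 F3 (f : groupoid_hom F2 F3) g => groupoid_hom_comp f g));
  by move=> *; apply: groupoid_hom_ext.
Defined.

Section GroupoidTheory.
Variable F : groupoid.

Lemma gr_invE (R : comPzRingType) (x y : {rmorphism kbar -> R})
  (u : gr_arrow F x y) v :
  gr_comp u v = gr_id F x -> v = gr_inv u.
Proof.
by move=> uv; rewrite -[v]gr_compl1 -(gr_compV u) -gr_compA uv gr_compr1.
Qed.

Lemma gr_idem (R : comPzRingType) (x : {rmorphism kbar -> R})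
  (u : gr_arrow F x x) :
  gr_comp u u = u -> u = gr_id F x.
Proof.
by move=> uu; rewrite -[u]gr_compl1 -{1}(gr_compV u) -gr_compA uu gr_compV.
Qed.

Lemma gr_nat_id (R S : comPzRingType) (f : {rmorphism R -> S})
  (x : {rmorphism kbar -> R}) :
  arrow_map f (gr_id F x) = gr_id F (rcomp f x).
Proof. by apply: gr_idem; rewrite -gr_nat_comp gr_compl1. Qed.

Lemma gr_nat_inv (R S : comPzRingType) (f : {rmorphism R -> S})
  (x y : {rmorphism kbar -> R})
  (u : gr_arrow F x y) : arrow_map f (gr_inv u) = gr_inv (arrow_map f u).
Proof. by apply: gr_invE; rewrite -gr_nat_comp gr_comprV gr_nat_id. Qed.

Definition diag_ring : comPzRingType := coeq (gr_d0 F) (gr_d1 F).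

Definition diag_proj : {rmorphism F -> diag_ring} :=
  coeq_map (gr_d0 F) (gr_d1 F).

Definition diag_str : {rmorphism kbar -> diag_ring} :=
  rcomp diag_proj (gr_d0 F).

Section DiagPoints.
Variables (R : comPzRingType) (x : {rmorphism kbar -> R}).

Definition diag_arrow (u : pt diag_str x) : gr_arrow F x x.
Proof.
apply: (@Arrow _ _ _ _ _ _ (rcomp u diag_proj)) => c.
  by rewrite /= -(pt_str u).
by rewrite /= -coeq_mapE -(pt_str u).
Defined.

Section DiagPt.
Variable u : gr_arrow F x x.

Fact diag_pt_rel c : u (gr_d0 F c) = u (gr_d1 F c).
Proof. by rewrite ar_target ar_source. Qed.

Fact diag_pt_str c : coeq_lift diag_pt_rel (diag_str c) = x c.
Proof. by rewrite -(ar_target u); exact: coeq_liftE. Qed.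

Definition diag_pt : pt diag_str x := @Pt _ diag_str _ x _ diag_pt_str.
End DiagPt.

Lemma diag_ptE (u : gr_arrow F x x) a : diag_pt u (diag_proj a) = u a.
Proof. exact: coeq_liftE. Qed.

Lemma diag_pt_ext (u v : pt diag_str x) :
  (forall a, u (diag_proj a) = v (diag_proj a)) -> u = v.
Proof.
by move=> uv; apply: pt_ext => b; congr (_ b : R); rewrite (coeq_hom_ext uv).
Qed.

Lemma diag_ptK : cancel diag_pt diag_arrow.
Proof. by move=> u; apply: arrow_ext => a; exact: diag_ptE. Qed.

Lemma diag_arrowK : cancel diag_arrow diag_pt.
Proof. by move=> u; apply: diag_pt_ext => a; rewrite diag_ptE. Qed.
End DiagPoints.

Lemma diag_arrow_map (R S : comPzRingType) (f : {rmorphism R -> S})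
  (x : {rmorphism kbar -> R})
  (u : pt diag_str x) : diag_arrow (pt_map f u) = arrow_map f (diag_arrow u).
Proof. exact: arrow_ext. Qed.

Lemma diag_pt_map (R S : comPzRingType) (f : {rmorphism R -> S})
  (x : {rmorphism kbar -> R})
  (u : gr_arrow F x x) : pt_map f (diag_pt u) = diag_pt (arrow_map f u).
Proof. by rewrite -[LHS]diag_arrowK diag_arrow_map diag_ptK. Qed.

Definition diag_mul (R : comPzRingType) (x : {rmorphism kbar -> R})
    (u v : pt diag_str x) :=
  diag_pt (gr_comp (diag_arrow u) (diag_arrow v)).
Definition diag_one (R : comPzRingType) (x : {rmorphism kbar -> R}) :
     pt diag_str x :=
  diag_pt (gr_id F x).
Definition diag_inv (R : comPzRingType) (x : {rmorphism kbar -> R})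
    (u : pt diag_str x) :=
  diag_pt (gr_inv (diag_arrow u)).

Definition diag_group : affine_group.
Proof.
apply: (@AffineGroup diag_ring diag_str diag_mul diag_one diag_inv).
- by move=> R x u v w; rewrite /diag_mul !diag_ptK gr_compA.
- by move=> R x u; rewrite /diag_mul diag_ptK gr_compl1 diag_arrowK.
- by move=> R x u; rewrite /diag_mul diag_ptK gr_compr1 diag_arrowK.
- by move=> R x u; rewrite /diag_mul diag_ptK gr_compV.
- by move=> R x u; rewrite /diag_mul diag_ptK gr_comprV.
- move=> R S f x u v.
  by rewrite /diag_mul diag_pt_map gr_nat_comp !diag_arrow_map.
Defined.
End GroupoidTheory.

Definition algebraic_extension := forall x : kbar, algebraicOver iota x.

Lemma alg_endo_bij (s : {rmorphism kbar -> kbar}) :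
  algebraic_extension -> (forall c, s (iota c) = iota c) -> bijective s.
Proof.
move=> alg_iota fix_s.
have surj_s x : exists y, s y = x.
  have [p p0 px] := alg_iota x.
  have [r qE] := closed_field_poly_normal (map_poly iota p).
  have q0 : lead_coef (map_poly iota p) != 0.
    by rewrite lead_coef_eq0 map_poly_eq0.
  have memr y : (y \in undup r) = root (map_poly iota p) y.
    by rewrite mem_undup qE rootZ // root_prod_XsubC.
  have sub_r : {subset map s (undup r) <= undup r}.
    move=> _ /mapP[y yr ->]; move: yr; rewrite !memr => /rootP py.
    have pE : map_poly iota p = map_poly s (map_poly iota p).
      by rewrite -map_poly_comp; apply: eq_map_poly => c /=; rewrite fix_s.
    by apply/rootP; rewrite pE horner_map py rmorph0.
  have uniq_r : uniq (map s (undup r)).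
    by rewrite map_inj_uniq ?undup_uniq //; exact: fmorph_inj.
  have [|_ rE] := uniq_min_size uniq_r sub_r; first by rewrite size_map.
  have : x \in map s (undup r) by rewrite rE memr.
  by case/mapP=> y _ ->; exists y.
exists (fun x => sval (cid (surj_s x))) => x;
  last exact: (svalP (cid (surj_s x))).
by apply: (fmorph_inj s); exact: (svalP (cid (surj_s (s x)))).
Qed.

Lemma gr_comp_eq (F : groupoid) (R : comPzRingType)
  (x y z x' y' z' : {rmorphism kbar -> R})
  (u : gr_arrow F x y) (v : gr_arrow F y z)
  (u' : gr_arrow F x' y') (v' : gr_arrow F y' z') :
  u =1 u' -> v =1 v' -> gr_comp u v =1 gr_comp u' v'.
Proof.
move=> uu vv.
have ex : x = x'.
  by apply: rmorph_ext => c; rewrite -(ar_target u) uu ar_target.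
have ey : y = y'.
  by apply: rmorph_ext => c; rewrite -(ar_source u) uu ar_source.
have ez : z = z'.
  by apply: rmorph_ext => c; rewrite -(ar_source v) vv ar_source.
by subst x' y' z'; rewrite (arrow_ext uu) (arrow_ext vv).
Qed.

Lemma gr_id_eq (F : groupoid) (R : comPzRingType)
  (x x' : {rmorphism kbar -> R}) : x =1 x' -> gr_id F x =1 gr_id F x'.
Proof. by move=> /rmorph_ext->. Qed.

Lemma gr_inv_eq (F : groupoid) (R : comPzRingType)
  (x y x' y' : {rmorphism kbar -> R})
  (u : gr_arrow F x y) (u' : gr_arrow F x' y') :
  u =1 u' -> gr_inv u =1 gr_inv u'.
Proof.
move=> uu.
have ex : x = x'.
  by apply: rmorph_ext => c; rewrite -(ar_target u) uu ar_target.
have ey : y = y'.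
  by apply: rmorph_ext => c; rewrite -(ar_source u) uu ar_source.
by subst x' y'; rewrite (arrow_ext uu).
Qed.

Lemma gh_id (F F' : groupoid) (f : groupoid_hom F F') (R : comPzRingType)
  (x : {rmorphism kbar -> R}) :
  hom_arrow (gh_kbar f) (gr_id F x) = gr_id F' x.
Proof. by apply: gr_idem; rewrite -gh_comp gr_compl1. Qed.

Lemma gh_inv (F F' : groupoid) (f : groupoid_hom F F') (R : comPzRingType)
  (x y : {rmorphism kbar -> R}) (u : gr_arrow F x y) :
  hom_arrow (gh_kbar f) (gr_inv u) = gr_inv (hom_arrow (gh_kbar f) u).
Proof. by apply: gr_invE; rewrite -gh_comp gr_comprV gh_id. Qed.

(* The kbar-points over kbar, F being regarded as a kbar-scheme by d0.        *)
Definition gr_kpt of algebraic_extension := fun F : groupoid => kpt (gr_d0 F).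

HB.instance Definition _ alg F := Topological.on (gr_kpt alg F).

Section GroupoidPoints.
Variables (alg : algebraic_extension) (F : groupoid).
Local Notation pts := (gr_kpt alg F).
Implicit Types u v w : pts.

Fact gr_gamma_fix u c : rcomp u (gr_d1 F) (iota c) = iota c.
Proof. by rewrite /= -gr_k; exact: (pt_str u). Qed.

(* d1 u = Spec (gr_gamma u). *)
Definition gr_gamma u : gal :=
  Gal (alg_endo_bij alg (gr_gamma_fix u)) (gr_gamma_fix u).

Definition kpt_arrow u : gr_arrow F (rid kbar) (gr_gamma u) :=
  @Arrow _ (gr_d0 F) (gr_d1 F) _ (rid kbar) (gr_gamma u) u (pt_str u)
    (fun=> erefl).

Definition arrow_kpt (y : {rmorphism kbar -> kbar})
    (u : gr_arrow F (rid kbar) y) : pts :=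
  @Pt _ (gr_d0 F) _ (rid kbar) u (ar_target u).

(* u o Spec s *)
Definition translate (s : {rmorphism kbar -> kbar}) u :
    gr_arrow F s (rcomp s (gr_gamma u)) :=
  @Arrow _ (gr_d0 F) (gr_d1 F) _ s (rcomp s (gr_gamma u)) (rcomp s u)
    (fun c => congr1 s (pt_str u c)) (fun=> erefl).

Definition gr_kmul u v : pts :=
  arrow_kpt (gr_comp (kpt_arrow u) (translate (gr_gamma u) v)).

Definition gr_kone : pts := arrow_kpt (gr_id F (rid kbar)).

Fact gr_kinv_str u c :
  rcomp (gr_gamma u)^-1%g (gr_inv (kpt_arrow u)) (gr_d0 F c) = c.
Proof.
rewrite -[RHS](galVK (gr_gamma u) c); congr ((gr_gamma u)^-1%g _).
exact: ar_target.
Qed.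

Definition gr_kinv u : pts := @Pt _ (gr_d0 F) _ (rid kbar) _ (gr_kinv_str u).

Lemma gr_gammaM u v : gr_gamma (gr_kmul u v) =1 rcomp (gr_gamma u) (gr_gamma v).
Proof. by move=> c; exact: ar_source. Qed.

Lemma gr_gamma1 : gr_gamma gr_kone =1 id.
Proof. by move=> c; exact: ar_source. Qed.

Lemma gr_gammaV u : gr_gamma (gr_kinv u) =1 (gr_gamma u)^-1%g.
Proof. by move=> c; rewrite /= ar_source. Qed.

Fact gr_kmulA : associative gr_kmul.
Proof.
move=> u v w; apply: pt_ext => a.
transitivity (gr_comp (kpt_arrow u) (gr_comp (translate (gr_gamma u) v)
  (translate (rcomp (gr_gamma u) (gr_gamma v)) w)) a).
  apply: gr_comp_eq => // b.
  have := congr1 (fun t : gr_arrow F _ _ => t b)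
    (gr_nat_comp (gr_gamma u) (kpt_arrow v) (translate (gr_gamma v) w)).
  by move=> /= ->; apply: gr_comp_eq.
rewrite gr_compA; apply: gr_comp_eq => // b.
exact/esym/gr_gammaM.
Qed.

Fact gr_kmul1 : left_id gr_kone gr_kmul.
Proof.
move=> u; apply: pt_ext => a.
transitivity (gr_comp (gr_id F (rid kbar)) (kpt_arrow u) a).
  by apply: gr_comp_eq => // b; exact: gr_gamma1.
by rewrite gr_compl1.
Qed.

Fact gr_kmulr1 : right_id gr_kone gr_kmul.
Proof.
move=> u; apply: pt_ext => a.
transitivity (gr_comp (kpt_arrow u) (gr_id F (gr_gamma u)) a).
  apply: gr_comp_eq => // b.
  have := congr1 (fun t : gr_arrow F _ _ => t b)
    (gr_nat_id F (gr_gamma u) (rid kbar)).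
  by move=> /= ->; apply: gr_id_eq.
by rewrite gr_compr1.
Qed.

Fact gr_kmulV : left_inverse gr_kone gr_kinv gr_kmul.
Proof.
move=> u; apply: pt_ext => a.
pose s := (gr_gamma u)^-1%g.
transitivity (arrow_map s (gr_comp (gr_inv (kpt_arrow u)) (kpt_arrow u)) a).
  rewrite gr_nat_comp; apply: gr_comp_eq => // b.
  exact: gr_gammaV.
rewrite gr_compV gr_nat_id; apply: gr_id_eq => c; exact: galVK.
Qed.

Fact gr_kmulrV : right_inverse gr_kone gr_kinv gr_kmul.
Proof.
move=> u; apply: pt_ext => a.
transitivity (gr_comp (kpt_arrow u) (gr_inv (kpt_arrow u)) a).
  by apply: gr_comp_eq => // b; exact: galKV.
by rewrite gr_comprV.
Qed.

HB.instance Definition _ :=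
  isGroup.Build pts gr_kmulA gr_kmul1 gr_kmulr1 gr_kmulV gr_kmulrV.

Definition gr_incl (z : ag_kpt (diag_group F)) : pts :=
  arrow_kpt (diag_arrow z).

(* The universal point of the diagonal. *)
Definition diag_univ : gr_arrow F (diag_str F) (diag_str F) :=
  diag_arrow (@Pt _ (diag_str F) _ (diag_str F) (rid _) (fun=> erefl)).

Section Conjugation.
Variable v : pts.

Definition conj_str : {rmorphism kbar -> diag_ring F} :=
  rcomp (diag_str F) (gr_gamma v)^-1%g.

Fact conj_arrow_target c : rcomp conj_str v (gr_d0 F c) = conj_str c.
Proof. by rewrite /= (pt_str v). Qed.

Fact conj_arrow_source c : rcomp conj_str v (gr_d1 F c) = diag_str F c.
Proof. by congr (diag_str F _); exact: (galVK (gr_gamma v)). Qed.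

Definition conj_arrow : gr_arrow F conj_str (diag_str F) :=
  @Arrow _ (gr_d0 F) (gr_d1 F) _ conj_str (diag_str F) (rcomp conj_str v)
    conj_arrow_target conj_arrow_source.

(* The morphism d |-> v o d o v^-1, obtained by evaluation at the universal   *)
(* point d of F^diag. The source of d is x = diag_str, so v has to be pulled  *)
(* back along conj_str = x o (gamma v)^-1 for its source to be x; the result  *)
(* is a point over conj_str.                                                  *)
Definition gr_act : {rmorphism diag_ring F -> diag_ring F} :=
  diag_pt (gr_comp (gr_comp conj_arrow diag_univ) (gr_inv conj_arrow)).
End Conjugation.

Definition groupoid_data : extended_data :=
  @ExtendedData (diag_group F) pts gr_incl gr_gamma gr_act.
End GroupoidPoints.

Section GroupoidDataHom.
Variables (alg : algebraic_extension) (F F' : groupoid) (f : groupoid_hom F F').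

Fact diag_hom_rel c :
  rcomp (diag_proj F) f (gr_d0 F' c) = rcomp (diag_proj F) f (gr_d1 F' c).
Proof. by rewrite /= (gh_kbar f).1 (gh_kbar f).2; exact: coeq_mapE. Qed.

Definition diag_hom : {rmorphism diag_ring F' -> diag_ring F} :=
  coeq_lift diag_hom_rel.

Lemma diag_homE a : diag_hom (diag_proj F' a) = diag_proj F (f a).
Proof. exact: coeq_liftE. Qed.

Fact diag_hom_kbar : @is_kbar_hom (diag_group F) (diag_group F') diag_hom.
Proof.
move=> c; rewrite /= /diag_str -[RHS]/(diag_proj F (gr_d0 F c)).
by rewrite -(gh_kbar f).1 -diag_homE.
Qed.

Lemma diag_hom_arrow (R : comPzRingType) (x : {rmorphism kbar -> R})
  (u : pt (diag_str F) x) :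
  diag_arrow (hom_pt diag_hom_kbar u : pt (diag_str F') x) =
    hom_arrow (gh_kbar f) (diag_arrow u).
Proof. by apply: arrow_ext => a; rewrite /= -diag_homE. Qed.

Fact diag_hom_group : is_group_hom diag_hom_kbar.
Proof.
move=> R x u v; apply: (can_inj (@diag_arrowK F' R x)).
rewrite diag_hom_arrow /= /diag_mul !diag_ptK (gh_comp f).
by rewrite !diag_hom_arrow.
Qed.

Definition kpt_hom (u : gr_kpt alg F) : gr_kpt alg F'.
Proof.
by apply: (@Pt _ _ _ _ (rcomp u f)) => c; rewrite /= (gh_kbar f).1 (pt_str u).
Defined.

Lemma kpt_hom_gamma u : gr_gamma (kpt_hom u) = gr_gamma u.
Proof. by apply: gal_ext => c; rewrite /= (gh_kbar f).2. Qed.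

Fact kpt_hom_mul : {morph kpt_hom : u v / (u * v)%g}.
Proof.
move=> u v; apply: pt_ext => a.
have := congr1 (fun t : gr_arrow F' _ _ => t a)
  (gh_comp f (kpt_arrow u) (translate (gr_gamma u) v)).
move=> /= ->; apply: gr_comp_eq => // b.
exact: (congr1 (fun s : gal => s (v (f b))) (esym (kpt_hom_gamma u))).
Qed.

Fact kpt_hom_cont : continuous kpt_hom.
Proof.
apply/continuousP => U oU.
have {}oU : krull_open (@pt_fun _ (gr_d0 F')) U := oU.
suff : krull_open (@pt_fun _ (gr_d0 F)) (kpt_hom @^-1` U) by [].
move=> z /oU[s sU]; exists (map f s) => w wz.
by apply: sU; move: wz; rewrite -!map_comp.
Qed.

Fact kpt_hom_incl (z : ag_kpt (diag_group F)) :
  kpt_hom (gr_incl alg z) =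
    gr_incl alg (hom_pt diag_hom_kbar z : ag_kpt (diag_group F')).
Proof. by apply: pt_ext => a; rewrite /= -diag_homE. Qed.

Fact diag_hom_act (v : gr_kpt alg F) b :
  gr_act v (diag_hom b) = diag_hom (gr_act (kpt_hom v) b).
Proof.
suff e : rcomp (gr_act v) diag_hom = rcomp diag_hom (gr_act (kpt_hom v)).
  exact: (congr1 (fun h : {rmorphism diag_ring F' -> diag_ring F} => h b) e).
apply: coeq_hom_ext => a.
transitivity (gr_act v (diag_proj F (f a))).
  by congr (gr_act v _); exact: diag_homE.
transitivity (diag_hom (gr_comp
  (gr_comp (conj_arrow (kpt_hom v)) (diag_univ F'))
  (gr_inv (conj_arrow (kpt_hom v))) a)); last first.
  by congr (diag_hom _); exact/esym/diag_ptE.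
transitivity (gr_comp (gr_comp (conj_arrow v) (diag_univ F))
  (gr_inv (conj_arrow v)) (f a)); first exact: diag_ptE.
transitivity (gr_comp (gr_comp (hom_arrow (gh_kbar f) (conj_arrow v))
  (hom_arrow (gh_kbar f) (diag_univ F)))
  (gr_inv (hom_arrow (gh_kbar f) (conj_arrow v))) a).
  by rewrite -gh_inv -!gh_comp.
transitivity (gr_comp (gr_comp (arrow_map diag_hom (conj_arrow (kpt_hom v)))
  (arrow_map diag_hom (diag_univ F')))
  (gr_inv (arrow_map diag_hom (conj_arrow (kpt_hom v)))) a); last first.
  by rewrite -gr_nat_inv -!gr_nat_comp.
have conjE : hom_arrow (gh_kbar f) (conj_arrow v) =1
    arrow_map diag_hom (conj_arrow (kpt_hom v)).
  move=> c; rewrite /= [RHS]diag_hom_kbar.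
  exact: (congr1 (fun s : gal => diag_str F ((s^-1)%g (v (f c))))
    (esym (kpt_hom_gamma v))).
apply: gr_comp_eq; last exact: gr_inv_eq.
by apply: gr_comp_eq => // c; exact/esym/diag_homE.
Qed.

Definition groupoid_data_hom :
    extended_hom (groupoid_data alg F) (groupoid_data alg F') :=
  @ExtendedHom (groupoid_data alg F) (groupoid_data alg F') diag_hom kpt_hom
    diag_hom_kbar diag_hom_group kpt_hom_mul kpt_hom_cont kpt_hom_gamma
    kpt_hom_incl diag_hom_act.
End GroupoidDataHom.

(* The functor F |-> (F^diag, F(kbar)), once its values are known to be       *)
(* Galois extended groups.                                                    *)
Section GroupoidFunctor.
Variable alg : algebraic_extension.
Hypothesis galois : forall F : transitive_groupoid,
  is_galois_extended (groupoid_data alg F).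

Definition points_ob (F : transitive_groupoid) : galois_extended :=
  GaloisExtended (galois F).

Definition points_map (F F' : transitive_groupoid) (f : groupoid_hom F F') :
    extended_hom (points_ob F) (points_ob F') :=
  groupoid_data_hom alg f.

Fact points_map1 (F : transitive_groupoid) :
  points_map (groupoid_id F) = extended_id (points_ob F).
Proof.
apply: extended_hom_ext => [b|u]; last exact: pt_ext.
suff e : diag_hom (groupoid_id F) = rid (diag_ring F).
  exact: (congr1 (fun h : {rmorphism diag_ring F -> diag_ring F} => h b) e).
by apply: coeq_hom_ext => a; exact: diag_homE.
Qed.

Fact points_mapM (F1 F2 F3 : transitive_groupoid) (f : groupoid_hom F2 F3)
  (g : groupoid_hom F1 F2) :
  points_map (groupoid_hom_comp f g) =
    extended_comp (points_map f) (points_map g).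
Proof.
apply: extended_hom_ext => [b|u]; last exact: pt_ext.
suff e : diag_hom (groupoid_hom_comp f g) = rcomp (diag_hom g) (diag_hom f).
  exact: (congr1 (fun h : {rmorphism diag_ring F3 -> diag_ring F1} => h b) e).
apply: coeq_hom_ext => a; rewrite [LHS]diag_homE.
by rewrite -[RHS]/(diag_hom g (diag_hom f (diag_proj F3 a))) !diag_homE.
Qed.

Definition points_functor :
    functor transitive_groupoid_cat galois_extended_cat :=
  @Functor transitive_groupoid_cat galois_extended_cat points_ob points_map
    points_map1 points_mapM.
End GroupoidFunctor.
End GaloisExtendedGroups.

(* Main.v *)
Require Import Defs.
From HB Require Import structures.
From mathcomp Require Import all_boot all_algebra separable.
From mathcomp Require Import zify ring.
From mathcomp Require Import boolp classical_sets functions filter.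
From mathcomp Require Import topology_structure product_topology.
From mathcomp Require Import subspace_topology.

Set Implicit Arguments.
Unset Strict Implicit.
Unset Printing Implicit Defensive.

Import GRing.Theory.
Local Open Scope classical_set_scope.
Local Open Scope ring_scope.
Local Open Scope quotient_scope.

(** Let q be a section of a transitive groupoid F over the scheme of pairs
    (x, y) of points of Spec kbar over k. Every arrow from y to x is then
    d q(x, y) for a unique automorphism d of x, and F is reconstructed from the
    group of automorphisms, the conjugation by q, and the factor set
    q(x, y) q(y, z) q(x, z)^-1. The scheme of pairs is the spectrum of
    kbar (x)_k kbar; since k is perfect this spectrum is the profinite space
    Gal, and all its local rings are kbar. Conjugation by q and the factor set
    are thus given by locally constant families indexed by Gal, that is by the
    structure of a Galois extended group.

    Technically, when two morphisms x and y from kbar to a ring R agree on k,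
    the spectrum of R is covered by the loci y = x o s for s in Gal: elements
    of R are compared on these loci (galois_separate2), and locally constant
    families of elements are glued (galois_glue). Computations with arrows
    whose values are in any ring, possibly with nilpotents, reduce in this way
    to computations with the kbar-points q(s). The same facts give the
    compactness of Gal (gal_compact), and the flatness of all modules over
    kbar (x)_k kbar (kk_flat).

    The existence of q (transitive_section) is the main point. It is not a
    formal consequence of faithful flatness, as F is not of finite type.
    Consider the closed subschemes Y of F with non-empty fibres over Gal that
    are stable by u v^-1 w, and a minimal one. Functions on F are combinations
    of matrix coefficients of finite-dimensional representations
    (rep_spanning). For a representation M, the closed images of the fibres of
    Y in the linear group are locally constant (img_pt_near), so that matrices
    G(t) in these images can be chosen to be locally constant in t. The
    condition M = G on Y has solutions in every fibre (img_fibre_proper), this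
    being an application of the theorem of Chevalley on constructible sets; by
    minimality it holds on Y. So all functions on Y come from
    kbar (x)_k kbar, and Y is a section.

    The values of q at the points of Gal form a continuous section of F(kbar),
    which is what makes F(kbar) an extension of Gal; hence the functor takes
    its values in Galois extended groups (galois_groupoid_data). In the other
    direction, a continuous section of E over Gal has a factor set, and the
    arrows d q(x, y) with d in D are multiplied accordingly (pt_comp); the laws
    of groupoids are checked on the loci y = x o s, where they are those of E
    (sg_groupoid), and the result has the given Galois extended group
    (recover). A morphism is determined by its values on automorphisms and on
    the q(s), which proves faithfulness (points_faithful), and any morphism of
    Galois extended groups prescribes compatible values of that kind
    (points_full). *)

(** * Ideals, quotients and prime ideals *)

Record is_ideal (R : comPzRingType) (I : set R) : Prop := IsIdeal {
  ideal0 : I 0;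
  idealD : forall x y, I x -> I y -> I (x + y);
  idealM : forall x y, I y -> I (x * y) }.

Section IdealTheory.
Variables (R : comPzRingType) (I : set R) (hI : is_ideal I).

Lemma idealMr x y : I x -> I (x * y).
Proof. by move=> Ix; rewrite mulrC; exact: idealM. Qed.

Lemma idealN x : I x -> I (- x).
Proof. by move=> Ix; rewrite -mulN1r; exact: idealM. Qed.

Lemma idealB x y : I x -> I y -> I (x - y).
Proof. by move=> Ix Iy; apply: idealD => //; exact: idealN. Qed.

Lemma ideal_sum (J : Type) (r : seq J) (P : pred J) (F : J -> R) :
  (forall j, P j -> I (F j)) -> I (\sum_(j <- r | P j) F j).
Proof. by move=> h; apply: big_ind => //; [exact: ideal0|exact: idealD]. Qed.

End IdealTheory.

Inductive ideal_gen (R : comPzRingType) (X : set R) : set R :=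
  | ig_base x : X x -> ideal_gen X x
  | ig_0 : ideal_gen X 0
  | ig_add x y : ideal_gen X x -> ideal_gen X y -> ideal_gen X (x + y)
  | ig_mul x y : ideal_gen X y -> ideal_gen X (x * y).

Lemma ideal_gen_ideal (R : comPzRingType) (X : set R) :
  is_ideal (ideal_gen X).
Proof. by split; [exact: ig_0|exact: ig_add|exact: ig_mul]. Qed.

Lemma ideal_gen_min (R : comPzRingType) (X I : set R) :
  is_ideal I -> X `<=` I -> ideal_gen X `<=` I.
Proof.
move=> hI XI x; elim=> [y /XI //||y z _ Iy _ Iz|y z _ Iz].
- exact: ideal0.
- exact: idealD.
- exact: idealM.
Qed.

Lemma ideal_gen_sub (R : comPzRingType) (X Y : set R) :
  X `<=` Y -> ideal_gen X `<=` ideal_gen Y.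
Proof.
move=> XY; apply: ideal_gen_min; first exact: ideal_gen_ideal.
by move=> x /XY; exact: ig_base.
Qed.

Lemma ker_ideal (R S : comPzRingType) (f : {rmorphism R -> S}) (I : set S) :
  is_ideal I -> is_ideal (f @^-1` I).
Proof.
move=> hI; split=> [|x y fx fy|x y fy]; rewrite /preimage /=.
- by rewrite rmorph0; exact: ideal0.
- by rewrite rmorphD; exact: idealD.
- by rewrite rmorphM; exact: idealM.
Qed.

Lemma zero_ideal (R : comPzRingType) : is_ideal [set x : R | x = 0].
Proof.
split=> //= [x y -> ->|x y ->]; [exact: addr0|exact: mulr0].
Qed.

Section QuotientRing.
Variables (R : comPzRingType) (I : set R) (hI : is_ideal I).

Definition quot_eqv : rel R := fun x y => `[< I (x - y) >].

Fact quot_eqv_equiv : equiv_class_of quot_eqv.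
Proof.
split=> [x|x y|y x z].
- by apply/asboolP; rewrite subrr; exact: ideal0.
- by apply/asbool_equiv_eq; split=> h; rewrite -opprB; exact: idealN.
- move=> /asboolP h1 /asboolP h2; apply/asboolP.
  by rewrite -(subrK y x) -addrA; exact: idealD.
Qed.

Canonical quot_equiv := EquivRelPack quot_eqv_equiv.

Definition quotient := {eq_quot quot_equiv}.
HB.instance Definition _ := Choice.on quotient.

Definition quot_of (x : R) : quotient := \pi x.

Lemma quot_ofE x y : quot_of x = quot_of y <-> I (x - y).
Proof.
split=> [/eqmodP/asboolP //|h]; by apply/eqmodP/asboolP.
Qed.

Lemma quot_repr (a : quotient) : quot_of (repr a) = a.
Proof. exact: reprK. Qed.

Lemma repr_quot x : I (repr (quot_of x) - x).
Proof. by apply/quot_ofE; rewrite quot_repr. Qed.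

Definition quot_add (a b : quotient) := quot_of (repr a + repr b).
Definition quot_mul (a b : quotient) := quot_of (repr a * repr b).
Definition quot_opp (a : quotient) := quot_of (- repr a).

Fact quot_addE x y : quot_add (quot_of x) (quot_of y) = quot_of (x + y).
Proof.
by apply/quot_ofE; rewrite opprD addrACA; apply: idealD => //;
  exact: repr_quot.
Qed.
Fact quot_mulE x y : quot_mul (quot_of x) (quot_of y) = quot_of (x * y).
Proof.
apply/quot_ofE; set x' := repr _; set y' := repr _.
rewrite -(subrK (x * y') (x' * y')) -mulrBl -addrA -mulrBr.
by apply: idealD => //; [apply: idealMr => //|apply: idealM => //];
  exact: repr_quot.
Qed.
Fact quot_oppE x : quot_opp (quot_of x) = quot_of (- x).
Proof.
by apply/quot_ofE; rewrite -opprD; apply: idealN => //; exact: repr_quot.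
Qed.

Fact quot_addA : associative quot_add.
Proof.
move=> a b c; rewrite -(quot_repr a) -(quot_repr b) -(quot_repr c).
by rewrite !quot_addE addrA.
Qed.
Fact quot_addC : commutative quot_add.
Proof.
move=> a b; rewrite -(quot_repr a) -(quot_repr b).
by rewrite !quot_addE addrC.
Qed.
Fact quot_add0 : left_id (quot_of 0) quot_add.
Proof. by move=> a; rewrite -(quot_repr a) quot_addE add0r. Qed.
Fact quot_addN : left_inverse (quot_of 0) quot_opp quot_add.
Proof. by move=> a; rewrite -(quot_repr a) quot_oppE quot_addE addNr. Qed.
Fact quot_mulA : associative quot_mul.
Proof.
move=> a b c; rewrite -(quot_repr a) -(quot_repr b) -(quot_repr c).
by rewrite !quot_mulE mulrA.
Qed.
Fact quot_mulC : commutative quot_mul.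
Proof.
move=> a b; rewrite -(quot_repr a) -(quot_repr b).
by rewrite !quot_mulE mulrC.
Qed.
Fact quot_mul1 : left_id (quot_of 1) quot_mul.
Proof. by move=> a; rewrite -(quot_repr a) quot_mulE mul1r. Qed.
Fact quot_mulD : left_distributive quot_mul quot_add.
Proof.
move=> a b c; rewrite -(quot_repr a) -(quot_repr b) -(quot_repr c).
by rewrite !(quot_addE, quot_mulE) mulrDl.
Qed.

HB.instance Definition _ :=
  GRing.isZmodule.Build quotient quot_addA quot_addC quot_add0 quot_addN.
HB.instance Definition _ :=
  GRing.Zmodule_isComPzRing.Build quotient quot_mulA quot_mulC quot_mul1
    quot_mulD.

Fact quot_of_zmod : zmod_morphism quot_of.
Proof. by move=> x y; rewrite -quot_addE -quot_oppE. Qed.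
Fact quot_of_monoid : monoid_morphism quot_of.
Proof. by split=> // x y; rewrite -quot_mulE. Qed.

HB.instance Definition _ :=
  GRing.isZmodMorphism.Build R quotient quot_of quot_of_zmod.
HB.instance Definition _ :=
  GRing.isMonoidMorphism.Build R quotient quot_of quot_of_monoid.

Definition quot_map : {rmorphism R -> quotient} := quot_of.

Lemma quot_map0 x : quot_map x = 0 <-> I x.
Proof. by rewrite -(rmorph0 quot_map) quot_ofE subr0. Qed.

End QuotientRing.

Section Primes.
Variable R : comPzRingType.

Lemma prime_ideal (p : spec R) : is_ideal (prime_set p).
Proof. by split; [exact: prime0|exact: primeD|exact: primeMl]. Qed.

Lemma bigcup_ideal (F : set (set R)) (X : set R) :
  F X -> total_on F subset -> (forall J, F J -> is_ideal J) ->
  is_ideal (\bigcup_(J in F) J).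
Proof.
move=> FX totF idF; split.
- by exists X => //; exact: ideal0 (idF _ FX).
- move=> x y [J FJ Jx] [K FK Ky].
  have [JK|KJ] := totF J K FJ FK.
    by exists K => //; apply: (idealD (idF _ FK)) => //; exact: JK.
  by exists J => //; apply: (idealD (idF _ FJ)) => //; exact: KJ.
- by move=> x y [J FJ Jy]; exists J => //; exact: (idealM (idF _ FJ)).
Qed.

(** An ideal that is maximal among those avoiding a multiplicative set is
    prime. *)
Lemma prime_avoiding (I S : set R) :
  is_ideal I -> S 1 -> (forall x y, S x -> S y -> S (x * y)) ->
  (forall x, I x -> ~ S x) ->
  exists p : spec R, I `<=` prime_set p /\ forall x, prime_set p x -> ~ S x.
Proof.
move=> hI S1 SM IS.
pose P : set (set R) := [set J | J = set0 \/
  [/\ is_ideal J, I `<=` J & forall x, J x -> ~ S x]].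
have [F FP totF|J [PJ maxJ]] := @Zorn_bigcup R P.
  have [[X FX]|nF] := pselect (exists2 X, F X & X !=set0); last first.
    left; apply/seteqP; split=> // x [X FX Xx]; apply: nF.
    by exists X => //; exists x.
  case=> y Xy; right; split.
  - pose G := [set Z | F Z /\ Z !=set0].
    have -> : \bigcup_(Z in F) Z = \bigcup_(Z in G) Z.
      apply/seteqP; split=> z [Z]; first by exists Z => //; split=> //; exists z.
      by case=> FZ _; exists Z.
    apply: (@bigcup_ideal G X); first by split => //; exists y.
      by move=> ? ? [? _] [? _]; exact: totF.
    move=> Z [/FP[->|[]//]]; by case.
  - move=> x Ix; exists X => //; case: (FP _ FX) => [X0|[_ IX _]]; last exact: IX.
    by rewrite X0 in Xy.
  - move=> x [Z /FP[->//|[_ _ ZS]] Zx]; exact: ZS.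
have [J0|[hJ IJ JS]] := PJ.
  exfalso; apply: (maxJ I); last by right; split.
  by rewrite J0; split=> // /(_ 0 (ideal0 hI)).
have key x : ~ J x -> exists a s, [/\ J a, S s & exists r, s = a + r * x].
  move=> nJx; pose K : set R := [set z | exists a r, J a /\ z = a + r * x].
  have hK : is_ideal K.
    split.
    - by exists 0, 0; rewrite mul0r addr0; split=> //; exact: ideal0.
    - move=> _ _ [a [r [Ja ->]]] [b [s [Jb ->]]]; exists (a + b), (r + s).
      by rewrite mulrDl addrACA; split=> //; exact: idealD.
    - move=> z _ [a [r [Ja ->]]]; exists (z * a), (z * r).
      by rewrite mulrDr mulrA; split=> //; exact: idealM.
  have JK : J `<` K.
    split=> [|KJ]; first by move=> z Jz; exists z, 0; rewrite mul0r addr0.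
    apply: nJx; apply: KJ; exists 0, 1; rewrite mul1r add0r; split=> //.
    exact: ideal0.
  apply: contrapT => h; apply: (maxJ K) => //; right; split=> // z.
    by move=> /IJ Jz; exists z, 0; rewrite mul0r addr0.
  by case=> a [r [Ja ->]] Sz; apply: h; exists a, (a + r * x); split=> //; exists r.
have J1 : ~ J 1 by move=> /JS.
have JP x y : J (x * y) -> J x \/ J y.
  move=> Jxy; apply: contrapT => /not_orP[/key[a [s [Ja Ss [r sE]]]]].
  move=> /key[b [t [Jb St [q tE]]]]; apply: (JS (s * t)); last exact: SM.
  rewrite sE tE mulrDl; apply: idealD => //; first exact: idealMr.
  rewrite mulrDr; apply: idealD => //; first exact: idealM.
  by rewrite mulrACA; exact: idealM.
exists (Spec (ideal0 hJ) (idealD hJ) (idealM hJ) J1 JP); split=> //.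
Qed.

Lemma proper_prime (I : set R) : is_ideal I -> ~ I 1 ->
  exists p : spec R, I `<=` prime_set p.
Proof.
move=> hI I1.
have [|//|//|p [Ip _]] := @prime_avoiding I [set x | x = 1] hI.
- by [].
- by move=> x y /= -> ->; rewrite mulr1.
- by move=> x Ix /= x1; apply: I1; rewrite -x1.
by exists p.
Qed.

Definition minimal_over (I : set R) (q : spec R) :=
  I `<=` prime_set q /\ forall p : spec R,
    I `<=` prime_set p -> prime_set p `<=` prime_set q ->
    prime_set q `<=` prime_set p.

(** Zorn's lemma applies to the complements of the primes, since the
    intersection of a chain of primes is prime. *)
Lemma minimal_prime (I : set R) : is_ideal I -> ~ I 1 ->
  exists q, minimal_over I q.
Proof.
move=> hI I1; have [p0 Ip0] := proper_prime hI I1.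
pose P : set (set R) := [set X | X = set0 \/
  exists p : spec R, I `<=` prime_set p /\ X = ~` prime_set p].
have [F FP totF|X [PX maxX]] := @Zorn_bigcup R P.
  pose U := \bigcup_(X in F) X.
  have [[X FX XN0]|nF] := pselect (exists2 X, F X & X !=set0); last first.
    left; apply/seteqP; split=> // x [X FX Xx]; apply: nF.
    by exists X => //; exists x.
  have compP Z z : F Z -> Z z -> exists p : spec R,
      I `<=` prime_set p /\ Z = ~` prime_set p.
    by move=> /FP[->//|].
  have common x y : U x -> U y -> exists2 Z, F Z & Z x /\ Z y.
    move=> [Z FZ Zx] [Y FY Yy]; have [ZY|YZ] := totF _ _ FZ FY.
      by exists Y => //; split=> //; exact: ZY.
    by exists Z => //; split=> //; exact: YZ.
  right; unshelve eexists (@Spec R (~` U) _ _ _ _ _).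
  - by case=> Z FZ Z0; have [p [_ ZE]] := compP _ _ FZ Z0;
      move: Z0; rewrite ZE; apply; exact: prime0.
  - move=> x y nx ny [Z FZ Zxy]; have [p [_ ZE]] := compP _ _ FZ Zxy.
    have inp z : ~ U z -> prime_set p z.
      by move=> nU; apply: contrapT => h; apply: nU; exists Z; rewrite // ZE.
    by move: Zxy; rewrite ZE; apply; apply: primeD; exact: inp.
  - move=> x y ny [Z FZ Zxy]; have [p [_ ZE]] := compP _ _ FZ Zxy.
    have inp z : ~ U z -> prime_set p z.
      by move=> nU; apply: contrapT => h; apply: nU; exists Z; rewrite // ZE.
    by move: Zxy; rewrite ZE; apply; apply: primeMl; exact: inp.
  - apply; case: XN0 => x Xx; have [p [_ XE]] := compP _ _ FX Xx.
    by exists X => //; rewrite XE; exact: prime1.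
  - move=> x y nxy; apply: contrapT => /not_orP[/contrapT Ux /contrapT Uy].
    have [Z FZ [Zx Zy]] := common _ _ Ux Uy.
    have [p [_ ZE]] := compP _ _ FZ Zx.
    apply: nxy; exists Z => //; rewrite ZE => /primeM[px|py].
      by move: Zx; rewrite ZE; exact.
    by move: Zy; rewrite ZE; exact.
  split=> /=; last by rewrite setCK.
  move=> x Ix [Z FZ Zx]; have [p [Ip ZE]] := compP _ _ FZ Zx.
  by move: Zx; rewrite ZE; apply; exact: Ip.
case: PX => [X0|[q [Iq XE]]].
  exfalso; apply: (maxX (~` prime_set p0)); last by right; exists p0.
  split; first by rewrite X0.
  by rewrite X0 => /(_ 1 (@prime1 _ p0)).
exists q; split=> // p Ip pq x qx; apply: contrapT => npx.
apply: (maxX (~` prime_set p)); last by right; exists p.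
split; first by rewrite XE => z; apply: contra_not; exact: pq.
by rewrite XE => /(_ x npx) /(_ qx).
Qed.
End Primes.

(** * Gluing over the Galois group *)

Definition locst (X : topologicalType) (Y : Type) (f : X -> Y) :=
  forall x, nbhs x [set y | f y = f x].

Lemma krull_nbhs (T X Y : Type) (ev : T -> X -> Y) (z : T) (A : set T) :
  (exists2 U, krull_open ev U & U z /\ U `<=` A) <->
  exists s : seq X, forall w, map (ev w) s = map (ev z) s -> A w.
Proof.
split=> [[U oU [Uz UA]]|[s sA]].
  by have [s sU] := oU z Uz; exists s => w /sU/UA.
exists [set w | map (ev w) s = map (ev z) s]; last by split.
by move=> w /= wz; exists s => v; rewrite wz.
Qed.

Section LocallyConstant.
Variable X : topologicalType.

Lemma locst_cst (Y : Type) (y : Y) : locst (fun _ : X => y).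
Proof. by move=> x; apply: filterS filterT. Qed.

Lemma locst_comp (Y Z : Type) (f : X -> Y) (g : Y -> Z) :
  locst f -> locst (g \o f).
Proof. by move=> lf x; apply: filterS (lf x) => y /= ->. Qed.

Lemma locst2 (Y Z W : Type) (f : X -> Y) (g : X -> Z) (h : Y -> Z -> W) :
  locst f -> locst g -> locst (fun x => h (f x) (g x)).
Proof.
by move=> lf lg x; apply: filterS2 (lf x) (lg x) => y /= -> ->.
Qed.

Lemma locst_map (Y Z : Type) (f : X -> Y -> Z) (r : seq Y) :
  (forall y, locst (f ^~ y)) -> locst (fun x => map (f x) r).
Proof.
by move=> lf; elim: r => [|y r IH] /=; [exact: locst_cst|exact: locst2].
Qed.

(** An element is the value of a ring expression, that involves finitely many
    generators. *)
Lemma locst_presented (G : Type) P (R : comPzRingType)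
    (f : X -> {rmorphism @presented G P -> R}) :
  (forall g, locst (fun x => f x (pr_gen P g))) ->
  forall a, locst (fun x => f x a).
Proof.
move=> lf a; rewrite -(reprK a) -[\pi _]pr_reval.
elim: (repr a) => [g|||e1 l1 e2 l2|e1 l1 e2 l2|e l] /=.
- exact: lf.
- by move=> x; apply: filterS filterT => y _ /=; rewrite !rmorph0.
- by move=> x; apply: filterS filterT => y _ /=; rewrite !rmorph1.
- by move=> x; apply: filterS (locst2 +%R l1 l2 x) => y /=;
    rewrite !rmorphD.
- by move=> x; apply: filterS (locst2 *%R l1 l2 x) => y /=;
    rewrite !rmorphM.
- by move=> x; apply: filterS (l x) => y /=; rewrite !rmorphN => ->.
Qed.
End LocallyConstant.

Section PolyEval.
Variables (A : comNzRingType) (S : comPzRingType) (f : {rmorphism A -> S}).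
Variable s : S.

(** Evaluation at s along f. The ring S may be the zero ring. *)
Definition peval (p : {poly A}) : S := \sum_(i < size p) f p`_i * s ^+ i.

Lemma peval_wide n (p : {poly A}) : (size p <= n)%N ->
  peval p = \sum_(i < n) f p`_i * s ^+ i.
Proof.
move=> pn; rewrite /peval (big_ord_widen _ (fun i => f p`_i * s ^+ i) pn).
rewrite big_mkcond; apply: eq_bigr => i _; case: ltnP => // ip.
by rewrite nth_default // rmorph0 mul0r.
Qed.

Fact peval_zmod : zmod_morphism peval.
Proof.
move=> p q; set n := maxn (size p) (size q).
rewrite (@peval_wide n (p - q)); last first.
  by rewrite (leq_trans (size_polyD _ _)) ?size_polyN.
rewrite (@peval_wide n p) ?leq_maxl // (@peval_wide n q) ?leq_maxr //.
rewrite -sumrB; apply: eq_bigr => i _.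
by rewrite coefB rmorphB mulrBl.
Qed.
HB.instance Definition _ := GRing.isZmodMorphism.Build _ _ peval peval_zmod.

Lemma pevalC a : peval a%:P = f a.
Proof.
rewrite (@peval_wide 1) ?size_polyC_leq1 // big_ord1 coefC eqxx.
by rewrite expr0 mulr1.
Qed.

Lemma pevalMX p : peval (p * 'X) = peval p * s.
Proof.
rewrite (@peval_wide (size p).+1); last first.
  by rewrite (leq_trans (size_polyMleq _ _)) // size_polyX addn2.
rewrite big_ord_recl coefMX eqxx rmorph0 mul0r add0r mulr_suml.
by apply: eq_bigr => i _; rewrite coefMX /= exprSr mulrA.
Qed.

Lemma pevalX : peval 'X = s.
Proof. by rewrite -['X]mul1r pevalMX pevalC rmorph1 mul1r. Qed.

Lemma pevalCM a p : peval (a%:P * p) = f a * peval p.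
Proof.
rewrite (@peval_wide (size p)); last first.
  rewrite mul_polyC; exact: size_scale_leq.
rewrite mulr_sumr; apply: eq_bigr => i _.
by rewrite coefCM rmorphM mulrA.
Qed.

Fact peval_monoid : monoid_morphism peval.
Proof.
split; first by rewrite pevalC rmorph1.
move=> p; elim/poly_ind: p => [|p c IH] q; first by rewrite mul0r !raddf0 mul0r.
rewrite mulrDl !raddfD /= mulrDl pevalCM pevalC -mulrA -(commr_polyX q) IH.
by rewrite !pevalMX mulrA mulrAC.
Qed.
HB.instance Definition _ := GRing.isMonoidMorphism.Build _ _ peval peval_monoid.

Definition pevals : {rmorphism {poly A} -> S} := peval.
End PolyEval.

Lemma prime_prod (R : comPzRingType) (p : spec R) (J : eqType) (r : seq J)
    (F : J -> R) : prime_set p (\prod_(j <- r) F j) ->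
  exists2 j, j \in r & prime_set p (F j).
Proof.
elim: r => [|j r IH]; first by rewrite big_nil => /prime1.
rewrite big_cons => /primeM[pj|/IH[i ir pi]].
  by exists j; rewrite ?mem_head.
by exists i; rewrite // inE ir orbT.
Qed.

Section Gluing.
Variables (k : fieldType) (kbar : closedFieldType) (iota : {rmorphism k -> kbar}).
Hypotheses (k_perfect : perfect_field k) (alg : algebraic_extension iota).

Local Notation gal := (gal iota).

Lemma nbhs_gal (s : gal) (A : set gal) :
  nbhs s A <-> exists cs : seq kbar, forall t : gal, map t cs = map s cs -> A t.
Proof.
rewrite -(krull_nbhs (@gal_fun _ _ iota)) nbhsE.
by split=> [[U [oU Us] UA]|[U oU [Us UA]]]; exists U.
Qed.

(** The minimal polynomial of c over k is separable, the field k being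
    perfect. *)
Lemma separable_roots c : exists zs : seq kbar,
  [/\ uniq zs, c \in zs & exists p : {poly k},
      map_poly iota p = \prod_(z <- zs) ('X - z%:P)].
Proof.
pose P n := `[< exists2 p : {poly k}, p != 0 & root (map_poly iota p) c /\
  size p = n >].
have exP : exists n, P n.
  by have [p p0 pc] := alg c; exists (size p); apply/asboolP; exists p.
case: (ex_minnP exP) => n /asboolP[p p0 [pc szp]] minP.
have min_p (q : {poly k}) : q != 0 -> root (map_poly iota q) c ->
    (size p <= size q)%N.
  by move=> q0 qc; rewrite szp; apply: minP; apply/asboolP; exists q.
have irr_p : irreducible_poly p.
  split=> [|q q1 qp].
    rewrite ltnNge; apply/negP => /size1_polyC pE.
    move: pc p0; rewrite pE map_polyC rootC fmorph_eq0 polyC_eq0.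
    by move=> /eqP->; rewrite eqxx.
  have [r pE] := dvdpP _ _ qp.
  have r0 : r != 0 by apply: contra_neq p0 => r0; rewrite pE r0 mul0r.
  have q0 : q != 0 by apply: contra_neq p0 => q0; rewrite pE q0 mulr0.
  have szE : (size p = (size r + size q).-1)%N by rewrite pE size_mul.
  move: pc; rewrite pE rmorphM rootM -pE => /orP[rc|qc].
    have := min_p _ r0 rc; rewrite szE; move: q1 q0; rewrite -size_poly_eq0.
    by case: (size q) => [|[|m]] //; rewrite addnS /= addnS ltnNge leq_addr.
  rewrite -(dvdp_size_eqp qp) eqn_leq (min_p _ q0 qc) andbT.
  exact: dvdp_leq.
have sep_p : separable_poly (map_poly iota p).
  by rewrite separable_map; exact: k_perfect.
have [zs pE] := closed_field_poly_normal (map_poly iota p).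
have lc0 : lead_coef (map_poly iota p) != 0 by rewrite lead_coef_eq0 map_poly_eq0.
exists zs; split.
- rewrite -separable_prod_XsubC -(eqp_separable (eqp_scale _ lc0)) -pE //.
- by move: pc; rewrite pE rootZ // root_prod_XsubC.
- exists ((lead_coef p)^-1 *: p); rewrite map_polyZ /= pE scalerA.
  by rewrite lead_coef_map -rmorphM /= mulVf ?rmorph1 ?scale1r // lead_coef_eq0.
Qed.

Section OneRing.
Variables (R : comPzRingType) (x y : {rmorphism kbar -> R}).
Hypothesis xy : forall c, x (iota c) = y (iota c).

(** On the locus y = x o s the second kbar-algebra structure is the first one
    twisted by s; a morphism out of R factors through that locus when it
    satisfies the following. *)
Definition agree_at (s : gal) (R' : comPzRingType) (f : {rmorphism R -> R'}) :=
  forall c, f (y c) = f (x (s c)).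

(** The polynomial p has its coefficients in k, where x and y agree; so y c
    is a root of the polynomial whose roots are the x z. *)
Lemma conj_roots c zs p : c \in zs ->
  map_poly iota p = \prod_(z <- zs) ('X - z%:P) ->
  \prod_(z <- zs) (y c - x z) = 0.
Proof.
move=> cz pE.
have <- : pevals x (y c) (map_poly iota p) = \prod_(z <- zs) (y c - x z).
  rewrite pE rmorph_prod; apply: eq_bigr => z _.
  by rewrite rmorphB /= pevalX pevalC.
have /rootP pc : root (map_poly iota p) c by rewrite pE root_prod_XsubC.
rewrite -(rmorph0 y) -pc /= /peval horner_coef rmorph_sum; apply: eq_bigr => i _.
by rewrite coef_map /= rmorphM rmorphXn xy.
Qed.

(** The value at v of the polynomial that interpolates 1 at z and 0 at the
    other elements of zs. *)
Definition lagrange (zs : seq kbar) (z : kbar) (v : R) : R :=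
  \prod_(z' <- zs | z' != z) (x (z - z')^-1 * (v - x z')).

Lemma lagrange_ann zs z v : z \in zs -> uniq zs ->
  \prod_(z' <- zs) (v - x z') = 0 -> lagrange zs z v * (v - x z) = 0.
Proof.
move=> zz uz; rewrite (bigD1_seq z) //= => h.
by rewrite /lagrange big_split -mulrA [X in _ * X]mulrC h mulr0.
Qed.
End OneRing.

Lemma gal_roots (s : gal) c zs p : c \in zs ->
  map_poly iota p = \prod_(z <- zs) ('X - z%:P) -> s c \in zs.
Proof.
move=> cz pE.
have /eqP := conj_roots (x := rid kbar) (fun c => esym (gal_fix s c)) cz pE.
rewrite prodf_seq_eq0.
by case/hasP=> z zz /= /eqP/subr0_eq->.
Qed.

Lemma lagrange_map (R R' : comPzRingType) (f : {rmorphism R -> R'})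
    (x : {rmorphism kbar -> R}) zs z v :
  f (lagrange x zs z v) = lagrange (rcomp f x) zs z (f v).
Proof.
rewrite /lagrange rmorph_prod; apply: eq_bigr => z' _.
by rewrite rmorphM rmorphB.
Qed.

Lemma lagrange_eq1 (R : comPzRingType) (x : {rmorphism kbar -> R}) zs z :
  lagrange x zs z (x z) = 1.
Proof.
rewrite /lagrange big1 // => z' zz'.
by rewrite -rmorphB -rmorphM mulVf ?rmorph1 // subr_eq0 eq_sym.
Qed.

Lemma lagrange_eq0 (R : comPzRingType) (x : {rmorphism kbar -> R}) zs z w :
  w \in zs -> w != z -> lagrange x zs z (x w) = 0.
Proof.
move=> wz wz'; rewrite /lagrange (big_rem w) //= wz' subrr mulr0.
exact: mul0r.
Qed.

Section Covering.
Variables (R : comPzRingType) (x y : {rmorphism kbar -> R}).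
Hypothesis xy : forall c, x (iota c) = y (iota c).

Local Notation agree_at := (agree_at x y).

(** The spectrum of R is covered by the loci y = x o s: at a prime, x and y
    embed kbar as the algebraic closure of k in the residue field. *)
Lemma galois_cover (I : set R) : is_ideal I ->
  (forall s, exists e, I e /\
     forall (R' : comPzRingType) (f : {rmorphism R -> R'}),
       agree_at s f -> f e = 1) ->
  I 1.
Proof.
move=> hI cov; apply: contrapT => I1; have [p Ip] := proper_prime hI I1.
pose hp := prime_ideal p; pose f := quot_map hp.
have f1 : f 1 <> 0 by move=> /quot_map0; exact: prime1.
have /choice[s0 s0P] c : exists c', f (x c') = f (y c).
  have [zs [_ cz [q qE]]] := separable_roots c.
  have : prime_set p (\prod_(z <- zs) (y c - x z)).
    by rewrite (conj_roots xy cz qE); exact: prime0.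
  case/prime_prod => z _ h; exists z; apply/esym/subr0_eq.
  by rewrite -rmorphB; apply/quot_map0.
have inj_x c c' : f (x c) = f (x c') -> c = c'.
  move=> e; apply/eqP; rewrite -subr_eq0; apply: contrapT => /negP cc; apply: f1.
  by rewrite -(rmorph1 x) -(mulVf cc) !rmorphM !rmorphB e subrr mulr0.
have s0B : zmod_morphism s0.
  by move=> c c'; apply: inj_x; rewrite s0P !rmorphB !s0P.
have s0M : monoid_morphism s0.
  split=> [|c c']; first by apply: inj_x; rewrite s0P !rmorph1.
  by apply: inj_x; rewrite s0P !rmorphM !s0P.
pose s1 : {rmorphism kbar -> kbar} := HB.pack s0
  (GRing.isZmodMorphism.Build kbar kbar s0 s0B)
  (GRing.isMonoidMorphism.Build kbar kbar s0 s0M).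
have s1k c : s1 (iota c) = iota c by apply: inj_x; rewrite [LHS]s0P xy.
have [e [Ie eP]] := cov (Gal (alg_endo_bij alg s1k) s1k).
have := Ip e Ie; rewrite -(quot_map0 hp) (eP _ (quot_map hp)) // => c; exact/esym/s0P.
Qed.

Lemma lagrange_agree (R' : comPzRingType) (f : {rmorphism R -> R'}) s zs z c :
  agree_at s f ->
  f (lagrange x zs z (y c)) = lagrange (rcomp f x) zs z (rcomp f x (s c)).
Proof. by move=> fs; rewrite lagrange_map fs. Qed.

(** On the locus of s, the Lagrange polynomial at s c takes the value 1 at y
    c; it kills y c - x (s c). *)
Lemma galois_local (S : comPzRingType) (phi : {rmorphism R -> S}) (s : gal) (r : S) :
  ideal_gen [set a | exists c, a = phi (y c - x (s c))] r ->
  exists2 e, phi e * r = 0 & forall (R' : comPzRingType) (f : {rmorphism R -> R'}),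
    agree_at s f -> f e = 1.
Proof.
elim=> [_ [c ->]||a b _ [e ea e1] _ [e' eb e'1]|a b _ [e eb e1]] /=.
- have [zs [uz cz [p pE]]] := separable_roots c.
  exists (lagrange x zs (s c) (y c)).
    rewrite -rmorphM lagrange_ann ?rmorph0 //; first exact: gal_roots pE.
    exact: conj_roots pE.
  by move=> R' f fs; rewrite (lagrange_agree _ _ _ fs) lagrange_eq1.
- by exists 1; [rewrite mulr0|move=> R' f _; exact: rmorph1].
- exists (e * e'); last by move=> R' f fs; rewrite rmorphM e1 // e'1 ?mul1r.
  by rewrite rmorphM mulrDr mulrAC ea mul0r add0r -mulrA eb mulr0.
- by exists e => //; rewrite mulrCA eb mulr0.
Qed.

(** An element that vanishes on the locus of s is killed by an element that
    is 1 there; the elements that kill r generate therefore the unit ideal. *)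
Lemma galois_separate (r : R) :
  (forall s (R' : comPzRingType) (f : {rmorphism R -> R'}),
     agree_at s f -> f r = 0) -> r = 0.
Proof.
move=> h; rewrite -[r]mul1r.
apply: (@galois_cover [set a | a * r = 0]).
  split=> [|a b /= ea eb|a b /= eb]; first exact: mul0r.
    by rewrite mulrDl ea eb addr0.
  by rewrite -mulrA eb mulr0.
move=> s; pose J := ideal_gen [set a | exists c, a = rid R (y c - x (s c))].
pose hJ : is_ideal J := ideal_gen_ideal _.
have [|e er e1] := @galois_local R (rid R) s r; last by exists e.
apply/(quot_map0 hJ)/(h s) => c; apply: subr0_eq; rewrite -rmorphB.
by apply/quot_map0; apply: ig_base; exists c.
Qed.

Lemma galois_separate2 (r r' : R) :
  (forall s (R' : comPzRingType) (f : {rmorphism R -> R'}),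
     agree_at s f -> f r = f r') -> r = r'.
Proof.
move=> h; apply: subr0_eq; apply: galois_separate => s R' f fs.
by rewrite rmorphB (h s) // subrr.
Qed.

(** A product of Lagrange polynomials, one for each element of cs. *)
Lemma galois_bump (s : gal) (cs : seq kbar) : exists2 e : R,
  forall (R' : comPzRingType) (f : {rmorphism R -> R'}),
    agree_at s f -> f e = 1 &
  forall (t : gal) (R' : comPzRingType) (f : {rmorphism R -> R'}),
    agree_at t f -> map t cs != map s cs -> f e = 0.
Proof.
elim: cs => [|c cs [e e1 e0]].
  by exists 1 => [R' f _|t R' f _]; [exact: rmorph1|rewrite eqxx].
have [zs [uz cz [p pE]]] := separable_roots c.
exists (lagrange x zs (s c) (y c) * e) => [R' f fs|t R' f ft].
  by rewrite rmorphM e1 // mulr1 (lagrange_agree _ _ _ fs) lagrange_eq1.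
rewrite rmorphM (lagrange_agree _ _ _ ft) eqseq_cons negb_and => /orP[tsc|tscs].
  by rewrite lagrange_eq0 ?mul0r //; exact: gal_roots pE.
by rewrite (e0 t) ?mulr0.
Qed.

(** A partition of unity: the elements a for which the family a * g s glues
    form an ideal, that contains the functions given by galois_bump. *)
Lemma galois_glue (g : gal -> R) : locst g ->
  exists r, forall s (R' : comPzRingType) (f : {rmorphism R -> R'}),
    agree_at s f -> f r = f (g s).
Proof.
move=> lg; suff [r rP] : exists r,
    forall s (R' : comPzRingType) (f : {rmorphism R -> R'}),
      agree_at s f -> f r = f (1 * g s).
  by exists r => s R' f fs; rewrite (rP s) // mul1r.
pose I := [set a | exists r,
    forall s (R' : comPzRingType) (f : {rmorphism R -> R'}),
      agree_at s f -> f r = f (a * g s)].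
apply: (@galois_cover I).
  split=> [|a b [r rP] [q qP]|a b [r rP]].
  - by exists 0 => s R' f fs; rewrite mul0r.
  - exists (r + q) => s R' f fs.
    by rewrite mulrDl !rmorphD (rP s) // (qP s).
  - by exists (a * r) => s R' f fs; rewrite rmorphM (rP s) // -rmorphM mulrA.
move=> s; have /nbhs_gal[cs csP] := lg s.
have [e e1 e0] := galois_bump s cs; exists e; split=> //.
exists (e * g s) => t R' f ft; rewrite !rmorphM.
have [/csP /= ->//|ts] := eqVneq (map t cs) (map s cs).
by rewrite (e0 t) // !mul0r.
Qed.

Section GlueMorphism.
Variables (B : comPzRingType) (f : gal -> {rmorphism B -> R}).
Hypothesis lf : forall b, locst (fun s => f s b).

Definition glue_fun (b : B) : R := sval (cid (galois_glue (lf b))).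

Lemma glue_funE b s (R' : comPzRingType) (h : {rmorphism R -> R'}) :
  agree_at s h -> h (glue_fun b) = h (f s b).
Proof. exact: svalP (cid (galois_glue (lf b))) s R' h. Qed.

Fact glue_zmod : zmod_morphism glue_fun.
Proof.
move=> a b; apply: galois_separate2 => s R' h hs.
by rewrite rmorphB !(glue_funE _ hs) !rmorphB.
Qed.
Fact glue_monoid : monoid_morphism glue_fun.
Proof.
split=> [|a b]; apply: galois_separate2 => s R' h hs.
  by rewrite (glue_funE _ hs) !rmorph1.
by rewrite rmorphM !(glue_funE _ hs) !rmorphM.
Qed.
HB.instance Definition _ := GRing.isZmodMorphism.Build _ _ glue_fun glue_zmod.
HB.instance Definition _ :=
  GRing.isMonoidMorphism.Build _ _ glue_fun glue_monoid.

Definition glue_hom : {rmorphism B -> R} := glue_fun.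

Lemma glue_homE b s (R' : comPzRingType) (h : {rmorphism R -> R'}) :
  agree_at s h -> h (glue_hom b) = h (f s b).
Proof. exact: glue_funE. Qed.
End GlueMorphism.
End Covering.

Definition kk := tensor iota iota.

Definition kk_pt (s : gal) : {rmorphism kk -> kbar} :=
  @tensor_lift _ _ _ iota iota _ (rid kbar) s (fun c => esym (gal_fix s c)).

Lemma kk_pt_agree s :
  agree_at (tensor_inl iota iota) (tensor_inr iota iota) s (kk_pt s).
Proof. by move=> c; rewrite tensor_liftr tensor_liftl. Qed.

(** Quasi-compactness of the spectrum of kbar (x)_k kbar: the elements whose
    support satisfies P form an ideal, that contains an element equal to 1 at
    s for every s. *)
Lemma gal_compact (P : set (set gal)) :
  (forall A B, A `<=` B -> P B -> P A) ->
  (forall A B, P A -> P B -> P (A `|` B)) ->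
  (forall s : gal, exists2 A, nbhs s A & P A) -> P setT.
Proof.
move=> subP unionP covP.
pose supp (a : kk) := [set s | kk_pt s a <> 0].
have I1 : P (supp 1).
  apply: (galois_cover (@tensor_comm _ _ _ iota iota)
    (I := [set a | P (supp a)])).
    split=> [|a b Pa Pb|a b Pb] /=.
    - have [A _ PA] := covP (gal_one iota).
      by apply: subP PA => s; rewrite /supp /mkset rmorph0.
    - apply: subP (unionP _ _ Pa Pb) => s; rewrite /supp /mkset rmorphD => h.
      apply: contrapT => /not_orP[/contrapT a0 /contrapT b0].
      by apply: h; rewrite a0 b0 addr0.
    - by apply: subP Pb => s; rewrite /supp /mkset rmorphM => h b0;
        apply: h; rewrite b0 mulr0.
  move=> s; have [A /nbhs_gal[cs csA] PA] := covP s.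
  have [e e1 e0] := galois_bump (tensor_inl iota iota) (tensor_inr iota iota)
    s cs.
  exists e; split=> //=; apply: subP PA => t /= te; apply: csA.
  apply/eqP/negPn/negP => ts; apply: te.
  exact: e0 (@kk_pt_agree t) ts.
by apply: subP I1 => s _; rewrite /supp /mkset rmorph1; apply/eqP; exact: oner_neq0.
Qed.

(** Local choices can be made locally constant, the group being profinite. *)
Lemma locst_choice (Y : Type) (Q : gal -> Y -> Prop) :
  (forall s : gal, exists v, nbhs s [set t | Q t v]) ->
  exists2 g : gal -> Y, locst g & forall s, Q s (g s).
Proof.
move=> hQ.
pose ok (A : set gal) := exists g : gal -> option Y, [/\ locst g,
  forall s v, g s = Some v -> Q s v & forall s, A s -> g s <> None].
have [g [lg gQ gA]] : ok setT.
  apply: gal_compact => [A B AB [g [lg gQ gB]]|A B [g [lg gQ gA]] [h [lh hQ' hB]]|s].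
  - by exists g; split=> // s /AB; exact: gB.
  - exists (fun s => if g s is Some v then Some v else h s); split.
    + exact: (locst2 (fun a b => if a is Some v then Some v else b)).
    + by move=> s v; case gs: (g s) => [w|] => [[<-]|/hQ' //]; exact: gQ.
    + by move=> s [/gA|/hB]; case: (g s).
  - have [v vs] := hQ s; have /nbhs_gal[cs csQ] := vs.
    exists [set t : gal | map t cs = map s cs].
      by apply/nbhs_gal; exists cs.
    exists (fun t : gal => if map t cs == map s cs then Some v else None); split.
    + move=> t; apply/nbhs_gal; exists cs => u /= -> //.
    + by move=> t w; case: eqP => // /csQ Qt [<-].
    + by move=> t /= ->; rewrite eqxx.
have /choice[h hP] s : exists v, g s = Some v.
  by case gs: (g s) => [v|]; [exists v|have := gA s I].
exists h => [s|s]; last exact/gQ/hP.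
by apply: filterS (lg s) => t /=; rewrite !hP => -[].
Qed.
End Gluing.

(** * Linear functionals and tensor products *)

(** The scalars act by an explicit function op, because a ring of functions
    on arrows is a vector space over kbar in two ways, by its source and by
    its target. *)
Section Functional.
Variables (K : fieldType) (V : zmodType) (op : K -> V -> V).
Hypotheses (opDr : forall c u v, op c (u + v) = op c u + op c v).
Hypotheses (opDl : forall c d v, op (c + d) v = op c v + op d v).
Hypotheses (opM : forall c d v, op (c * d) v = op c (op d v)).
Hypotheses (op1 : forall v, op 1 v = v).

Definition is_subspace (W : set V) :=
  [/\ W 0, forall u v, W u -> W v -> W (u + v) & forall c u, W u -> W (op c u)].

Fact op0 v : op 0 v = 0.
Proof. by apply: (addrI (op 0 v)); rewrite -opDl !addr0. Qed.

Fact opr0 c : op c 0 = 0.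
Proof. by apply: (addrI (op c 0)); rewrite -opDr !addr0. Qed.

Fact opN1 v : op (- 1) v = - v.
Proof. by apply: (addrI v); rewrite -{1}[v]op1 -opDl !subrr op0. Qed.

Fact opNr c v : op c (- v) = - op c v.
Proof. by apply: (addrI (op c v)); rewrite -opDr !subrr opr0. Qed.

Fact opNl c v : op (- c) v = - op c v.
Proof. by apply: (addrI (op c v)); rewrite -opDl !subrr op0. Qed.

Fact subspaceB W u v : is_subspace W -> W u -> W v -> W (u - v).
Proof. by case=> _ WD WZ Wu Wv; apply: WD => //; rewrite -opN1; exact: WZ. Qed.

(** A subspace maximal among those containing W but not b is a hyperplane. *)
Lemma linear_functional (W : set V) (b : V) : is_subspace W -> ~ W b ->
  exists l : V -> K, [/\ forall u v, l (u + v) = l u + l v,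
    forall c u, l (op c u) = c * l u, forall u, W u -> l u = 0 & l b = 1].
Proof.
move=> sW nWb.
pose P : set (set V) := [set X | X = set0 \/
  [/\ is_subspace X, W `<=` X & ~ X b]].
have [F FP totF|M [PM maxM]] := @Zorn_bigcup V P.
  have [[X FX [x Xx]]|nF] := pselect (exists2 X, F X & X !=set0); last first.
    left; apply/seteqP; split=> // x [X FX Xx]; apply: nF.
    by exists X => //; exists x.
  have inF Z z : F Z -> Z z -> [/\ is_subspace Z, W `<=` Z & ~ Z b].
    by move=> /FP[->//|].
  right; split.
  - split.
    + by exists X => //; have [[]] := inF X x FX Xx.
    + move=> u v [Y FY Yu] [Z FZ Zv]; have [YZ|ZY] := totF Y Z FY FZ.
        by exists Z => //; have [[_ ZD _] _ _] := inF Z v FZ Zv;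
          apply: ZD => //; exact: YZ.
      by exists Y => //; have [[_ YD _] _ _] := inF Y u FY Yu;
        apply: YD => //; exact: ZY.
    + move=> c u [Y FY Yu]; exists Y => //.
      by have [[_ _ YZ] _ _] := inF Y u FY Yu; exact: YZ.
  - by move=> w Ww; exists X => //; have [_ WX _] := inF X x FX Xx; exact: WX.
  - by case=> Y FY Yb; have [_ _] := inF Y b FY Yb.
have [M0|[sM WM nMb]] := PM.
  exfalso; apply: (maxM W); last by right; split.
  by rewrite M0; split=> //; case: sW => W0 _ _ /(_ 0 W0).
have [M_0 MD MZ] := sM.
have /choice[l lP] v : exists c, M (v - op c b).
  have [Mv|nMv] := pselect (M v); first by exists 0; rewrite op0 subr0.
  pose N : set V := [set w | exists c, M (w - op c v)].
  have sN : is_subspace N.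
    split.
    - by exists 0; rewrite op0 subr0.
    - move=> u w [c Mu] [d Mw]; exists (c + d).
      by rewrite opDl opprD addrACA; exact: MD.
    - move=> c u [d Mu]; exists (c * d).
      by rewrite opM -opNr -opDr; exact: MZ.
  have MN : M `<` N.
    split=> [w Mw|NM]; first by exists 0; rewrite op0 subr0.
    by apply: nMv; apply: NM; exists 1; rewrite op1 subrr.
  have : N b.
    apply: contrapT => nNb; apply: (maxM N) => //; right; split=> //.
    by move=> w /WM Mw; exists 0; rewrite op0 subr0.
  case=> d Mb; have d0 : d != 0.
    by apply/eqP => d0; apply: nMb; move: Mb; rewrite d0 op0 subr0.
  exists d^-1; have := MZ (- d^-1) _ Mb.
  by rewrite opDr opNr -opM mulNr mulVf // !opNl op1 opprK addrC.
have lE v c : M (v - op c b) -> l v = c.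
  move=> h; apply/eqP; rewrite -subr_eq0; apply: contrapT => /negP lc; apply: nMb.
  have : M (op (l v - c) b).
    have := subspaceB sM h (lP v).
    by rewrite opprB addrC addrA subrK -opNl -opDl.
  by move=> /(MZ (l v - c)^-1); rewrite -opM mulVf // op1.
exists l; split.
- by move=> u v; apply: lE; rewrite opDl opprD addrACA; exact: MD.
- by move=> c u; apply: lE; rewrite opM -opNr -opDr; exact: MZ.
- by move=> u Wu; apply: lE; rewrite op0 subr0; exact: WM.
- by apply: lE; rewrite op1 subrr.
Qed.
End Functional.

(** The tensor product being defined by a universal property among rings, its
    additive maps have to be obtained from a ring. That ring is the one in
    which A and B act on the K-linear maps A -> B, by x . phi = phi (x * -) and
    y . phi = y * phi; it is described by formal expressions modulo those that
    act in the same way. *)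
Section TensorFunctional.
Variables (K A B : comPzRingType).
Variables (a : {rmorphism K -> A}) (b : {rmorphism K -> B}).

Definition klinear (phi : A -> B) :=
  (forall x y, phi (x + y) = phi x + phi y) /\
  (forall c x, phi (a c * x) = b c * phi x).

Fixpoint act (e : rexpr (A + B)) (phi : A -> B) : A -> B :=
  match e with
  | RVar (inl x) => fun z => phi (x * z)
  | RVar (inr y) => fun z => y * phi z
  | RZero => fun _ => 0
  | ROne => phi
  | RAdd e1 e2 => fun z => act e1 phi z + act e2 phi z
  | RMul e1 e2 => act e1 (act e2 phi)
  | ROpp e1 => fun z => - act e1 phi z
  end.

Fact act_klinear e phi : klinear phi -> klinear (act e phi).
Proof.
elim: e phi => [[x|y]|||e1 h1 e2 h2|e1 h1 e2 h2|e h] phi [pD pZ] //=.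
- split=> [u v|c u]; first by rewrite mulrDr pD.
  by rewrite mulrCA pZ.
- split=> [u v|c u]; first by rewrite pD mulrDr.
  by rewrite pZ mulrCA.
- by split=> [u v|c u]; rewrite ?addr0 ?mulr0.
- have [D1 Z1] := h1 phi (conj pD pZ); have [D2 Z2] := h2 phi (conj pD pZ).
  split=> [u v|c u]; first by rewrite D1 D2 addrACA.
  by rewrite Z1 Z2 mulrDr.
- by apply: h1; exact: h2.
- have [D1 Z1] := h phi (conj pD pZ).
  split=> [u v|c u]; first by rewrite D1 opprD.
  by rewrite Z1 mulrN.
Qed.

Fact actD e phi psi :
  act e (fun z => phi z + psi z) = fun z => act e phi z + act e psi z.
Proof.
elim: e phi psi => [[x|y]|||e1 h1 e2 h2|e1 h1 e2 h2|e h] phi psi /=;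
  apply/funext => z //=.
- by rewrite mulrDr.
- by rewrite addr0.
- by rewrite h1 h2 addrACA.
- by rewrite h2 h1.
- by rewrite h opprD.
Qed.

Fact act_0 e : act e (fun=> 0) = fun=> 0.
Proof.
elim: e => [[x|y]|||e1 h1 e2 h2|e1 h1 e2 h2|e h] //=; apply/funext => z.
- by rewrite mulr0.
- by rewrite h1 h2 addr0.
- by rewrite h2 h1.
- by rewrite h oppr0.
Qed.

Fact actN e phi : act e (fun z => - phi z) = fun z => - act e phi z.
Proof.
apply/funext => z; apply/eqP; rewrite -addr_eq0 -[_ + _]/
  ((fun z => act e (fun z => - phi z) z + act e phi z) z) -actD.
suff -> : (fun z => - phi z + phi z) = fun=> 0 by rewrite act_0.
by apply/funext => t; rewrite addNr.
Qed.

Fact act_shift e x phi : act e (fun z => phi (x * z)) = fun z => act e phi (x * z).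
Proof.
elim: e phi => [[x'|y]|||e1 h1 e2 h2|e1 h1 e2 h2|e h] phi //=; apply/funext => z.
- by rewrite mulrCA.
- by rewrite h1 h2.
- by rewrite h2 h1.
- by rewrite h.
Qed.

Fact act_scale e y phi : act e (fun z => y * phi z) = fun z => y * act e phi z.
Proof.
elim: e phi => [[x'|y']|||e1 h1 e2 h2|e1 h1 e2 h2|e h] phi //=; apply/funext => z.
- by rewrite mulrCA.
- by rewrite mulr0.
- by rewrite h1 h2 mulrDr.
- by rewrite h2 h1.
- by rewrite h mulrN.
Qed.

Fact act_comm e f phi : act e (act f phi) = act f (act e phi).
Proof.
elim: f phi => [[x|y]|||f1 h1 f2 h2|f1 h1 f2 h2|f h] phi /=.
- exact: act_shift.
- exact: act_scale.
- exact: act_0.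
- by [].
- by rewrite actD h1 h2.
- by rewrite h1 h2.
- by rewrite actN h.
Qed.

Definition act_eqv : rel (rexpr (A + B)) := fun e f =>
  `[< forall phi, klinear phi -> act e phi = act f phi >].

Fact act_eqv_equiv : equiv_class_of act_eqv.
Proof.
split=> [e|e f|e f g]; first exact/asboolP.
  by apply/asbool_equiv_eq; split=> h phi lphi; rewrite h.
by move=> /asboolP h1 /asboolP h2; apply/asboolP => phi lphi; rewrite h1 ?h2.
Qed.

Canonical act_equiv := EquivRelPack act_eqv_equiv.
Definition act_ring := {eq_quot act_equiv}.
HB.instance Definition _ := Choice.on act_ring.

Definition ar_of (e : rexpr (A + B)) : act_ring := \pi e.
Definition ar_act (t : act_ring) (phi : A -> B) := act (repr t) phi.

Fact ar_ofE e phi : klinear phi -> ar_act (ar_of e) phi = act e phi.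
Proof.
move=> lphi; rewrite /ar_act.
have /eqmodP/asboolP h : repr (ar_of e) = e %[mod act_ring] by rewrite reprK.
exact: h.
Qed.

Fact ar_eq (s t : act_ring) :
  (forall phi, klinear phi -> ar_act s phi = ar_act t phi) -> s = t.
Proof. by move=> h; rewrite -(reprK s) -(reprK t); apply/eqmodP/asboolP. Qed.

Fact ar_act_klinear t phi : klinear phi -> klinear (ar_act t phi).
Proof. exact: act_klinear. Qed.

Definition ar_add (s t : act_ring) := ar_of (RAdd (repr s) (repr t)).
Definition ar_mul (s t : act_ring) := ar_of (RMul (repr s) (repr t)).
Definition ar_opp (s : act_ring) := ar_of (ROpp (repr s)).

Fact ar_addE s t phi : klinear phi ->
  ar_act (ar_add s t) phi = fun z => ar_act s phi z + ar_act t phi z.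
Proof. exact: ar_ofE. Qed.
Fact ar_mulE s t phi : klinear phi ->
  ar_act (ar_mul s t) phi = ar_act s (ar_act t phi).
Proof. exact: ar_ofE. Qed.
Fact ar_oppE s phi : klinear phi ->
  ar_act (ar_opp s) phi = fun z => - ar_act s phi z.
Proof. exact: ar_ofE. Qed.

Fact ar_addA : associative ar_add.
Proof.
by move=> r s t; apply: ar_eq => p lp; rewrite !ar_addE //; apply/funext => z;
  rewrite addrA.
Qed.
Fact ar_addC : commutative ar_add.
Proof.
by move=> s t; apply: ar_eq => p lp; rewrite !ar_addE //; apply/funext => z;
  rewrite addrC.
Qed.
Fact ar_add0 : left_id (ar_of (RZero _)) ar_add.
Proof.
by move=> s; apply: ar_eq => p lp; rewrite ar_addE // ar_ofE //;
  apply/funext => z; rewrite /= add0r.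
Qed.
Fact ar_addN : left_inverse (ar_of (RZero _)) ar_opp ar_add.
Proof.
by move=> s; apply: ar_eq => p lp; rewrite ar_addE // ar_oppE // ar_ofE //;
  apply/funext => z; rewrite /= addNr.
Qed.
Fact ar_mulA : associative ar_mul.
Proof.
move=> r s t; apply: ar_eq => p lp; rewrite !ar_mulE //.
exact: ar_act_klinear.
Qed.
Fact ar_mulC : commutative ar_mul.
Proof. by move=> s t; apply: ar_eq => p lp; rewrite !ar_mulE //; exact: act_comm. Qed.
Fact ar_mul1 : left_id (ar_of (ROne _)) ar_mul.
Proof.
move=> s; apply: ar_eq => p lp; rewrite ar_mulE // ar_ofE //.
exact: ar_act_klinear.
Qed.
Fact ar_mulD : left_distributive ar_mul ar_add.
Proof.
move=> r s t; apply: ar_eq => p lp; rewrite ar_addE // !ar_mulE // ar_addE //.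
exact: ar_act_klinear.
Qed.

HB.instance Definition _ :=
  GRing.isZmodule.Build act_ring ar_addA ar_addC ar_add0 ar_addN.
HB.instance Definition _ :=
  GRing.Zmodule_isComPzRing.Build act_ring ar_mulA ar_mulC ar_mul1 ar_mulD.

Definition ar_inl (x : A) : act_ring := ar_of (RVar (inl x)).
Definition ar_inr (y : B) : act_ring := ar_of (RVar (inr y)).

Fact klinearB phi x y : klinear phi -> phi (x - y) = phi x - phi y.
Proof. by case=> pD _; apply: (addIr (phi y)); rewrite -pD !subrK. Qed.

Fact ar_inl_zmod : zmod_morphism ar_inl.
Proof.
move=> x y; apply: ar_eq => p lp; rewrite ar_addE // ar_oppE // !ar_ofE //.
by apply/funext => z /=; rewrite mulrBl klinearB.
Qed.
Fact ar_inl_monoid : monoid_morphism ar_inl.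
Proof.
split=> [|x y]; apply: ar_eq => p lp.
  by rewrite !ar_ofE //; apply/funext => z /=; rewrite mul1r.
rewrite ar_mulE // !ar_ofE //; last exact: act_klinear.
by apply/funext => z /=; rewrite mulrAC mulrC mulrA.
Qed.
Fact ar_inr_zmod : zmod_morphism ar_inr.
Proof.
move=> x y; apply: ar_eq => p lp; rewrite ar_addE // ar_oppE // !ar_ofE //.
by apply/funext => z /=; rewrite mulrBl.
Qed.
Fact ar_inr_monoid : monoid_morphism ar_inr.
Proof.
split=> [|x y]; apply: ar_eq => p lp.
  by rewrite !ar_ofE //; apply/funext => z /=; rewrite mul1r.
rewrite ar_mulE // !ar_ofE //; last exact: act_klinear.
by apply/funext => z /=; rewrite mulrA.
Qed.
HB.instance Definition _ := GRing.isZmodMorphism.Build _ _ ar_inl ar_inl_zmod.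
HB.instance Definition _ := GRing.isMonoidMorphism.Build _ _ ar_inl ar_inl_monoid.
HB.instance Definition _ := GRing.isZmodMorphism.Build _ _ ar_inr ar_inr_zmod.
HB.instance Definition _ := GRing.isMonoidMorphism.Build _ _ ar_inr ar_inr_monoid.

Fact ar_in_comm c : (ar_inl : {rmorphism A -> act_ring}) (a c) =
  (ar_inr : {rmorphism B -> act_ring}) (b c).
Proof.
apply: ar_eq => p lp; rewrite !ar_ofE //; apply/funext => z /=.
by case: lp => _ ->.
Qed.

Lemma tensor_functional (phi : A -> B) : klinear phi ->
  exists2 L : tensor a b -> B, forall s t, L (s + t) = L s + L t &
    forall x y, L (tensor_inl a b x * tensor_inr a b y) = phi x * y.
Proof.
move=> lphi; pose T := tensor_lift ar_in_comm.
exists (fun t => ar_act (T t) phi 1) => [s t|x y].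
  by rewrite rmorphD /= ar_addE.
rewrite rmorphM tensor_liftl tensor_liftr ar_mulE // ar_ofE ?ar_ofE //=.
  by rewrite mulr1 mulrC.
exact: (act_klinear (RVar (inr y))).
Qed.

Lemma tensor_sum (t : tensor a b) : exists s : seq (A * B),
  t = \sum_(xy <- s) tensor_inl a b xy.1 * tensor_inr a b xy.2.
Proof.
rewrite -(reprK t) -[\pi _]pr_reval.
elim: (repr t) => [[x|y]|||e1 [s1 h1] e2 [s2 h2]|e1 [s1 h1] e2 [s2 h2]|e [s h]] /=.
- exists [:: (x, 1)]; rewrite big_seq1 rmorph1 mulr1 //.
- exists [:: (1, y)]; rewrite big_seq1 rmorph1 mul1r //.
- by exists [::]; rewrite big_nil.
- by exists [:: (1, 1)]; rewrite big_seq1 !rmorph1 mulr1.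
- by exists (s1 ++ s2); rewrite big_cat h1 h2.
- exists [seq (p.1 * q.1, p.2 * q.2) | p <- s1, q <- s2].
  rewrite h1 h2 big_allpairs_dep mulr_suml; apply: eq_bigr => p _.
  rewrite mulr_sumr; apply: eq_bigr => q _.
  by rewrite !rmorphM mulrACA.
- exists [seq (- p.1, p.2) | p <- s].
  rewrite h big_map -sumrN; apply: eq_bigr => p _.
  by rewrite rmorphN mulNr.
Qed.
End TensorFunctional.

(** * Polynomial rings: the basis theorem and the theorem of zeros *)

(** The coefficients change in the recursion, so that the variables can be
    eliminated one by one. *)
Fixpoint mpol (R : comNzRingType) (n : nat) : comNzRingType :=
  if n is m.+1 then mpol {poly R} m else R.

Fixpoint mconst (R : comNzRingType) (n : nat) : {rmorphism R -> mpol R n} :=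
  match n with
  | 0 => rid R
  | m.+1 => rcomp (mconst {poly R} m) (polyC : {rmorphism R -> {poly R}})
  end.

Fixpoint mgen (R : comNzRingType) (n : nat) (i : nat) : mpol R n :=
  match n with
  | 0 => 0
  | m.+1 => if i is j.+1 then mgen {poly R} m j else mconst {poly R} m 'X
  end.

Fixpoint mev (R : comNzRingType) (S : comPzRingType) (n : nat)
    (f : {rmorphism R -> S}) (c : nat -> S) : {rmorphism mpol R n -> S} :=
  match n with
  | 0 => f
  | m.+1 => mev m (pevals f (c 0)) (fun i => c i.+1)
  end.

Lemma mevC (R : comNzRingType) (S : comPzRingType) (n : nat)
  (f : {rmorphism R -> S}) (c : nat -> S) a : mev n f c (mconst R n a) = f a.
Proof.
elim: n R f c a => //= n IH R f c a.
by rewrite IH; exact: pevalC.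
Qed.

Lemma mevX (R : comNzRingType) (S : comPzRingType) (n : nat)
  (f : {rmorphism R -> S}) (c : nat -> S) i :
  (i < n)%N -> mev n f c (mgen R n i) = c i.
Proof.
elim: n R f c i => //= n IH R f c [_|i ni]; last exact: IH.
by rewrite mevC; exact: pevalX.
Qed.

Lemma poly_hom_ext (R : comNzRingType) (S : comPzRingType)
  (g h : {rmorphism {poly R} -> S}) :
  (forall a, g a%:P = h a%:P) -> g 'X = h 'X -> g = h.
Proof.
move=> ghC ghX; apply: rmorph_ext; elim/poly_ind => [|p c IH].
  by rewrite !rmorph0.
by rewrite !rmorphD !rmorphM ghC IH ghX.
Qed.

Lemma mpol_hom_ext (R : comNzRingType) (S : comPzRingType) n
  (g h : {rmorphism mpol R n -> S}) :
  (forall a, g (mconst R n a) = h (mconst R n a)) ->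
  (forall i, (i < n)%N -> g (mgen R n i) = h (mgen R n i)) -> g = h.
Proof.
elim: n R g h => [|n IH] R g h ghC ghX; first exact: rmorph_ext.
apply: IH => [a|i ni]; last exact: (ghX i.+1).
have e : rcomp g (mconst {poly R} n) = rcomp h (mconst {poly R} n).
  by apply: poly_hom_ext => [b|]; [exact: ghC|exact: (ghX 0%N)].
exact: (congr1 (fun f : {rmorphism {poly R} -> S} => f a) e).
Qed.

Section Noetherian.
Definition span (R : comPzRingType) (s : seq R) : set R :=
  ideal_gen [set x | x \in s].

Definition noetherian (R : comPzRingType) := forall P : set R,
  exists s : seq R, (forall x, x \in s -> P x) /\ P `<=` span s.

Lemma span_ideal (R : comPzRingType) (s : seq R) : is_ideal (span s).
Proof. exact: ideal_gen_ideal. Qed.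

Lemma span_sub (R : comPzRingType) (s t : seq R) :
  {subset s <= t} -> span s `<=` span t.
Proof. by move=> st; apply: ideal_gen_sub => x /=; exact: st. Qed.

Lemma ideal_gen_finite (R : comPzRingType) (P : set R) x : ideal_gen P x ->
  exists s : seq R, (forall y, y \in s -> P y) /\ span s x.
Proof.
elim=> [y Py||y z _ [s [sP sy]] _ [t [tP tz]]|y z _ [s [sP sz]]].
- exists [:: y]; split=> [z|]; first by rewrite inE => /eqP->.
  by apply: ig_base => /=; rewrite inE.
- by exists [::]; split=> //; exact: ig_0.
- exists (s ++ t); split=> [w|]; first by rewrite mem_cat => /orP[/sP|/tP].
  apply: ig_add; first by apply: (span_sub _ sy) => w; rewrite mem_cat => ->.
  by apply: (span_sub _ tz) => w; rewrite mem_cat => ->; rewrite orbT.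
- by exists s; split=> //; exact: ig_mul.
Qed.

Lemma span_finite (R : comPzRingType) (P : set R) (t : seq R) :
  (forall x, x \in t -> ideal_gen P x) ->
  exists s : seq R, (forall y, y \in s -> P y) /\ span t `<=` span s.
Proof.
elim: t => [|x t IH] tP.
  by exists [::]; split.
have [s [sP ts]] : exists s : seq R,
    (forall y, y \in s -> P y) /\ span t `<=` span s.
  by apply: IH => y yt; apply: tP; rewrite inE yt orbT.
have [r [rP rx]] := ideal_gen_finite (tP x (mem_head _ _)).
exists (r ++ s); split=> [y|]; first by rewrite mem_cat => /orP[/rP|/sP].
apply: ideal_gen_min; first exact: span_ideal.
move=> y /=; rewrite inE => /orP[/eqP->|yt].
  by apply: (span_sub _ rx) => w; rewrite mem_cat => ->.
have /span_sub : {subset s <= r ++ s} by move=> w; rewrite mem_cat => ->; rewrite orbT.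
by apply; apply: ts; exact: ig_base.
Qed.

Lemma noetherianP (R : comPzRingType) :
  (forall I : set R, is_ideal I -> exists s : seq R,
    (forall x, x \in s -> I x) /\ I `<=` span s) -> noetherian R.
Proof.
move=> h P; have [t [tP Pt]] := h _ (ideal_gen_ideal P).
have [s [sP ts]] := span_finite tP.
by exists s; split=> // x Px; apply: ts; apply: Pt; exact: ig_base.
Qed.

Lemma field_noetherian (K : fieldType) : noetherian K.
Proof.
move=> P; have [[x Px x0]|nP] := pselect (exists2 x, P x & x != 0).
  exists [:: x]; split=> [y|y _]; first by rewrite inE => /eqP->.
  by rewrite -(mulfVK x0 y); apply: ig_mul; apply: ig_base; rewrite /= inE.
exists [::]; split=> // x Px; have [->|x0] := eqVneq x 0; first exact: ig_0.
by case: nP; exists x.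
Qed.

Section Hilbert.
Variables (R : comNzRingType) (noethR : noetherian R).
Variables (I : set {poly R}) (hI : is_ideal I).

Let lead n : set R := [set a | exists p, [/\ I p, (size p <= n.+1)%N & p`_n = a]].

Fact lead_ideal n : is_ideal (lead n).
Proof.
split.
- by exists 0; rewrite size_poly0 coef0; split=> //; exact: ideal0.
- move=> _ _ [p [Ip sp <-]] [q [Iq sq <-]]; exists (p + q).
  rewrite coefD; split=> //; first exact: idealD.
  by rewrite (leq_trans (size_polyD _ _)) // geq_max sp.
- move=> a _ [p [Ip sp <-]]; exists (a%:P * p).
  rewrite coefCM; split=> //; first exact: idealM.
  by rewrite mul_polyC (leq_trans (size_scale_leq _ _)).
Qed.

Fact lead_mono m n : (m <= n)%N -> lead m `<=` lead n.
Proof.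
move=> /subnK <- _ [p [Ip sp <-]]; exists ('X^(n - m) * p).
rewrite coefXnM ltnNge leq_addr addKn; split=> //; first exact: idealM.
rewrite (leq_trans (size_polyMleq _ _)) // size_polyXn /=.
by rewrite -addnS leq_add2l.
Qed.

Fact lead_lift n (s : seq R) : (forall a, a \in s -> lead n a) ->
  exists t : seq {poly R}, (forall p, p \in t -> I p) /\
    forall a, span s a ->
      exists g, [/\ span t g, (size g <= n.+1)%N & g`_n = a].
Proof.
move=> sL; have [t [tI tP]] : exists t : seq {poly R},
    (forall p, p \in t -> I p) /\
    forall a, a \in s -> exists g, [/\ g \in t, (size g <= n.+1)%N & g`_n = a].
  elim: s sL => [|a s IH] sL; first by exists [::].
  have [t [tI tP]] : exists t : seq {poly R}, (forall p, p \in t -> I p) /\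
      forall a, a \in s -> exists g, [/\ g \in t, (size g <= n.+1)%N & g`_n = a].
    by apply: IH => b bs; apply: sL; rewrite inE bs orbT.
  have [p [Ip sp pa]] := sL a (mem_head _ _); exists (p :: t).
  split=> [q|b]; first by rewrite inE => /orP[/eqP->|/tI].
  rewrite inE => /orP[/eqP->|/tP[g [gt sg gb]]].
    by exists p; rewrite mem_head.
  by exists g; rewrite inE gt orbT.
exists t; split=> // a; elim=> [b /= /tP[g [gt sg gb]]||b c _ [g [tg sg gb]] _ [h [th sh hc]]|b c _ [g [tg sg gc]]].
- by exists g; split=> //; exact: ig_base.
- by exists 0; rewrite size_poly0 coef0; split=> //; exact: ig_0.
- exists (g + h); rewrite coefD gb hc; split=> //; first exact: ig_add.
  by rewrite (leq_trans (size_polyD _ _)) // geq_max sg.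
- exists (b%:P * g); rewrite coefCM gc; split=> //; first exact: ig_mul.
  by rewrite mul_polyC (leq_trans (size_scale_leq _ _)).
Qed.

Fact lead_stable : exists N, forall n, lead n `<=` lead N.
Proof.
have [s [sL Ls]] := noethR [set a | exists n, lead n a].
have [N NP] : exists N, forall a, a \in s -> lead N a.
  elim: s sL {Ls} => [|a s IH] sL; first by exists 0%N.
  have [N NP] : exists N, forall a, a \in s -> lead N a.
    by apply: IH => b bs; apply: sL; rewrite inE bs orbT.
  have [n an] := sL a (mem_head _ _); exists (maxn n N) => b.
  rewrite inE => /orP[/eqP->|/NP]; first exact: lead_mono (leq_maxl _ _) _ an.
  exact: lead_mono (leq_maxr _ _) _.
exists N => n a an; have : span s a by apply: Ls; exists n.
by apply: ideal_gen_min; [exact: lead_ideal|exact: NP].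
Qed.

(** Generators of the ideals of leading coefficients, up to the degree N
    where these ideals become stationary, lift to generators: subtracting a
    multiple of these lowers the degree. *)
Fact hilbert_ideal :
  exists s : seq {poly R}, (forall x, x \in s -> I x) /\ I `<=` span s.
Proof.
have [N NP] := lead_stable.
have low n : exists t : seq {poly R}, (forall p, p \in t -> I p) /\
    forall m a, (m < n)%N -> lead m a ->
      exists g, [/\ span t g, (size g <= m.+1)%N & g`_m = a].
  elim: n => [|n [t [tI tP]]]; first by exists [::].
  have [s [sL Ls]] := noethR (lead n); have [t' [t'I t'P]] := lead_lift sL.
  exists (t ++ t'); split=> [p|m a].
    by rewrite mem_cat => /orP[/tI|/t'I].
  rewrite ltnS leq_eqVlt => /orP[/eqP->|mn] La.
    have [g [tg sg ga]] := t'P a (Ls a La); exists g; split=> //.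
    by apply: (span_sub _ tg) => w; rewrite mem_cat => ->; rewrite orbT.
  have [g [tg sg ga]] := tP m a mn La; exists g; split=> //.
  by apply: (span_sub _ tg) => w; rewrite mem_cat => ->.
have [t [tI tP]] := low N.+1; exists t; split=> //.
have tsub : span t `<=` I by apply: ideal_gen_min.
move=> p; have [n] := ubnP (size p); elim: n p => // n IH p sp Ip.
have [->|p0] := eqVneq p 0; first exact: ig_0.
set m := (size p).-1; have sm : size p = m.+1 by rewrite prednK // lt0n size_poly_eq0.
have Lm : lead m p`_m by exists p; rewrite sm.
have [g [tg sg gm]] : exists g, [/\ span t g, (size g <= m.+1)%N & g`_m = p`_m].
  have [mN|Nm] := ltnP m N.+1; first exact: tP.
  have [g [tg sg gm]] := tP N _ (ltnSn N) (NP m _ Lm).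
  exists ('X^(m - N) * g); split; first exact: ig_mul.
    rewrite (leq_trans (size_polyMleq _ _)) // size_polyXn /=.
    by rewrite (leq_trans (leq_add (leqnn _) sg)) // addnS subnK // ltnW.
  by rewrite coefXnM ltnNge leq_subr subKn // ltnW.
rewrite -(subrK g p); apply: ig_add => //; apply: IH; last first.
  by apply: idealB => //; exact: tsub.
rewrite (leq_trans _ (ltnSE sp)) // sm ltnS; apply/leq_sizeP => j.
rewrite leq_eqVlt => /orP[/eqP<-|mj]; first by rewrite coefB gm subrr.
by rewrite coefB !nth_default ?subrr // ?sm // (leq_trans sg).
Qed.
End Hilbert.

Lemma poly_noetherian (R : comNzRingType) : noetherian R -> noetherian {poly R}.
Proof. by move=> nR; apply: noetherianP => I hI; exact: hilbert_ideal. Qed.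

Lemma mpol_noetherian (R : comNzRingType) n : noetherian R -> noetherian (mpol R n).
Proof. by elim: n R => //= n IH R nR; apply: IH; exact: poly_noetherian. Qed.
End Noetherian.

Lemma primeMr (R : comPzRingType) (p : spec R) x y :
  prime_set p x -> prime_set p (x * y).
Proof. by move=> px; rewrite mulrC; exact: primeMl. Qed.

Section Chevalley.
Variable L : closedFieldType.

Lemma poly_pdiv (R : comNzRingType) (d p : {poly R}) : d != 0 ->
  exists m q r, [/\ (lead_coef d ^+ m)%:P * p = q * d + r,
    (size r < size d)%N & (size q <= (size p - size d).+1)%N].
Proof.
move=> d0; have [n] := ubnP (size p); elim: n p => // n IH p sp.
have [pd|dp] := ltnP (size p) (size d).
  by exists 0%N, 0, p; rewrite expr0 mul1r mul0r add0r size_poly0.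
have p0 : p != 0.
  by rewrite -size_poly_gt0 (leq_trans _ dp) // size_poly_gt0.
set e := (size p - size d)%N.
pose p' := (lead_coef d)%:P * p - ((lead_coef p)%:P * 'X^e) * d.
have sp' : (size p' < size p)%N.
  rewrite -(prednK (n := size p)) ?size_poly_gt0 // ltnS; apply/leq_sizeP => j.
  rewrite /p' coefB coefCM -mulrA coefCM coefXnM.
  have se : (size d + e = size p)%N by rewrite subnKC.
  rewrite leq_eqVlt => /orP[/eqP<-|pj].
    have ep : (e <= (size p).-1)%N by rewrite -subn1 leq_sub2l // size_poly_gt0.
    rewrite ltnNge ep /= -{2}se.
    have -> : ((size d + e).-1 - e = (size d).-1)%N.
      by lia.
    by rewrite -!lead_coefE mulrC subrr.
  have pj' : (size p <= j)%N by rewrite -(prednK (n := size p)) ?size_poly_gt0.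
  rewrite nth_default // mulr0 ltnNge.
  have ej : (e <= j)%N by rewrite (leq_trans (leq_subr _ _)).
  rewrite ej /= nth_default ?mulr0 ?subrr //.
  by rewrite -(leq_add2r e) se subnK.
have [m [q [r [E sr sq]]]] := IH p' (leq_trans sp' (ltnSE sp)).
exists m.+1, (q + (lead_coef d ^+ m)%:P * ((lead_coef p)%:P * 'X^e)), r; split=> //.
  rewrite exprSr polyCM -mulrA mulrDl addrAC -E /p' mulrBr -!mulrA subrK //.
rewrite (leq_trans (size_polyD _ _)) // geq_max; apply/andP; split.
  rewrite (leq_trans sq) // ltnS leq_sub2r // ltnW //.
rewrite mulrA -polyCM mul_polyC (leq_trans (size_scale_leq _ _)) //.
by rewrite size_polyXn.
Qed.

Section Step.
Variables (R : comNzRingType) (p : spec {poly R}) (v : {poly R}).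
Hypothesis nv : ~ prime_set p v.

Let pc (a : R) := prime_set p a%:P.
Let hp := prime_ideal p.

Fact pc_poly (Q : {poly R}) : (forall i, pc Q`_i) -> prime_set p Q.
Proof.
move=> h; rewrite -[Q]coefK poly_def; apply: (ideal_sum hp) => i _.
by rewrite -mul_polyC; apply: primeMr; exact: h.
Qed.

Fact pc_sum (J : Type) (r : seq J) (P : pred J) (F : J -> R) :
  (forall j, P j -> pc (F j)) -> pc (\sum_(j <- r | P j) F j).
Proof.
by move=> h; rewrite /pc rmorph_sum; apply: (ideal_sum hp) => j; exact: h.
Qed.

Fact pcM a b : pc a -> pc (b * a).
Proof. by rewrite /pc polyCM; exact: primeMl. Qed.

Fact pcMl a b : pc a -> pc (a * b).
Proof. by rewrite mulrC; exact: pcM. Qed.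

Fact pc_trunc (D : {poly R}) : (forall i, pc D`_i) \/
  exists D' : {poly R}, [/\ (size D' <= size D)%N, ~ pc (lead_coef D') & prime_set p (D - D')].
Proof.
have [n] := ubnP (size D); elim: n D => // n IH D sD.
have [pl|npl] := pselect (pc (lead_coef D)); last first.
  by right; exists D; rewrite subrr; split=> //; exact: prime0.
have [D0|D0] := eqVneq D 0.
  by left=> i; rewrite D0 coef0 /pc rmorph0; exact: prime0.
pose E := D - (lead_coef D)%:P * 'X^((size D).-1).
have cE i : E`_i = if i == (size D).-1 then 0 else D`_i.
  rewrite coefB coefCM coefXn; case: eqP => [->|_].
    by rewrite mulr1 lead_coefE subrr.
  by rewrite mulr0 subr0.
have sE : (size E < size D)%N.
  rewrite -(prednK (n := size D)) ?size_poly_gt0 // ltnS; apply/leq_sizeP => j.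
  rewrite cE leq_eqVlt => /orP[/eqP->|Dj]; first by rewrite eqxx.
  rewrite gtn_eqF // nth_default // -(prednK (n := size D)) ?size_poly_gt0 //.
have pDE : prime_set p (D - E) by rewrite opprB addrCA subrr addr0; exact: primeMr.
case: (IH E (leq_trans sE (ltnSE sD))) => [h|[D' [s1 s2 s3]]].
  left=> i; have := h i; rewrite cE; case: eqP => // -> _.
  by rewrite -lead_coefE.
right; exists D'; split=> //; first by rewrite (leq_trans s1) // ltnW.
by rewrite -(subrK E D) -addrA; exact: primeD.
Qed.

(** Either p is generated by constants, and v is only required to keep one of
    its coefficients, or X is algebraic modulo p, of equation P of minimal
    degree; then a root of P is a point, and a Euclidean division shows that
    some multiple of v is, modulo p, a constant outside p. *)
Lemma chevalley_step : exists u, ~ pc u /\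
  forall f : {rmorphism R -> L}, (forall a, pc a -> f a = 0) -> f u != 0 ->
  exists x : L, (forall Q, prime_set p Q -> pevals f x Q = 0) /\
    pevals f x v != 0.
Proof.
have [allc|] := pselect (forall Q, prime_set p Q -> forall i, pc Q`_i).
  have [i vi] : exists i, ~ pc v`_i.
    by apply: contrapT => /forallNP h; apply/nv/pc_poly => i; apply: contrapT.
  exists v`_i; split=> // f fp fv.
  have evE x (Q : {poly R}) : pevals f x Q = (map_poly f Q).[x].
    have -> : pevals f x = rcomp (horner_eval x) (map_poly f).
      by apply: poly_hom_ext => [a|] /=;
        rewrite ?pevalC ?pevalX ?map_polyC ?map_polyX /horner_eval ?hornerC ?hornerX.
    by [].
  have [x vx] : exists x, (map_poly f v).[x] != 0.
    pose g := map_poly f v.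
    have g0 : g != 0.
      apply: contra_neq fv => g0; rewrite -(coef_map f) -/g g0 coef0 //.
    have [/size_poly1P[c c0 gE]|/closed_rootP[x /rootP gx]] := boolP (size (g - 1) == 1%N).
      exists 0; rewrite -/g -(subrK 1 g) gE -polyC1 -polyCD hornerC.
      apply: contra_neq g0 => c1; rewrite -(subrK 1 g) gE -polyC1 -polyCD c1 //.
    exists x; rewrite -/g -(subrK 1 g) hornerD gx add0r hornerC; exact: oner_neq0.
  exists x; split=> [Q pQ|]; last by rewrite evE.
  rewrite /= /peval big1 // => j _; rewrite fp ?mul0r //; exact: allc.
move=> nallc.
have [P0 [pP0 lP0]] : exists P, prime_set p P /\ ~ pc (lead_coef P).
  apply: contrapT => h; apply: nallc => Q pQ; case: (pc_trunc Q) => // -[D [_ lD pD]].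
  exfalso; apply: h; exists D; split=> //.
  by rewrite -(subKr Q D); apply: (idealB hp).
pose isP n := `[< exists P, [/\ prime_set p P, ~ pc (lead_coef P) & size P = n] >].
have exP : exists n, isP n by exists (size P0); apply/asboolP; exists P0.
case: (ex_minnP exP) => n /asboolP[P [pP lP szP]] minP.
have small Q : prime_set p Q -> (size Q < size P)%N -> forall i, pc Q`_i.
  move=> pQ sQ; case: (pc_trunc Q) => // -[D [sD lD pD]]; exfalso.
  have : isP (size D).
    apply/asboolP; exists D; split=> //.
    by rewrite -(subKr Q D); apply: (idealB hp).
  by move=> /minP; rewrite -szP leqNgt (leq_ltn_trans sD sQ).
have pc0 : pc 0 by rewrite /pc rmorph0; exact: prime0.
have P_0 : P != 0 by apply/eqP => P_0; apply: lP; rewrite P_0 lead_coef0.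
have sP : (1 < size P)%N.
  rewrite ltnNge; apply/negP => /size1_polyC PE; apply: lP.
  by rewrite PE lead_coefC /pc -PE.
pose inD D := (exists W N, D = W * v + N /\ prime_set p N) /\ ~ prime_set p D.
pose isD n := `[< exists D, inD D /\ size D = n >].
have exD : exists n, isD n.
  exists (size v); apply/asboolP; exists v; split=> //; split=> //.
  by exists 1, 0; rewrite mul1r addr0; split=> //; exact: prime0.
case: (ex_minnP exD) => m /asboolP[D1 [[[W1 [N1 [D1E pN1]]] nD1] szD1]] minD.
have [D [W [N [DE pN nD sD lD]]]] : exists D W N,
    [/\ D = W * v + N, prime_set p N, ~ prime_set p D, size D = m & ~ pc (lead_coef D)].
  case: (pc_trunc D1) => [/pc_poly //|[D [sD lD pD]]].
  have nD : ~ prime_set p D.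
    by move=> h; apply: nD1; rewrite -(subrK D D1); exact: primeD.
  have DE : D = W1 * v + (N1 - (D1 - D)).
    by rewrite addrA -D1E subKr.
  have pN : prime_set p (N1 - (D1 - D)) by exact: (idealB hp).
  exists D, W1, (N1 - (D1 - D)); split=> //.
  apply/eqP; rewrite eqn_leq -{1}szD1 sD; apply: minD; apply/asboolP.
  by exists D; split=> //; split=> //; exists W1, (N1 - (D1 - D)).
have powpc (a : R) j : ~ pc a -> ~ prime_set p (a ^+ j)%:P.
  move=> na; elim: j => [|j IH]; first by rewrite expr0; exact: prime1.
  by rewrite exprS polyCM => /primeM[].
have minD' D' : inD D' -> (m <= size D')%N.
  by move=> h; apply: minD; apply/asboolP; exists D'.
have D_0 : D != 0 by apply/eqP => D_0; apply: lD; rewrite D_0 lead_coef0.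
have sD1 : size D = 1%N.
  apply/eqP; rewrite eqn_leq size_poly_gt0 D_0 andbT leqNgt; apply/negP => sD2.
  have [DP|PD] := ltnP (size D) (size P); last first.
    have [j [Q [r [E sr _]]]] := poly_pdiv D P_0.
    have rE : r = (lead_coef P ^+ j)%:P * D - Q * P by rewrite E addrC addKr.
    have : inD r.
      split.
        exists ((lead_coef P ^+ j)%:P * W), ((lead_coef P ^+ j)%:P * N - Q * P).
        split; first by rewrite rE DE mulrDr mulrA addrA.
        by apply: (idealB hp); exact: primeMl.
      move=> pr; have : prime_set p ((lead_coef P ^+ j)%:P * D).
        by rewrite E; apply: primeD => //; exact: primeMl.
      by move=> /primeM[/powpc|].
    by move=> /minD'; rewrite leqNgt -sD (leq_trans sr PD).
  have [j [Q [r [E sr sQ]]]] := poly_pdiv P D_0.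
  have rE : r = (lead_coef D ^+ j)%:P * P - Q * D by rewrite E addrC addKr.
  have [pr|npr] := pselect (prime_set p r); last first.
    have : inD r.
      split=> //; exists (- (Q * W)), ((lead_coef D ^+ j)%:P * P - Q * N).
      split; last by apply: (idealB hp); exact: primeMl.
      by rewrite rE DE mulrDr opprD mulNr mulrA addrCA.
    by move=> /minD'; rewrite leqNgt -sD sr.
  have : prime_set p (Q * D).
    rewrite -(addrK r (Q * D)) -E; apply: (idealB hp) => //; exact: primeMl.
  move=> /primeM[pQ|//].
  have cQ : forall i, pc Q`_i.
    by apply: small => //; rewrite (leq_ltn_trans sQ) //; lia.
  have /(congr1 (fun q : {poly R} => q`_(size P).-1)) := E.
  rewrite coefCM coefD [r`__]nth_default ?addr0; last first.
    by rewrite -ltnS prednK ?(ltnW sP) // (leq_trans sr) // ltnW.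
  move=> e; have : pc (lead_coef D ^+ j * P`_(size P).-1).
    by rewrite e coefM; apply: pc_sum => i _; exact: pcMl.
  by rewrite -lead_coefE /pc polyCM => /primeM[/powpc|].
have [u uE] : exists u, D = u%:P by exists D`_0; apply: size1_polyC; rewrite sD1.
have nu : ~ pc u by rewrite /pc -uE.
exists (lead_coef P * u); split.
  by rewrite /pc polyCM => /primeM[].
move=> f fp; rewrite rmorphM mulf_eq0 negb_or => /andP[fa fu].
have [x /rootP Px] : exists x, root (map_poly f P) x.
  by apply/closed_rootP; rewrite size_map_poly_id0 // gtn_eqF.
have evE (Q : {poly R}) : pevals f x Q = (map_poly f Q).[x].
  have -> : pevals f x = rcomp (horner_eval x) (map_poly f).
    by apply: poly_hom_ext => [a|] /=;
      rewrite ?pevalC ?pevalX ?map_polyC ?map_polyX /horner_eval ?hornerC ?hornerX.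
  by [].
have zero Q : prime_set p Q -> pevals f x Q = 0.
  move=> pQ; have [j [q [r [E sr _]]]] := poly_pdiv Q P_0.
  have pr : prime_set p r.
    have -> : r = (lead_coef P ^+ j)%:P * Q - q * P by rewrite E addrC addKr.
    by apply: (idealB hp); exact: primeMl.
  have r0 : pevals f x r = 0.
    by rewrite /= /peval big1 // => i _; rewrite fp ?mul0r //; exact: small.
  have := congr1 (pevals f x) E; rewrite rmorphM rmorphD rmorphM r0 addr0 [pevals f x P]evE Px mulr0.
  move=> /eqP; rewrite mulf_eq0 => /orP[|/eqP //].
  by rewrite /= pevalC rmorphXn expf_eq0 (negPf fa) andbF.
exists x; split=> //; apply: contra_neq fu => v0.
have := congr1 (pevals f x) DE; rewrite uE rmorphD rmorphM v0 mulr0 (zero N pN) addr0.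
by rewrite /= pevalC.
Qed.
End Step.

Lemma chevalley (R : comNzRingType) n (p : spec (mpol R n)) (v : mpol R n) :
  ~ prime_set p v -> exists u, ~ prime_set p (mconst R n u) /\
  forall f : {rmorphism R -> L}, (forall a, prime_set p (mconst R n a) -> f a = 0) ->
  f u != 0 -> exists c : nat -> L,
    (forall Q, prime_set p Q -> mev n f c Q = 0) /\ mev n f c v != 0.
Proof.
elim: n R p v => [|n IH] R p v nv.
  by exists v; split=> // f fp fv; exists (fun=> 0).
have [u1 [nu1 u1P]] := IH {poly R} p v nv.
have [u [nu uP]] := @chevalley_step R (spec_map (mconst {poly R} n) p) u1 nu1.
exists u; split=> // f fp fu; have [x [xp xu]] := uP f fp fu.
have [c [cp cv]] := u1P (pevals f x) xp xu.
by exists (fun i => if i is j.+1 then c j else x).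
Qed.

(** When the constants form the field L, the identity satisfies the
    hypotheses of chevalley, since a prime contains no non-zero constant. *)
Lemma nullstellensatz n (p : spec (mpol L n)) (v : mpol L n) :
  ~ prime_set p v -> exists c : nat -> L,
    (forall Q, prime_set p Q -> mev n (rid L) c Q = 0) /\ mev n (rid L) c v != 0.
Proof.
move=> nv; have [u [nu uP]] := chevalley nv.
apply: (uP (rid L)) => [a pa|].
  apply/eqP; apply: contrapT => /negP a0; apply: (@prime1 _ p).
  by rewrite -(rmorph1 (mconst L n)) -(mulVf a0) rmorphM; exact: primeMl.
apply/eqP => u0; apply: nu; have -> : u = 0 := u0.
by rewrite rmorph0; exact: prime0.
Qed.
End Chevalley.

(** * Matrix coefficients of a groupoid *)

Section MatrixCoefficients.
Variables (k : fieldType) (kbar : closedFieldType) (iota : {rmorphism k -> kbar}).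
Variable F : groupoid iota.

Local Notation d0 := (gr_d0 F).
Local Notation d1 := (gr_d1 F).

Definition arrow_univ : gr_arrow F d0 d1 :=
  @Arrow kbar F d0 d1 _ d0 d1 (rid F) (fun=> erefl) (fun=> erefl).

Definition comp_left : gr_arrow F (rcomp (tensor_inl d1 d0) d0)
    (rcomp (tensor_inl d1 d0) d1) :=
  arrow_map (tensor_inl d1 d0) arrow_univ.

Definition comp_right : gr_arrow F (rcomp (tensor_inl d1 d0) d1)
    (rcomp (tensor_inr d1 d0) d1) :=
  @Arrow kbar F d0 d1 _ (rcomp (tensor_inl d1 d0) d1) (rcomp (tensor_inr d1 d0) d1)
    (tensor_inr d1 d0) (fun c => esym (tensor_comm d1 d0 c)) (fun=> erefl).

Definition comult : {rmorphism F -> tensor d1 d0} := gr_comp comp_left comp_right.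

Fact composable (R : comPzRingType) (x y z : {rmorphism kbar -> R})
  (u : gr_arrow F x y) (v : gr_arrow F y z) c : u (d1 c) = v (d0 c).
Proof. by rewrite ar_source ar_target. Qed.

(** A composable pair of arrows is a point of the tensor product, and comult
    is the composite of the universal composable pair. *)
Lemma gr_compE (R : comPzRingType) (x y z : {rmorphism kbar -> R})
  (u : gr_arrow F x y) (v : gr_arrow F y z) a :
  gr_comp u v a = tensor_lift (composable u v) (comult a).
Proof.
pose f := tensor_lift (composable u v).
have := congr1 (fun t : gr_arrow F _ _ => t a) (gr_nat_comp f comp_left comp_right).
move=> /= ->; apply: gr_comp_eq => b.
  exact/esym/(tensor_liftl (composable u v)).
exact/esym/(tensor_liftr (composable u v)).
Qed.

Lemma gr_compS a : exists s : seq (F * F),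
  forall (R : comPzRingType) (x y z : {rmorphism kbar -> R})
    (u : gr_arrow F x y) (v : gr_arrow F y z),
    gr_comp u v a = \sum_(p <- s) u p.1 * v p.2.
Proof.
have [s sE] := tensor_sum (comult a); exists s => R x y z u v.
rewrite gr_compE sE rmorph_sum; apply: eq_bigr => p _.
by rewrite rmorphM tensor_liftl tensor_liftr.
Qed.

Definition counit : {rmorphism F -> kbar} := gr_id F (rid kbar).

Lemma gr_idE (R : comPzRingType) (x : {rmorphism kbar -> R}) a :
  gr_id F x a = x (counit a).
Proof.
have := congr1 (fun t : gr_arrow F _ _ => t a) (gr_nat_id F x (rid kbar)).
by move=> /= ->; apply: gr_id_eq.
Qed.

Definition antipode : {rmorphism F -> F} := gr_inv arrow_univ.

Lemma gr_inv_antipode (R : comPzRingType) (x y : {rmorphism kbar -> R})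
  (u : gr_arrow F x y) a : gr_inv u a = u (antipode a).
Proof.
have := congr1 (fun t : gr_arrow F _ _ => t a) (gr_nat_inv u arrow_univ).
by move=> /= ->; apply: gr_inv_eq.
Qed.

(** A finite-dimensional representation of F with a basis, by its matrix. *)
Definition is_rep n (M : 'I_n -> 'I_n -> F) :=
  (forall (R : comPzRingType) (x y z : {rmorphism kbar -> R})
    (u : gr_arrow F x y) (v : gr_arrow F y z) i j,
    gr_comp u v (M i j) = \sum_l u (M i l) * v (M l j)) /\
  (forall (R : comPzRingType) (x : {rmorphism kbar -> R}) i j,
    gr_id F x (M i j) = (i == j)%:R).

Definition expands (a : F) n (p q : 'I_n -> F) :=
  forall (R : comPzRingType) (x y z : {rmorphism kbar -> R})
    (u : gr_arrow F x y) (v : gr_arrow F y z),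
    gr_comp u v a = \sum_j u (p j) * v (q j).

Lemma expandsE a : exists n (p q : 'I_n -> F), expands a p q.
Proof.
have [s sE] := gr_compS a; exists (size s).
exists (fun j => (nth (0, 0) s j).1), (fun j => (nth (0, 0) s j).2).
by move=> R x y z u v; rewrite sE (big_nth (0, 0)) big_mkord.
Qed.

Section DualBasis.
Variables (d : {rmorphism kbar -> F}).

(** The functional is zero on the span of the other coefficients. *)
Lemma dual_functional n (q : 'I_n.+1 -> F) (j0 : 'I_n.+1) :
  ~ (exists c : 'I_n -> kbar, q j0 = \sum_i d (c i) * q (lift j0 i)) ->
  exists l : F -> kbar, [/\ forall a b, l (a + b) = l a + l b,
    forall c a, l (d c * a) = c * l a & forall j, l (q j) = (j == j0)%:R].
Proof.
pose W : set F := [set w | exists c : 'I_n -> kbar,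
  w = \sum_i d (c i) * q (lift j0 i)].
move=> nW.
have sW : is_subspace (fun c a => d c * a) W.
  split.
  - by exists (fun=> 0); rewrite big1 // => i _; rewrite rmorph0 mul0r.
  - move=> _ _ [c ->] [c' ->]; exists (fun i => c i + c' i).
    by rewrite -big_split; apply: eq_bigr => i _; rewrite rmorphD mulrDl.
  - move=> e _ [c ->]; exists (fun i => e * c i).
    by rewrite mulr_sumr; apply: eq_bigr => i _; rewrite rmorphM mulrA.
have [|c c' v|c c' v|v|l [lD lZ lW l1]] := linear_functional _ _ _ _ sW nW.
- by move=> c a b; rewrite mulrDr.
- by rewrite rmorphD mulrDl.
- by rewrite rmorphM mulrA.
- by rewrite rmorph1 mul1r.
exists l; split=> // j; case: (unliftP j0 j) => [i|] ->; last by rewrite eqxx.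
rewrite eq_sym (negPf (neq_lift _ _)); apply: lW.
exists (fun i' => (i' == i)%:R); rewrite (bigD1 i) //= eqxx rmorph1 mul1r.
by rewrite big1 ?addr0 // => i' /negPf->; rewrite rmorph0 mul0r.
Qed.
End DualBasis.

(** A linear relation between the coefficients on either side would give a
    shorter expansion; in an expansion of minimal length both families are
    linearly independent and have dual functionals. *)
Lemma minimal_expansion a : exists n (p q : 'I_n -> F), [/\ expands a p q,
  forall j0, exists l : F -> kbar, [/\ forall a b, l (a + b) = l a + l b,
    forall c a, l (d1 c * a) = c * l a & forall j, l (p j) = (j == j0)%:R] &
  forall j0, exists l : F -> kbar, [/\ forall a b, l (a + b) = l a + l b,
    forall c a, l (d0 c * a) = c * l a & forall j, l (q j) = (j == j0)%:R]].
Proof.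
pose P n := `[< exists p q : 'I_n -> F, expands a p q >].
have exP : exists n, P n by have [n h] := expandsE a; exists n; exact/asboolP.
case: (ex_minnP exP) => n /asboolP[p [q pq]] minP; exists n, p, q.
case: n p q pq minP => [|n] p q pq minP; first by split=> // -[].
split=> // j0; apply: dual_functional => -[c cE].
  have /minP : P n; last by rewrite ltnn.
  apply/asboolP; exists (fun i => p (lift j0 i)).
  exists (fun i => q (lift j0 i) + d0 (c i) * q j0) => R x y z u v.
  rewrite pq (bigD1_ord j0) //= cE rmorph_sum mulr_suml -big_split.
  apply: eq_bigr => i _ /=; rewrite !rmorphM rmorphD rmorphM mulrDr addrC.
  by rewrite ar_source ar_target mulrCA mulrA.
have /minP : P n; last by rewrite ltnn.
apply/asboolP; exists (fun i => p (lift j0 i) + d1 (c i) * p j0).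
exists (fun i => q (lift j0 i)) => R x y z u v.
rewrite pq (bigD1_ord j0) //= cE rmorph_sum mulr_sumr -big_split.
apply: eq_bigr => i _ /=; rewrite !rmorphM rmorphD rmorphM mulrDl addrC.
by rewrite ar_source ar_target mulrCA mulrA.
Qed.

Section TensorArrows.
Variables (R : comPzRingType) (x : {rmorphism kbar -> R}).

Definition arrow_from : gr_arrow F (rcomp (tensor_inr d0 x) x)
    (rcomp (tensor_inl d0 x) d1) :=
  @Arrow kbar F d0 d1 _ (rcomp (tensor_inr d0 x) x) (rcomp (tensor_inl d0 x) d1)
    (tensor_inl d0 x) (tensor_comm d0 x) (fun=> erefl).

Definition arrow_to : gr_arrow F (rcomp (tensor_inl d1 x) d0)
    (rcomp (tensor_inr d1 x) x) :=
  @Arrow kbar F d0 d1 _ (rcomp (tensor_inl d1 x) d0) (rcomp (tensor_inr d1 x) x)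
    (tensor_inl d1 x) (fun=> erefl) (tensor_comm d1 x).
End TensorArrows.

Fact klinear_functional (R : comPzRingType) (x : {rmorphism kbar -> R})
  (A : comPzRingType) (e : {rmorphism kbar -> A}) (l : A -> kbar) :
  (forall a b, l (a + b) = l a + l b) -> (forall c a, l (e c * a) = c * l a) ->
  klinear e x (x \o l).
Proof.
by move=> lD lZ; split=> [a b|c a] /=; rewrite ?lD ?lZ ?rmorphD ?rmorphM.
Qed.

Fact additive_sum (V W : zmodType) (L : V -> W) (J : Type) (r : seq J) (G : J -> V) :
  (forall s t, L (s + t) = L s + L t) ->
  L (\sum_(j <- r) G j) = \sum_(j <- r) L (G j).
Proof.
move=> LD; have L0 : L 0 = 0 by apply: (addrI (L 0)); rewrite -LD !addr0.
by elim: r => [|j r IH]; rewrite ?big_nil // !big_cons LD IH.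
Qed.

(** In a minimal expansion of a, functionals dual to the q j turn the
    associativity of the composition into an expansion of p j along the p i,
    with coefficients M i j; functionals dual to the p i show then that M is
    a representation. Evaluation at identities recovers a from M. *)
Lemma rep_spanning (a : F) : exists n (M : 'I_n -> 'I_n -> F),
  is_rep M /\ exists b c : 'I_n -> kbar,
    a = \sum_j (\sum_i d0 (b i) * M i j) * d1 (c j).
Proof.
have [n [p [q [pq lp lq]]]] := minimal_expansion a; exists n.
have /choice[mu muP] := lp; have /choice[la laP] := lq.
have /choice[s sE] i := gr_compS (q i).
pose M i j : F := \sum_(t <- s i) t.1 * d1 (la j t.2).
have pE (R : comPzRingType) (x y z : {rmorphism kbar -> R})
    (u : gr_arrow F x y) (v : gr_arrow F y z) j :
    gr_comp u v (p j) = \sum_i u (p i) * v (M i j).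
  have [laD laZ laq] := laP j.
  have [L LD LE] := tensor_functional (klinear_functional z laD laZ).
  pose f := tensor_inr d0 z; pose w := arrow_from z.
  have := congr1 (fun t : gr_arrow F _ _ => t a)
    (gr_compA (arrow_map f u) (arrow_map f v) w).
  rewrite /= -gr_nat_comp !pq => /(congr1 L); rewrite !additive_sum // => e.
  transitivity (\sum_i L (arrow_map f (gr_comp u v) (p i) * w (q i))).
    rewrite (bigD1 j) //= big1 ?addr0 => [|i ij]; rewrite mulrC LE /= laq.
      by rewrite eqxx rmorph1 mul1r.
    by rewrite (negPf ij) rmorph0 mul0r.
  rewrite -e; apply: eq_bigr => i _; rewrite sE mulr_sumr additive_sum //.
  rewrite rmorph_sum mulr_sumr; apply: eq_bigr => t _.
  transitivity (L (w t.2 * f (u (p i) * v t.1))).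
    by rewrite rmorphM mulrA mulrC.
  by rewrite LE /= rmorphM ar_source mulrC mulrA.
have left_cancel (R : comPzRingType) (x : {rmorphism kbar -> R}) (l : 'I_n)
    (g h : 'I_n -> R) :
    \sum_i arrow_to x (p i) * tensor_inr d1 x (g i) =
      \sum_i arrow_to x (p i) * tensor_inr d1 x (h i) -> g l = h l.
  have [muD muZ mup] := muP l.
  have [L LD LE] := tensor_functional (klinear_functional x muD muZ).
  have LS (r : 'I_n -> R) :
      L (\sum_i arrow_to x (p i) * tensor_inr d1 x (r i)) = r l.
    rewrite additive_sum // (bigD1 l) //= big1 ?addr0 => [|i il]; rewrite LE /= mup.
      by rewrite eqxx rmorph1 mul1r.
    by rewrite (negPf il) rmorph0 mul0r.
  by move=> /(congr1 L); rewrite !LS.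
exists M; split; first split.
- move=> R x y z u v l j; pose f := tensor_inr d1 x; pose t := arrow_to x.
  apply: (@left_cancel _ x l (fun l => gr_comp u v (M l j))
    (fun l => \sum_i u (M l i) * v (M i j))).
  have := congr1 (fun t : gr_arrow F _ _ => t (p j))
    (gr_compA t (arrow_map f u) (arrow_map f v)).
  rewrite /= -gr_nat_comp !pE => ->.
  transitivity (\sum_i \sum_i' t (p i') * arrow_map f u (M i' i) *
      arrow_map f v (M i j)).
    by apply: eq_bigr => i _; rewrite -mulr_suml -pE.
  rewrite exchange_big; apply: eq_bigr => i _ /=.
  rewrite rmorph_sum mulr_sumr; apply: eq_bigr => i' _.
  by rewrite rmorphM mulrA.
- move=> R x l j; apply: (@left_cancel _ x l (fun l => gr_id F x (M l j))
    (fun l => (l == j)%:R)).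
  have := congr1 (fun t : gr_arrow F _ _ => t (p j)) (gr_compr1 (arrow_to x)).
  rewrite -gr_nat_id pE /= => ->.
  rewrite [RHS](bigD1 j) //= eqxx rmorph1 mulr1 big1 ?addr0 //.
  by move=> i /negPf->; rewrite rmorph0 mulr0.
exists (fun i => counit (p i)), (fun j => counit (q j)).
have := congr1 (fun t : gr_arrow F _ _ => t a) (gr_compr1 arrow_univ).
move=> /esym e; rewrite -[LHS]/(arrow_univ a) e pq.
apply: eq_bigr => j _; rewrite gr_idE; congr (_ * _).
have := congr1 (fun t : gr_arrow F _ _ => t (p j)) (gr_compl1 arrow_univ).
move=> /esym e'; rewrite [LHS]e' pE.
by apply: eq_bigr => i _; rewrite gr_idE.
Qed.
End MatrixCoefficients.

(** * Heaps of arrows and the points of their images in linear groups *)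

Section MatrixPolynomials.
Variable n : nat.

(** The boolean tells the entries of the second matrix from those of the
    first. *)
Definition mvar : finType := (bool * ('I_n * 'I_n))%type.

Definition mcoord (R : comPzRingType) (G G' : 'M[R]_n) (i : nat) : R :=
  if insub i is Some j then
    let v : mvar := enum_val (j : 'I_#|mvar|) in
    if v.1 then G' v.2.1 v.2.2 else G v.2.1 v.2.2
  else 0.

(** Polynomials in the entries of a matrix X and of a matrix X', to be
    evaluated at inverse matrices. *)
Definition mxpolys (R : comNzRingType) := mpol R #|mvar|.

Section Eval.
Variables (R : comNzRingType) (S : comPzRingType).

Definition mxgen (b : bool) (i j : 'I_n) : mxpolys R :=
  mgen R #|mvar| (enum_rank ((b, (i, j)) : mvar)).

Definition mxeval (f : {rmorphism R -> S}) (G G' : 'M[S]_n) :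
    {rmorphism mxpolys R -> S} := mev #|mvar| f (mcoord G G').

Lemma mxevalC f G G' a : mxeval f G G' (mconst R _ a) = f a.
Proof. exact: mevC. Qed.

Lemma mxevalX f G G' b i j :
  mxeval f G G' (mxgen b i j) = if b then G' i j else G i j.
Proof.
rewrite /mxeval /mxgen mevX // /mcoord.
by rewrite valK /= enum_rankK.
Qed.

Lemma mxpoly_ext (g h : {rmorphism mxpolys R -> S}) :
  (forall a, g (mconst R _ a) = h (mconst R _ a)) ->
  (forall b i j, g (mxgen b i j) = h (mxgen b i j)) -> g = h.
Proof.
move=> ghC ghX; apply: mpol_hom_ext => // i ni.
have := ghX (enum_val (Ordinal ni)).1 (enum_val (Ordinal ni)).2.1
  (enum_val (Ordinal ni)).2.2.
by rewrite /mxgen -!surjective_pairing enum_valK.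
Qed.
End Eval.

Lemma mxeval_map (R : comNzRingType) (S S' : comPzRingType)
  (f : {rmorphism R -> S}) (h : {rmorphism S -> S'}) (G G' : 'M[S]_n) P :
  h (mxeval f G G' P) = mxeval (rcomp h f) (map_mx h G) (map_mx h G') P.
Proof.
suff e : rcomp h (mxeval f G G') = mxeval (rcomp h f) (map_mx h G) (map_mx h G').
  exact: (congr1 (fun g : {rmorphism mxpolys R -> S'} => g P) e).
apply: mxpoly_ext => [a|b i j].
  by rewrite -[LHS]/(h (mxeval f G G' (mconst R _ a))) !mxevalC.
rewrite -[LHS]/(h (mxeval f G G' (mxgen R b i j))) !mxevalX.
by case: b; rewrite mxE.
Qed.

Definition mxX (R : comNzRingType) (b : bool) : 'M[mxpolys R]_n :=
  \matrix_(i, j) mxgen R b i j.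

Lemma mxeval_mxX (R : comNzRingType) (S : comPzRingType)
  (f : {rmorphism R -> S}) (G G' : 'M[S]_n) b :
  map_mx (mxeval f G G') (mxX R b) = if b then G' else G.
Proof. by apply/matrixP => i j; rewrite !mxE mxevalX; case: b. Qed.

Lemma mxeval_eta (R : comNzRingType) (S : comPzRingType)
  (g : {rmorphism mxpolys R -> S}) :
  g = mxeval (rcomp g (mconst R _)) (map_mx g (mxX R false)) (map_mx g (mxX R true)).
Proof.
apply: mxpoly_ext => [a|b i j]; first by rewrite mxevalC.
by rewrite mxevalX; case: b; rewrite !mxE.
Qed.

Definition cmx (R : comNzRingType) (G : 'M[R]_n) : 'M[mxpolys R]_n :=
  map_mx (mconst R #|mvar|) G.

Lemma mxeval_cmx (R : comNzRingType) (S : comPzRingType)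
  (f : {rmorphism R -> S}) (G G' : 'M[S]_n) (H : 'M[R]_n) :
  map_mx (mxeval f G G') (cmx H) = map_mx f H.
Proof. by apply/matrixP => i j; rewrite !mxE mxevalC. Qed.

(** Substitutions in polynomials, dual to the maps v |-> G v^-1 W and
    v |-> v H on invertible matrices. *)
Definition mxtwist (R : comNzRingType) (G G' W W' : 'M[R]_n) :
    {rmorphism mxpolys R -> mxpolys R} :=
  mxeval (mconst R _) (cmx G *m mxX R true *m cmx W)
    (cmx W' *m mxX R false *m cmx G').

Lemma mxeval_twist (R : comNzRingType) (S : comPzRingType)
  (f : {rmorphism R -> S}) (V V' : 'M[S]_n) (G G' W W' : 'M[R]_n) P :
  mxeval f V V' (mxtwist G G' W W' P) =
    mxeval f (map_mx f G *m V' *m map_mx f W) (map_mx f W' *m V *m map_mx f G') P.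
Proof.
rewrite mxeval_map !map_mxM !mxeval_cmx !mxeval_mxX.
congr (mxeval _ _ _ P); apply: rmorph_ext => a; exact: mxevalC.
Qed.

Definition mxtrans (R : comNzRingType) (H H' : 'M[R]_n) :
    {rmorphism mxpolys R -> mxpolys R} :=
  mxeval (mconst R _) (mxX R false *m cmx H) (cmx H' *m mxX R true).

Lemma mxeval_trans (R : comNzRingType) (S : comPzRingType)
  (f : {rmorphism R -> S}) (V V' : 'M[S]_n) (H H' : 'M[R]_n) P :
  mxeval f V V' (mxtrans H H' P) =
    mxeval f (V *m map_mx f H) (map_mx f H' *m V') P.
Proof.
rewrite mxeval_map !map_mxM !mxeval_cmx !mxeval_mxX.
congr (mxeval _ _ _ P); apply: rmorph_ext => a; exact: mxevalC.
Qed.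
End MatrixPolynomials.

Section Heap.
Variables (k : fieldType) (kbar : closedFieldType) (iota : {rmorphism k -> kbar}).
Variable F : groupoid iota.

Local Notation gal := (gal iota).
Local Notation d0 := (gr_d0 F).
Local Notation d1 := (gr_d1 F).

Definition kills (R : comPzRingType) (I : set F) (f : F -> R) :=
  forall a, I a -> f a = 0.

(** The ideal of the fibre, over the point s of the Galois group, of the closed
    subscheme defined by I. *)
Definition fibre (I : set F) (s : gal) : set F :=
  ideal_gen [set a | I a \/ exists c, a = d1 c - d0 (s c)].

(** The closed subscheme of F defined by I is stable by (u, v, w) |-> u v^-1 w;
    it is thus a torsor under a subgroup of the diagonal. *)
Definition heap (I : set F) :=
  forall (R : comPzRingType) (x y z : {rmorphism kbar -> R})
    (u v : gr_arrow F x y) (w : gr_arrow F x z),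
    kills I u -> kills I v -> kills I w -> kills I (gr_comp u (gr_comp (gr_inv v) w)).

Lemma fibre_ideal I s : is_ideal (fibre I s).
Proof. exact: ideal_gen_ideal. Qed.

Lemma fibre_sub I s : I `<=` fibre I s.
Proof. by move=> a Ia; apply: ig_base; left. Qed.

Lemma fibre_agree (R : comPzRingType) I s (f : {rmorphism F -> R}) :
  kills (fibre I s) f <-> kills I f /\ agree_at d0 d1 s f.
Proof.
split=> [h|[kI fs]].
  split=> [a Ia|c]; first by apply/h/fibre_sub.
  by apply/subr0_eq; rewrite -rmorphB; apply: h; apply: ig_base; right; exists c.
move=> a; elim=> [b [/kI //|[c ->]]||b c _ eb _ ec|b c _ ec].
- by rewrite rmorphB fs subrr.
- exact: rmorph0.
- by rewrite rmorphD eb ec addr0.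
- by rewrite rmorphM ec mulr0.
Qed.

Definition fibre_ring I s := quotient (fibre_ideal I s).
Definition fibre_map I s : {rmorphism F -> fibre_ring I s} :=
  quot_map (fibre_ideal I s).

Lemma fibre_map_kills I s : kills (fibre I s) (fibre_map I s).
Proof. by move=> a fa; apply/(quot_map0 (fibre_ideal I s)). Qed.

(** An element of the ideal involves finitely many relations d1 c = d0 (s c),
    that hold for every t near s. *)
Lemma fibre_near I s a : fibre I s a -> nbhs s [set t | fibre I t a].
Proof.
elim=> [b [Ib|[c ->]]||b c _ nb _ nc|b c _ nc].
- by apply: filterS filterT => t _; exact: fibre_sub.
- apply/nbhs_gal; exists [:: c] => t [tc] /=; rewrite -tc.
  by apply: ig_base; right; exists c.
- by apply: filterS filterT => t _; exact: ig_0.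
- by apply: filterS2 nb nc => t; exact: ig_add.
- by apply: filterS nc => t; exact: ig_mul.
Qed.

Section Representation.
Variables (n : nat) (M : 'I_n -> 'I_n -> F) (repM : is_rep M).

Definition rep_mx (R : comPzRingType) (f : F -> R) : 'M[R]_n :=
  \matrix_(i, j) f (M i j).
Definition rep_inv (R : comPzRingType) (f : F -> R) : 'M[R]_n :=
  \matrix_(i, j) f (antipode F (M i j)).

Lemma rep_mx_comp (R : comPzRingType) (x y z : {rmorphism kbar -> R})
  (u : gr_arrow F x y) (v : gr_arrow F y z) :
  rep_mx (gr_comp u v) = rep_mx u *m rep_mx v.
Proof.
apply/matrixP => i j; rewrite !mxE repM.1; apply: eq_bigr => l _.
by rewrite !mxE.
Qed.

Lemma rep_mx_id (R : comPzRingType) (x : {rmorphism kbar -> R}) :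
  rep_mx (gr_id F x) = 1%:M.
Proof. by apply/matrixP => i j; rewrite !mxE repM.2. Qed.

Lemma rep_mx_inv (R : comPzRingType) (x y : {rmorphism kbar -> R})
  (u : gr_arrow F x y) : rep_mx (gr_inv u) = rep_inv u.
Proof. by apply/matrixP => i j; rewrite !mxE gr_inv_antipode. Qed.

Lemma gr_invK (R : comPzRingType) (x y : {rmorphism kbar -> R})
  (u : gr_arrow F x y) : gr_inv (gr_inv u) = u.
Proof. by symmetry; apply: gr_invE; rewrite gr_compV. Qed.

Lemma rep_inv_inv (R : comPzRingType) (x y : {rmorphism kbar -> R})
  (u : gr_arrow F x y) : rep_inv (gr_inv u) = rep_mx u.
Proof. by rewrite -rep_mx_inv gr_invK. Qed.

Lemma rep_inv_comp (R : comPzRingType) (x y z : {rmorphism kbar -> R})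
  (u : gr_arrow F x y) (v : gr_arrow F y z) :
  rep_inv (gr_comp u v) = rep_inv v *m rep_inv u.
Proof.
have e : gr_comp (gr_inv v) (gr_inv u) = gr_inv (gr_comp u v).
  apply: gr_invE; rewrite gr_compA -(gr_compA u v) gr_comprV gr_compr1.
  exact: gr_comprV.
by rewrite -!rep_mx_inv -rep_mx_comp e.
Qed.

Lemma rep_map (R R' : comPzRingType) (f : {rmorphism F -> R})
  (h : {rmorphism R -> R'}) : map_mx h (rep_mx f) = rep_mx (rcomp h f).
Proof. by apply/matrixP => i j; rewrite !mxE. Qed.

Lemma rep_inv_map (R R' : comPzRingType) (f : {rmorphism F -> R})
  (h : {rmorphism R -> R'}) : map_mx h (rep_inv f) = rep_inv (rcomp h f).
Proof. by apply/matrixP => i j; rewrite !mxE. Qed.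

Lemma rep_mulV : rep_mx (rid F) *m rep_inv (rid F) = 1%:M.
Proof.
rewrite -(rep_mx_inv (arrow_univ F)) -[rep_mx (rid F)]/(rep_mx (arrow_univ F)).
by rewrite -rep_mx_comp gr_comprV rep_mx_id.
Qed.

Definition rep_eval : {rmorphism mxpolys n kbar -> F} :=
  mxeval d0 (rep_mx (rid F)) (rep_inv (rid F)).

Lemma rep_eval_map (R : comPzRingType) (f : {rmorphism F -> R}) P :
  f (rep_eval P) = mxeval (rcomp f d0) (rep_mx f) (rep_inv f) P.
Proof.
rewrite /rep_eval mxeval_map rep_map rep_inv_map.
have -> : rcomp f (rid F) = f by apply: rmorph_ext.
by [].
Qed.

Variables (I : set F) (heapI : heap I).

(** The equations and the points, over a point s of the Galois group, of the
    closed image in the linear group of the subscheme defined by I. *)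
Definition img_eqn (s : gal) : set (mxpolys n kbar) :=
  [set P | fibre I s (rep_eval P)].

Definition img_pt (s : gal) (G G' : 'M[kbar]_n) :=
  forall P, img_eqn s P -> mxeval (rid kbar) G G' P = 0.

Lemma img_eqn_ideal s : is_ideal (img_eqn s).
Proof. exact: ker_ideal (fibre_ideal I s). Qed.

Lemma img_pt_mulV s G G' : img_pt s G G' -> G *m G' = 1%:M.
Proof.
move=> sG; apply/matrixP => i j.
pose P := (mxX n kbar false *m mxX n kbar true) i j - (i == j)%:R.
have evP (S : comPzRingType) f (H H' : 'M[S]_n) :
    mxeval f H H' P = (H *m H') i j - (i == j)%:R.
  rewrite rmorphB /= rmorph_nat; congr (_ - _).
  have <- : map_mx (mxeval f H H') (mxX n kbar false *m mxX n kbar true) = H *m H'.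
    by rewrite map_mxM !mxeval_mxX.
  by rewrite !mxE.
have /sG : img_eqn s P.
  by rewrite /img_eqn /mkset /rep_eval evP rep_mulV !mxE subrr; exact: ig_0.
by rewrite evP => /subr0_eq->; rewrite mxE.
Qed.

Lemma img_pt_Vmul s G G' : img_pt s G G' -> G' *m G = 1%:M.
Proof. by move=> /img_pt_mulV/mulmx1C. Qed.

(** A prime of the fibre contains the equations of its image, to which the
    theorem of zeros applies. *)
Lemma img_pt_exists s : ~ fibre I s 1 -> exists G G', img_pt s G G'.
Proof.
move=> /(proper_prime (fibre_ideal I s))[q Iq].
have [c [cP _]] := @nullstellensatz _ _ (spec_map rep_eval q) 1 (@prime1 _ _).
pose g := mev #|mvar n| (rid kbar) c.
exists (map_mx g (mxX n kbar false)), (map_mx g (mxX n kbar true)) => P sP.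
have -> : mxeval (rid kbar) (map_mx g (mxX n kbar false))
    (map_mx g (mxX n kbar true)) = g.
  rewrite [RHS]mxeval_eta; congr mxeval; apply: rmorph_ext => a.
  by rewrite [RHS]mevC.
by apply: cP; exact: Iq.
Qed.

(** An identity between polynomials in the entries of the generic point of a
    fibre remains true at the points of its closed image, also after extension
    of scalars: such a point extends to a linear functional on the functions
    on the fibre. *)
Section Specialise.
Variables (s : gal) (G G' : 'M[kbar]_n) (sG : img_pt s G G').
Variables (B : comPzRingType) (b : {rmorphism kbar -> B}).

Let str : {rmorphism kbar -> fibre_ring I s} := rcomp (fibre_map I s) d0.
Let gen : {rmorphism mxpolys n kbar -> fibre_ring I s} :=
  rcomp (fibre_map I s) rep_eval.
Let pb := tensor (mconst kbar #|mvar n|) b.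

Fact spec_generic_comm c : rcomp (tensor_inl str b) gen (mconst kbar _ c) =
  tensor_inr str b (b c).
Proof. by rewrite -tensor_comm /gen /= /rep_eval mxevalC. Qed.

Definition spec_generic : {rmorphism pb -> tensor str b} :=
  tensor_lift spec_generic_comm.

Fact spec_point_comm c :
  rcomp b (mxeval (rid kbar) G G') (mconst kbar _ c) = rid B (b c).
Proof. by rewrite /= mxevalC. Qed.

Definition spec_point : {rmorphism pb -> B} := tensor_lift spec_point_comm.

Lemma specialise (t : pb) : spec_generic t = 0 -> spec_point t = 0.
Proof.
pose ev := mxeval (rid kbar) G G'.
pose W : set (fibre_ring I s) := [set w | exists P, w = gen P /\ ev P = 0].
have sW : is_subspace (fun c a => str c * a) W.
  split.
  - by exists 0; rewrite !rmorph0.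
  - move=> _ _ [P [-> P0]] [Q [-> Q0]]; exists (P + Q).
    by rewrite !rmorphD P0 Q0 addr0.
  - move=> c _ [P [-> P0]]; exists (mconst kbar _ c * P).
    by rewrite !rmorphM P0 mulr0 /gen /= /rep_eval mxevalC.
have nW : ~ W 1.
  case=> P [P1 P0]; have e : ev (1 - P) = 1 by rewrite rmorphB rmorph1 P0 subr0.
  have : ev (1 - P) = 0.
    apply: sG; apply/(quot_map0 (fibre_ideal I s)).
    by rewrite -[LHS]/(gen (1 - P)) rmorphB rmorph1 -P1 subrr.
  by rewrite e => /eqP; rewrite oner_eq0.
have [|c c' v|c c' v|v|l [lD lZ lW l1]] := linear_functional _ _ _ _ sW nW.
- by move=> c v w; rewrite mulrDr.
- by rewrite rmorphD mulrDl.
- by rewrite rmorphM mulrA.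
- by rewrite rmorph1 mul1r.
have lgen P : l (gen P) = ev P.
  have : l (gen (P - mconst kbar _ (ev P))) = 0.
    apply: lW; exists (P - mconst kbar _ (ev P)); split=> //.
    by rewrite rmorphB [X in _ - X]mxevalC subrr.
  rewrite rmorphB => h; rewrite -(subrK (gen (mconst kbar _ (ev P))) (gen P)).
  rewrite lD h add0r /gen /= /rep_eval mxevalC -[X in l X]mulr1.
  by rewrite [LHS]lZ l1 mulr1.
have [L LD LE] := tensor_functional (klinear_functional b lD lZ).
suff -> : spec_point t = L (spec_generic t).
  by move=> ->; apply: (addrI (L 0)); rewrite -LD !addr0.
have [r ->] := tensor_sum t; rewrite !rmorph_sum additive_sum //.
apply: eq_bigr => p _; rewrite !rmorphM !tensor_liftl !tensor_liftr LE /=.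
by rewrite lgen.
Qed.

Lemma specialise_mx (H H' : 'M[pb]_n) P :
  mxeval (rcomp (tensor_inr str b) b) (map_mx spec_generic H)
    (map_mx spec_generic H') P = 0 ->
  mxeval b (map_mx spec_point H) (map_mx spec_point H') P = 0.
Proof.
pose c : {rmorphism kbar -> pb} := rcomp (tensor_inr (mconst kbar #|mvar n|) b) b.
have -> : mxeval (rcomp (tensor_inr str b) b) (map_mx spec_generic H)
    (map_mx spec_generic H') P = spec_generic (mxeval c H H' P).
  rewrite mxeval_map; congr (mxeval _ _ _ P); apply: rmorph_ext => a.
  exact/esym/(tensor_liftr spec_generic_comm).
have -> : mxeval b (map_mx spec_point H) (map_mx spec_point H') P =
    spec_point (mxeval c H H' P).
  rewrite mxeval_map; congr (mxeval _ _ _ P); apply: rmorph_ext => a.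
  exact/esym/(tensor_liftr spec_point_comm).
exact: specialise.
Qed.

Definition spec_X (b0 : bool) : 'M[pb]_n :=
  map_mx (tensor_inl (mconst kbar #|mvar n|) b) (mxX n kbar b0).
Definition spec_B (N : 'M[B]_n) : 'M[pb]_n :=
  map_mx (tensor_inr (mconst kbar #|mvar n|) b) N.

Lemma spec_point_X b0 :
  map_mx spec_point (spec_X b0) = map_mx b (if b0 then G' else G).
Proof.
apply/matrixP => i j; rewrite !mxE tensor_liftl /= mxevalX.
by case: b0.
Qed.

Lemma spec_point_B N : map_mx spec_point (spec_B N) = N.
Proof. by apply/matrixP => i j; rewrite !mxE tensor_liftr. Qed.

Lemma spec_generic_X b0 : map_mx spec_generic (spec_X b0) =
  map_mx (rcomp (tensor_inl str b) (fibre_map I s))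
    (if b0 then rep_inv (rid F) else rep_mx (rid F)).
Proof.
apply/matrixP => i j; rewrite !mxE tensor_liftl /= /rep_eval mxevalX.
by case: b0; rewrite !mxE.
Qed.

Lemma spec_generic_B N : map_mx spec_generic (spec_B N) = map_mx (tensor_inr str b) N.
Proof. by apply/matrixP => i j; rewrite !mxE tensor_liftr. Qed.
End Specialise.
End Representation.
End Heap.

(** * Fibres of closed heaps *)

Section HeapPoints.
Variables (k : fieldType) (kbar : closedFieldType) (iota : {rmorphism k -> kbar}).
Variable F : groupoid iota.
Variables (I : set F) (heapI : heap I).

Local Notation gal := (gal iota).
Local Notation d0 := (gr_d0 F).
Local Notation d1 := (gr_d1 F).
Local Notation fibre := (fibre I).

Lemma kills_comp (R S : comPzRingType) (J : set F) (f : {rmorphism F -> R})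
  (h : {rmorphism R -> S}) : kills J f -> kills J (rcomp h f).
Proof. by move=> fJ a Ja; rewrite /= fJ ?rmorph0. Qed.

Section OneRep.
Variables (n : nat) (M : 'I_n -> 'I_n -> F) (repM : is_rep M).

Local Notation img_eqn := (img_eqn M I).
Local Notation img_pt := (img_pt M I).

(** A representation turns the heap operation u v^-1 w on arrows into the one
    on matrices. *)
Lemma heap_pt (s t : gal) (R : comPzRingType) (x : {rmorphism kbar -> R})
    (f g h : {rmorphism F -> R}) P :
  kills (fibre s) f -> kills (fibre s) g -> kills (fibre t) h ->
  rcomp f d0 = x -> rcomp g d0 = x -> rcomp h d0 = x -> img_eqn t P ->
  mxeval x (rep_mx M f *m rep_inv M g *m rep_mx M h)
    (rep_inv M h *m rep_mx M g *m rep_inv M f) P = 0.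
Proof.
move=> /fibre_agree[fI fs] /fibre_agree[gI gs] /fibre_agree[hI ht] fx gx hx tP.
have arr (e : {rmorphism F -> R}) (r : gal) : agree_at d0 d1 r e ->
    rcomp e d0 = x -> {w : gr_arrow F x (rcomp x r) | w =1 e}.
  move=> er ex; unshelve eexists (@Arrow kbar F d0 d1 R x (rcomp x r) e _ _) => //.
    by move=> c; rewrite -ex.
  by move=> c; rewrite /= er -ex.
have [u uf] := arr f s fs fx; have [v vg] := arr g s gs gx.
have [w wh] := arr h t ht hx.
have mxE' (e e' : F -> R) : e =1 e' ->
    rep_mx M e = rep_mx M e' /\ rep_inv M e = rep_inv M e'.
  by move=> ee; split; apply/matrixP => i j; rewrite !mxE ee.
pose e := gr_comp u (gr_comp (gr_inv v) w).
have eI : kills (fibre t) e.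
  apply/fibre_agree; split=> [|c]; last by rewrite ar_source ar_target.
  by apply: heapI => a Ia; rewrite ?uf ?vg ?wh; [exact: fI|exact: gI|exact: hI].
have := eI _ tP; rewrite rep_eval_map.
have -> : rcomp e d0 = x by apply: rmorph_ext => c; exact: ar_target.
rewrite !rep_mx_comp // !rep_inv_comp // rep_mx_inv // rep_inv_inv //.
have [-> ->] := mxE' _ _ uf; have [-> ->] := mxE' _ _ vg.
by have [-> ->] := mxE' _ _ wh; rewrite !mulmxA.
Qed.

(** Generic points are replaced with points of the closed images one factor
    at a time, here the first one, by specialise. *)
Lemma heap_pt1 (s t : gal) (R : comPzRingType) (x : {rmorphism kbar -> R})
    (g h : {rmorphism F -> R}) G G' P :
  img_pt s G G' -> kills (fibre s) g -> kills (fibre t) h ->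
  rcomp g d0 = x -> rcomp h d0 = x -> img_eqn t P ->
  mxeval x (map_mx x G *m rep_inv M g *m rep_mx M h)
    (rep_inv M h *m rep_mx M g *m map_mx x G') P = 0.
Proof.
move=> sG gs ht gx hx tP.
pose H := spec_X n x false *m spec_B x (rep_inv M g) *m spec_B x (rep_mx M h).
pose H' := spec_B x (rep_inv M h) *m spec_B x (rep_mx M g) *m spec_X n x true.
have := @specialise_mx _ _ _ _ _ _ I s _ _ sG _ x H H' P.
rewrite !map_mxM !spec_point_X !spec_point_B; apply.
rewrite !spec_generic_X !spec_generic_B /= !rep_inv_map !rep_map.
apply: heap_pt tP => //.
- exact: (kills_comp _ (@fibre_map_kills _ _ _ F I s)).
- exact: kills_comp.
- exact: kills_comp.
- by apply: rmorph_ext => c; exact: tensor_comm.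
- by rewrite -gx; apply: rmorph_ext.
- by rewrite -hx; apply: rmorph_ext.
Qed.

Lemma heap_pt2 (s t : gal) (R : comPzRingType) (x : {rmorphism kbar -> R})
    (g : {rmorphism F -> R}) G G' W W' P :
  img_pt s G G' -> kills (fibre s) g -> img_pt t W W' ->
  rcomp g d0 = x -> img_eqn t P ->
  mxeval x (map_mx x G *m rep_inv M g *m map_mx x W)
    (map_mx x W' *m rep_mx M g *m map_mx x G') P = 0.
Proof.
move=> sG gs tW gx tP.
pose H := spec_B x (map_mx x G) *m spec_B x (rep_inv M g) *m spec_X n x false.
pose H' := spec_X n x true *m spec_B x (rep_mx M g) *m spec_B x (map_mx x G').
have := @specialise_mx _ _ _ _ _ _ I t _ _ tW _ x H H' P.
rewrite !map_mxM !spec_point_X !spec_point_B; apply.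
rewrite !spec_generic_X !spec_generic_B /= !rep_inv_map !rep_map -!map_mx_comp.
apply: (heap_pt1 sG _ _ _ _ tP).
- exact: kills_comp.
- exact: (kills_comp _ (@fibre_map_kills _ _ _ F I t)).
- by rewrite -gx; apply: rmorph_ext.
- by apply: rmorph_ext => c; exact: tensor_comm.
Qed.

Lemma twist_eqn (s t : gal) G G' W W' P :
  img_pt s G G' -> img_pt t W W' -> img_eqn t P ->
  img_eqn s (mxtwist G G' W W' P).
Proof.
move=> sG tW tP; apply/(quot_map0 (fibre_ideal I s)).
rewrite -[LHS]/(fibre_map I s (rep_eval M (mxtwist G G' W W' P))).
rewrite rep_eval_map mxeval_twist; apply: (heap_pt2 sG _ tW) => //; exact: fibre_map_kills.
Qed.

(** The heap operation on arrows makes the closed images into heaps of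
    matrices: the three factors of heap_pt are specialised in turn. *)
Lemma heap_img (s t : gal) G G' H H' W W' :
  img_pt s G G' -> img_pt s H H' -> img_pt t W W' ->
  img_pt t (G *m H' *m W) (W' *m H *m G').
Proof.
move=> sG sH tW P tP; have := sH _ (twist_eqn sG tW tP).
rewrite mxeval_twist.
have mapid (X : 'M[kbar]_n) : map_mx (rid kbar) X = X.
  by apply/matrixP => i j; rewrite mxE.
by rewrite !mapid.
Qed.

(** The closed image of a fibre is locally constant. Near s, it satisfies the
    finitely many equations that define it at s; but all closed images are
    translates of one another, and a closed subset of an algebraic variety is
    not a translate of a proper closed subset of itself. *)
Lemma img_pt_near (s : gal) G G' : (forall t : gal, ~ fibre t 1) ->
  img_pt s G G' -> nbhs s [set t | img_pt t G G'].
Proof.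
move=> nempty sG.
have noeth : noetherian (mxpolys n kbar).
  by apply: mpol_noetherian; exact: field_noetherian.
have [ps [psE psG]] := noeth (img_eqn s).
have near_ps : nbhs s [set t | forall P, P \in ps -> img_eqn t P].
  elim: ps psE {psG} => [|P ps IH] psE.
    by apply: filterS filterT => t _ P; rewrite in_nil.
  have hP : nbhs s [set t | img_eqn t P].
    by apply: (@fibre_near _ _ _ F I s); apply: psE; exact: mem_head.
  have hps : nbhs s [set t | forall P, P \in ps -> img_eqn t P].
    by apply: IH => Q Qps; apply: psE; rewrite inE Qps orbT.
  by apply: filterS2 hP hps => t tP tps Q; rewrite inE => /orP[/eqP->|/tps].
apply: filterS near_ps => t /= tps.
have eqn_st : img_eqn s `<=` img_eqn t.
  by move=> P /psG; apply: ideal_gen_min; [exact: img_eqn_ideal|exact: tps].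
have pt_ts U U' : img_pt t U U' -> img_pt s U U' by move=> h P /eqn_st; exact: h.
have [T [T' tT]] := img_pt_exists M (nempty t).
pose g : 'M[kbar]_n := G' * T; pose g' : 'M[kbar]_n := T' * G.
have GG' : G * G' = 1 := img_pt_mulV repM sG.
have G'G : G' * G = 1 := img_pt_Vmul repM sG.
have TT' : T * T' = 1 := img_pt_mulV repM tT.
have T'T : T' * T = 1 := img_pt_Vmul repM tT.
have gg' : g * g' = 1 by rewrite /g /g' mulrA -(mulrA G') TT' mulr1.
have g'g : g' * g = 1 by rewrite /g /g' mulrA -(mulrA T') GG' mulr1.
have trans U U' : img_pt s U U' -> img_pt t (U * g) (g' * U').
  move=> sU; have := heap_img sU sG tT.
  by rewrite /g /g' -!mulmxE !mulmxA.
clearbody g g'.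
have pw i : g ^+ i * g' ^+ i = 1.
  elim: i => [|i IH]; first by rewrite mulr1.
  by rewrite exprSr exprS mulrA -(mulrA _ g) gg' mulr1.
have transi i U U' : img_pt s U U' -> img_pt s (U * g ^+ i) (g' ^+ i * U').
  move=> sU; elim: i => [|i IH]; first by rewrite mulr1 mul1r.
  have := pt_ts _ _ (trans _ _ IH).
  by rewrite exprSr exprS !mulrA.
(* The translates of the image at s by the powers of g decrease; J is the
   ideal of their intersection, and N an exponent from which they are
   constant. *)
pose J : set (mxpolys n kbar) := [set P | exists i, forall U U', img_pt s U U' ->
  mxeval (rid kbar) (U * g ^+ i) (g' ^+ i * U') P = 0].
have [qs [qsJ qsG]] := noeth J.
have [N NP] : exists N, forall P, P \in qs -> forall U U', img_pt s U U' ->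
    mxeval (rid kbar) (U * g ^+ N) (g' ^+ N * U') P = 0.
  elim: qs qsJ {qsG} => [|Q qs IH] qsJ; first by exists 0%N.
  have [N NP] : exists N, forall P, P \in qs -> forall U U', img_pt s U U' ->
      mxeval (rid kbar) (U * g ^+ N) (g' ^+ N * U') P = 0.
    by apply: IH => P Pqs; apply: qsJ; rewrite inE Pqs orbT.
  have [i iP] := qsJ Q (mem_head _ _); exists (i + N)%N => P.
  rewrite inE => /orP[/eqP->|Pqs] U U' sU.
    have := iP _ _ (transi N _ _ sU).
    by rewrite -mulrA -exprD mulrA -exprD addnC [X in _ ^+ X * U']addnC.
  have := NP _ Pqs _ _ (transi i _ _ sU).
  by rewrite -mulrA -exprD mulrA -exprD [X in _ ^+ X * U']addnC.
have JN : forall P, J P -> forall U U', img_pt s U U' ->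
    mxeval (rid kbar) (U * g ^+ N) (g' ^+ N * U') P = 0.
  move=> P /qsG PG U U' sU; move: P PG.
  apply: (@ideal_gen_min _ _ [set P | mxeval (rid kbar) (U * g ^+ N)
    (g' ^+ N * U') P = 0]); last by move=> P /= /NP; apply.
  exact: ker_ideal (zero_ideal kbar).
move=> P tP.
have mapid (X : 'M[kbar]_n) : map_mx (rid kbar) X = X.
  by apply/matrixP => i j; rewrite mxE.
have JQ : J (mxtrans (g' ^+ N) (g ^+ N) P).
  exists N.+1 => U U' sU; rewrite mxeval_trans !mapid !mulmxE.
  rewrite exprS -!mulrA pw mulr1 exprSr !mulrA pw mul1r.
  exact: (trans _ _ sU P tP).
have := JN _ JQ _ _ sG; rewrite mxeval_trans !mapid !mulmxE.
by rewrite -!mulrA pw mulr1 !mulrA pw mul1r.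
Qed.
End OneRep.

Section SubRep.
Variables (m n : nat) (B : 'I_m -> 'I_m -> F) (M : 'I_n -> 'I_n -> F).
Variables (e : 'I_n -> 'I_m) (eB : forall i j, B (e i) (e j) = M i j).

Definition mxrestr : {rmorphism mxpolys n kbar -> mxpolys m kbar} :=
  mxeval (mconst kbar _) (mxsub e e (mxX m kbar false)) (mxsub e e (mxX m kbar true)).

Lemma mxeval_restr (S : comPzRingType) (f : {rmorphism kbar -> S}) H H' P :
  mxeval f H H' (mxrestr P) = mxeval f (mxsub e e H) (mxsub e e H') P.
Proof.
rewrite mxeval_map.
have -> : rcomp (mxeval f H H') (mconst kbar _) = f.
  by apply: rmorph_ext => a; exact: mxevalC.
by rewrite !map_mxsub !mxeval_mxX.
Qed.

Lemma rep_eval_restr P : rep_eval B (mxrestr P) = rep_eval M P.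
Proof.
rewrite [LHS]mxeval_restr; congr (mxeval _ _ _ P);
  by apply/matrixP => i j; rewrite !mxE eB.
Qed.

Lemma img_pt_restr s H H' : img_pt B I s H H' ->
  img_pt M I s (mxsub e e H) (mxsub e e H').
Proof.
move=> sH P sP; rewrite -mxeval_restr; apply: sH.
by rewrite /img_eqn /mkset rep_eval_restr.
Qed.
End SubRep.

Section DirectSum.
Variables (n m : nat) (M : 'I_n -> 'I_n -> F) (N : 'I_m -> 'I_m -> F).
Hypotheses (repM : is_rep M) (repN : is_rep N).

Definition rep_sum (i j : 'I_(n + m)) : F :=
  match fintype.split i, fintype.split j with
  | inl a, inl b => M a b
  | inr a, inr b => N a b
  | _, _ => 0
  end.

Lemma rep_sum_ll i j : rep_sum (lshift m i) (lshift m j) = M i j.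
Proof.
by rewrite /rep_sum -[lshift m i]/(unsplit (inl i)) -[lshift m j]/(unsplit (inl j))
  !unsplitK.
Qed.

Lemma rep_sum_rr i j : rep_sum (rshift n i) (rshift n j) = N i j.
Proof.
by rewrite /rep_sum -[rshift n i]/(unsplit (inr i)) -[rshift n j]/(unsplit (inr j))
  !unsplitK.
Qed.

Lemma rep_sum_lr i j : rep_sum (lshift m i) (rshift n j) = 0.
Proof.
by rewrite /rep_sum -[lshift m i]/(unsplit (inl i)) -[rshift n j]/(unsplit (inr j))
  !unsplitK.
Qed.

Lemma rep_sum_rl i j : rep_sum (rshift n i) (lshift m j) = 0.
Proof.
by rewrite /rep_sum -[rshift n i]/(unsplit (inr i)) -[lshift m j]/(unsplit (inl j))
  !unsplitK.
Qed.

Definition rep_sumE := (rep_sum_ll, rep_sum_rr, rep_sum_lr, rep_sum_rl).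

Lemma rep_sum_rep : is_rep rep_sum.
Proof.
split=> [R x y z u v i j|R x i j].
  rewrite big_split_ord -(splitK i) -(splitK j).
  case: (fintype.split i) => a; case: (fintype.split j) => b /=; rewrite !rep_sumE.
  - rewrite repM.1 [X in _ = _ + X]big1 ?addr0 => [|l _].
      by apply: eq_bigr => l _; rewrite !rep_sumE.
    by rewrite !rep_sumE rmorph0 mul0r.
  - rewrite rmorph0 !big1 ?addr0 // => l _;
      by rewrite !rep_sumE rmorph0 ?mulr0 ?mul0r.
  - rewrite rmorph0 !big1 ?addr0 // => l _;
      by rewrite !rep_sumE rmorph0 ?mulr0 ?mul0r.
  - rewrite repN.1 [X in _ = X + _]big1 ?add0r => [|l _].
      by apply: eq_bigr => l _; rewrite !rep_sumE.
    by rewrite !rep_sumE rmorph0 mul0r.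
rewrite -(splitK i) -(splitK j).
case: (fintype.split i) => a; case: (fintype.split j) => b /=; rewrite !rep_sumE.
- by rewrite repM.2 eq_lshift.
- by rewrite rmorph0 eq_lrshift.
- by rewrite rmorph0 eq_rlshift.
- by rewrite repN.2 eq_rshift.
Qed.

Lemma img_pt_sum_ur s H H' : img_pt rep_sum I s H H' ->
  ursubmx H = 0 /\ ursubmx H' = 0.
Proof.
move=> sH; have van b i j : mxeval (rid kbar) H H'
    (mxgen kbar b (lshift m i) (rshift n j)) = 0.
  apply: sH; rewrite /img_eqn /mkset /rep_eval mxevalX.
  by case: b; rewrite mxE rep_sum_lr ?rmorph0; exact: ig_0.
split; apply/matrixP => i j; rewrite !mxE.
  by have := van false i j; rewrite mxevalX.
by have := van true i j; rewrite mxevalX.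
Qed.

Lemma ulsubmx_mul (X Y : 'M[kbar]_(n + m)) : ursubmx X = 0 ->
  ulsubmx (X *m Y) = ulsubmx X *m ulsubmx Y.
Proof.
move=> X0; apply/matrixP => i j; rewrite !mxE big_split_ord /=.
rewrite [X in _ + X]big1 ?addr0 => [|l _].
  by apply: eq_bigr => l _; rewrite !mxE.
by have /matrixP/(_ i l) := X0; rewrite !mxE => ->; rewrite mul0r.
Qed.

Lemma img_pt_ul s H H' : img_pt rep_sum I s H H' ->
  img_pt M I s (ulsubmx H) (ulsubmx H').
Proof.
move=> /(img_pt_restr rep_sum_ll).
have -> : forall X : 'M[kbar]_(n + m), mxsub (lshift m) (lshift m) X = ulsubmx X.
  by move=> X; apply/matrixP => i j; rewrite !mxE.
have -> : mxsub (lshift m) (lshift m) H' = ulsubmx H'.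
  by apply/matrixP => i j; rewrite !mxE.
by [].
Qed.

(** Minimal primes lift along an injective ring morphism; the points that are
    general on the corresponding components lift by the theorem of
    Chevalley. *)
Lemma img_lift_generic t (q : spec (mxpolys n kbar)) :
  minimal_over (img_eqn M I t) q -> exists u, ~ prime_set q u /\
  forall G G', (forall P, prime_set q P -> mxeval (rid kbar) G G' P = 0) ->
  mxeval (rid kbar) G G' u != 0 ->
  exists H H', img_pt rep_sum I t H H' /\ ulsubmx H = G.
Proof.
move=> [Iq minq].
pose E : {rmorphism mxpolys (n + m) (mxpolys n kbar) -> F} :=
  mxeval (rep_eval M) (rep_mx rep_sum (rid F)) (rep_inv rep_sum (rid F)).
pose S := [set x | exists s, ~ prime_set q s /\ x = mconst (mxpolys n kbar) #|mvar (n + m)| s].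
have EC s : E (mconst _ _ s) = rep_eval M s by exact: mxevalC.
have [||||q' [Kq' q'S]] := @prime_avoiding _ (E @^-1` fibre t) S.
- exact: ker_ideal (fibre_ideal I t).
- by exists 1; rewrite rmorph1; split=> //; exact: prime1.
- move=> _ _ [x [qx ->]] [y [qy ->]]; exists (x * y); rewrite rmorphM; split=> //.
  by move=> /primeM[].
- move=> z fz [s [qs sE]]; apply: qs; apply: Iq.
  rewrite /img_eqn /mkset -EC -sE; exact: fz.
have q'q a : prime_set q' (mconst _ _ a) -> prime_set q a.
  by move=> q'a; apply: contrapT => qa; apply: (q'S _ q'a); exists a.
have qq' a : prime_set q a -> prime_set q' (mconst _ _ a).
  apply: (minq (spec_map (mconst _ _) q')) => [b Ib|]; last exact: q'q.
  by apply: Kq'; rewrite /preimage /mkset EC.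
have [u [nu uP]] := @chevalley kbar _ _ q' 1 (@prime1 _ _).
exists u; split; first by move=> /qq'.
move=> G G' qG uG; pose f := mxeval (rid kbar) G G'.
have [c [cq' _]] := uP f (fun a h => qG _ (q'q _ h)) uG.
pose f' := mev #|mvar (n + m)| f c.
have f'C a : f' (mconst _ _ a) = f a by exact: mevC.
pose H := map_mx f' (mxX (n + m) (mxpolys n kbar) false).
pose H' := map_mx f' (mxX (n + m) (mxpolys n kbar) true).
exists H, H'; split.
  pose j : {rmorphism mxpolys (n + m) kbar -> mxpolys (n + m) (mxpolys n kbar)} :=
    mxeval (rcomp (mconst _ _) (mconst kbar _)) (mxX (n + m) _ false) (mxX (n + m) _ true).
  move=> P tP; have -> : mxeval (rid kbar) H H' P = f' (j P).
    rewrite mxeval_map; congr (mxeval _ _ _ P); apply: rmorph_ext => a.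
    by rewrite -[RHS]/(f' (mconst _ _ (mconst kbar _ a))) f'C [RHS]mxevalC.
  apply: cq'; apply: Kq'; rewrite /preimage /mkset.
  have -> : E (j P) = rep_eval rep_sum P.
    rewrite mxeval_map !mxeval_mxX; congr (mxeval _ _ _ P); apply: rmorph_ext => a.
    by rewrite -[LHS]/(E (mconst _ _ (mconst kbar _ a))) EC [LHS]mxevalC.
  exact: tP.
apply/matrixP => i j; rewrite !mxE.
have : f' (mxgen _ false (lshift m i) (lshift m j) -
    mconst _ _ (mxgen kbar false i j)) = 0.
  apply: cq'; apply: Kq'; rewrite /preimage /mkset rmorphB EC.
  by rewrite /E /rep_eval !mxevalX !mxE rep_sum_ll subrr; exact: ig_0.
by rewrite rmorphB f'C => /subr0_eq->; rewrite /f mxevalX.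
Qed.

Lemma mxpoly_id p (P : mxpolys p kbar) :
  mxeval (mconst kbar _) (mxX p kbar false) (mxX p kbar true) P = P.
Proof.
have e := mxeval_eta (rid (mxpolys p kbar)).
have := congr1 (fun g : {rmorphism _ -> _} => g P) e => /= {2}->.
by congr (mxeval _ _ _ P); [apply: rmorph_ext|apply/matrixP => i j; rewrite !mxE|
  apply/matrixP => i j; rewrite !mxE].
Qed.

Lemma twistK (G G' W W' : 'M[kbar]_n) P : G' *m G = 1%:M -> W *m W' = 1%:M ->
  mxtwist G G' W W' (mxtwist W W' G G' P) = P.
Proof.
move=> G'G WW'; rewrite [LHS]mxeval_twist -/(cmx W) -/(cmx W') -/(cmx G) -/(cmx G').
have cM (X Y : 'M[kbar]_n) : X *m Y = 1%:M -> cmx X *m cmx Y = 1%:M.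
  by move=> XY; rewrite -map_mxM XY map_mx1.
rewrite !mulmxA (cM _ _ WW') mul1mx -!mulmxA (cM _ _ G'G) mulmx1.
by rewrite !mulmxA (cM _ _ G'G) mul1mx -!mulmxA (cM _ _ WW') mulmx1 mxpoly_id.
Qed.

(** Every point of the closed image of a fibre lifts, although it need not be
    general: a point G is of the form G2 W^-1 G1 where G1 and G2 = G G1^-1 W
    are general and W lifts. *)
Lemma img_lift t G G' : ~ fibre t 1 -> img_pt M I t G G' ->
  exists H H', img_pt rep_sum I t H H' /\ ulsubmx H = G.
Proof.
move=> nempty tG.
have nI1 : ~ img_eqn M I t 1 by rewrite /img_eqn /mkset rmorph1.
have [q minq] := minimal_prime (img_eqn_ideal M I t) nI1.
have [Iq minq2] := minq.
have repB := rep_sum_rep.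
have [WB [WB' tWB]] := img_pt_exists rep_sum nempty.
have tW := img_pt_ul tWB.
set W := ulsubmx WB in tW; set W' := ulsubmx WB' in tW.
have G'G := img_pt_Vmul repM tG; have GG' := img_pt_mulV repM tG.
have W'W := img_pt_Vmul repM tW; have WW' := img_pt_mulV repM tW.
pose th := mxtwist G G' W W'; pose th2 := mxtwist W W' G G'.
have minq' : minimal_over (img_eqn M I t) (spec_map th q).
  split=> [P tP|p Ip pq x qx]; first exact: Iq _ (twist_eqn repM tG tW tP).
  rewrite -(twistK x W'W GG').
  apply: (minq2 (spec_map th2 p)) => [P tP|P /pq|]; last exact: qx.
    exact: Ip _ (twist_eqn repM tW tG tP).
  by rewrite /= /th /th2 twistK.
have [u1 [nu1 u1P]] := img_lift_generic minq.
have [u2 [nu2 u2P]] := img_lift_generic minq'.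
have nu : ~ prime_set q (u1 * th u2) by move=> /primeM[].
have [c [cq cu]] := nullstellensatz nu.
pose f := mev #|mvar n| (rid kbar) c.
pose X := map_mx f (mxX n kbar false); pose X' := map_mx f (mxX n kbar true).
have fE : f = mxeval (rid kbar) X X'.
  rewrite [LHS]mxeval_eta; congr mxeval; apply: rmorph_ext => a.
  exact: mevC.
have cq' P : prime_set q P -> mxeval (rid kbar) X X' P = 0.
  by rewrite -fE; exact: cq.
move: cu; rewrite -/f rmorphM fE mulf_eq0 negb_or => /andP[c1 c2].
have mapid (Z : 'M[kbar]_n) : map_mx (rid kbar) Z = Z.
  by apply/matrixP => i j; rewrite mxE.
have thE P : mxeval (rid kbar) X X' (th P) =
    mxeval (rid kbar) (G *m X' *m W) (W' *m X *m G') P.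
  by rewrite mxeval_twist !mapid.
have [H1 [H1' [tH1 H1X]]] := u1P _ _ cq' c1.
have q2 P : prime_set (spec_map th q) P ->
    mxeval (rid kbar) (G *m X' *m W) (W' *m X *m G') P = 0.
  by move=> qP; rewrite -thE; exact: cq'.
have [H2 [H2' [tH2 H2X]]] : exists H H', img_pt rep_sum I t H H' /\
    ulsubmx H = G *m X' *m W.
  by apply: u2P q2 _; rewrite -thE.
have tX : img_pt M I t X X' by move=> P tP; apply: cq'; exact: Iq.
exists (H2 *m WB' *m H1), (H1' *m WB *m H2'); split.
  exact: heap_img tH2 tWB tH1.
have [H20 _] := img_pt_sum_ur tH2; have [_ WB0] := img_pt_sum_ur tWB.
rewrite -mulmxA !ulsubmx_mul // H1X H2X -/W'.
by rewrite mulmxA -(mulmxA _ W) WW' mulmx1 -mulmxA (img_pt_Vmul repM tX) mulmx1.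
Qed.
End DirectSum.

(** On the fibre at t, where d1 c = d0 (t c), the expression of a function by
    matrix coefficients becomes a polynomial in the entries of one
    representation. *)
Lemma rep_fibre_span t (s : seq F) : exists m (N : 'I_m -> 'I_m -> F),
  is_rep N /\ forall a, a \in s -> exists Q, fibre t (a - rep_eval N Q).
Proof.
elim: s => [|a s [m [N [repN NP]]]].
  exists 0%N, (fun _ _ => 0); split=> //; split=> [R x y z u v []|R x []] //.
have [n [M [repM [b [c aE]]]]] := rep_spanning a.
exists (n + m)%N, (rep_sum M N); split; first exact: rep_sum_rep.
move=> a'; rewrite inE => /orP[/eqP->|/NP[Q QP]]; last first.
  by exists (mxrestr (@rshift n m) Q); rewrite (rep_eval_restr (rep_sum_rr M N)).
pose Q : mxpolys n kbar := \sum_j \sum_i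
  mconst kbar _ (b i * t (c j)) * mxgen kbar false i j.
exists (mxrestr (@lshift n m) Q); rewrite (rep_eval_restr (rep_sum_ll M N)).
have -> : a - rep_eval M Q =
    \sum_j (\sum_i d0 (b i) * M i j) * (d1 (c j) - d0 (t (c j))).
  rewrite {1}aE rmorph_sum -sumrB; apply: eq_bigr => j _.
  rewrite mulrBr; congr (_ - _); rewrite rmorph_sum mulr_suml; apply: eq_bigr => i _.
  by rewrite rmorphM /rep_eval mxevalC mxevalX mxE rmorphM mulrAC.
apply: (ideal_sum (fibre_ideal I t)) => j _; apply: ig_mul; apply: ig_base.
by right; exists (c j).
Qed.

(** If no arrow of the fibre had the matrix G, then 1 would be a combination
    of the M i j - G i j, whose coefficients are polynomials in the entries
    of a second representation N. A lift of G to the closed image for the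
    direct sum of M and N, given by img_lift, contradicts this. *)
Lemma img_fibre_proper n (M : 'I_n -> 'I_n -> F) t G G' :
  is_rep M -> ~ fibre t 1 -> img_pt M I t G G' ->
  ~ ideal_gen (fibre t `|` [set a | exists i j, a = M i j - d0 (G i j)]) 1.
Proof.
move=> repM nempty tG.
have expr a : ideal_gen (fibre t `|` [set a | exists i j, a = M i j - d0 (G i j)]) a ->
    exists (b : 'I_n * 'I_n -> F),
      fibre t (a - \sum_p b p * (M p.1 p.2 - d0 (G p.1 p.2))).
  elim=> [x [tx|[i [j ->]]]||x y _ [b bP] _ [c cP]|x y _ [b bP]].
  - by exists (fun=> 0); rewrite big1 ?subr0 // => p _; rewrite mul0r.
  - exists (fun p => (p == (i, j))%:R); rewrite (bigD1 (i, j)) //= eqxx mul1r.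
    by rewrite big1 ?addr0 ?subrr => [|p /negPf->]; rewrite ?mul0r //; exact: ig_0.
  - by exists (fun=> 0); rewrite big1 ?subr0 => [|p _]; rewrite ?mul0r //; exact: ig_0.
  - exists (fun p => b p + c p); under eq_bigr do rewrite mulrDl.
    by rewrite big_split opprD addrACA; exact: ig_add.
  - exists (fun p => x * b p); under eq_bigr do rewrite -mulrA.
    by rewrite -mulr_sumr -mulrBr; exact: ig_mul.
move=> /expr[b bP].
have [m [N [repN NP]]] := rep_fibre_span t (codom b).
have /choice[Q QP] (p : 'I_n * 'I_n) : exists Q, fibre t (b p - rep_eval N Q).
  by apply: NP; exact: codom_f.
have [H [H' [tH HG]]] := img_lift repM repN nempty tG.
pose gen (p : 'I_n * 'I_n) : mxpolys (n + m) kbar := mxgen kbar false (lshift m p.1) (lshift m p.2).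
pose P : mxpolys (n + m) kbar := 1 - \sum_(p : 'I_n * 'I_n)
  mxrestr (@rshift n m) (Q p) * (gen p - mconst kbar _ (G p.1 p.2)).
have : mxeval (rid kbar) H H' P = 0.
  apply: tH; rewrite /img_eqn /mkset.
  have -> : rep_eval (rep_sum M N) P =
      (1 - \sum_p b p * (M p.1 p.2 - d0 (G p.1 p.2))) +
      \sum_p (b p - rep_eval N (Q p)) * (M p.1 p.2 - d0 (G p.1 p.2)).
    rewrite rmorphB rmorph1 -addrA; congr (_ + _).
    rewrite -sumrN -big_split rmorph_sum -sumrN; apply: eq_bigr => p _ /=.
    rewrite rmorphM (rep_eval_restr (rep_sum_rr M N)) rmorphB.
    rewrite /rep_eval mxevalC mxevalX mxE rep_sum_ll.
    by rewrite mulrBl addrA addNr add0r.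
  apply: ig_add => //; apply: (ideal_sum (fibre_ideal I t)) => p _.
  by rewrite mulrC; apply: ig_mul; exact: QP.
rewrite rmorphB rmorph1 rmorph_sum big1 ?subr0 => [/eqP|p _].
  by rewrite oner_eq0.
rewrite rmorphM rmorphB mxevalC mxevalX -HG !mxE subrr.
exact: mulr0.
Qed.
End HeapPoints.

(** * A section of a transitive groupoid over the Galois group *)

Section GroupoidSection.
Variables (k : fieldType) (kbar : closedFieldType) (iota : {rmorphism k -> kbar}).
Hypotheses (k_perfect : perfect_field k) (alg : algebraic_extension iota).
Variable F : groupoid iota.

Local Notation gal := (gal iota).
Local Notation kk := (kk iota).
Local Notation d0 := (gr_d0 F).
Local Notation d1 := (gr_d1 F).

Definition kk_str : {rmorphism kk -> F} := tensor_lift (@gr_k _ _ _ F).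

Lemma rcompE (A B C : pzSemiRingType) (g : {rmorphism B -> C})
  (f : {rmorphism A -> B}) a : rcomp g f a = g (f a).
Proof. by []. Qed.

Lemma kk_strl c : kk_str (tensor_inl iota iota c) = d0 c.
Proof. exact: tensor_liftl. Qed.

Lemma kk_strr c : kk_str (tensor_inr iota iota c) = d1 c.
Proof. exact: tensor_liftr. Qed.

Lemma kk_ptl (s : gal) c : kk_pt s (tensor_inl iota iota c) = c.
Proof. exact: tensor_liftl. Qed.

Lemma kk_ptr (s : gal) c : kk_pt s (tensor_inr iota iota c) = s c.
Proof. exact: tensor_liftr. Qed.

(** The closed subschemes of F, with non-empty fibres over Gal, that are
    torsors under a subgroup of the diagonal. The smallest ones are sections. *)
Record good (I : set F) : Prop := Good {
  good_ideal : is_ideal I;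
  good_fibre : forall t : gal, ~ fibre I t 1;
  good_heap : heap I }.

(** The fibre of F at t is not empty because F is surjective on the spectrum
    of kbar (x)_k kbar, of which t is a point. *)
Lemma good_zero : is_transitive F -> good [set a | a = 0].
Proof.
case=> _ surj; split.
- exact: zero_ideal.
- move=> t t1.
  have k0 : is_ideal [set a : kbar | a = 0] by exact: zero_ideal.
  have k1 : ~ [set a : kbar | a = 0] 1 by move=> /eqP; rewrite oner_eq0.
  have [p0 p0P] := proper_prime k0 k1.
  have p0E a : prime_set p0 a -> a = 0.
    move=> pa; apply/eqP; apply: contrapT => /negP a0; apply: (@prime1 _ p0).
    by rewrite -(mulVf a0); exact: primeMl.
  have [q qE] := surj (spec_map (kk_pt t) p0).
  have qP (a : kk) : kk_pt t a = 0 -> prime_set q (kk_str a).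
    move=> a0; have : prime_set p0 (kk_pt t a) by rewrite a0; exact: prime0.
    by rewrite -[prime_set p0 _]/(prime_set (spec_map (kk_pt t) p0) a) -qE.
  apply: (@prime1 _ q); move: t1; apply: ideal_gen_min; first exact: prime_ideal.
  move=> a [->|[c ->]]; first exact: prime0.
  have := qP (tensor_inr _ _ c - tensor_inl _ _ (t c)).
  rewrite !rmorphB kk_strl kk_strr; apply.
  by rewrite kk_ptl kk_ptr subrr.
- move=> R x y z u v w _ _ _ a ->; exact: rmorph0.
Qed.

Lemma good_union (C : set (set F)) : C !=set0 -> C `<=` good ->
  total_on C subset -> good (\bigcup_(I in C) I).
Proof.
move=> [I0 CI0] Cgood totC; split.
- by apply: bigcup_ideal CI0 totC _ => I /Cgood[].
- move=> t t1.
  have : (\bigcup_(J in [set fibre I t | I in C]) J) 1.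
    move: t1; apply: ideal_gen_min.
      apply: (@bigcup_ideal _ _ (fibre I0 t)); first by exists I0.
        move=> _ _ [I CI <-] [J CJ <-]; have [IJ|JI] := totC I J CI CJ.
          by left; apply: ideal_gen_sub => a [/IJ|]; [left|right].
        by right; apply: ideal_gen_sub => a [/JI|]; [left|right].
      by move=> _ [I _ <-]; exact: fibre_ideal.
    move=> a [[I CI Ia]|[c ->]].
      by exists (fibre I t); [exists I|exact: fibre_sub].
    exists (fibre I0 t); first by exists I0.
    by apply: ig_base; right; exists c.
  by case=> _ [I /Cgood[_ h _] <-]; exact: h.
- move=> R x y z u v w uC vC wC a [I CI Ia].
  have [_ _ hI] := Cgood I CI.
  by apply: hI Ia => b Ib; [apply: uC|apply: vC|apply: wC]; exists I.
Qed.

Lemma good_max : is_transitive F ->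
  exists I, good I /\ forall J, good J -> I `<=` J -> J `<=` I.
Proof.
move=> transF; have g0 := good_zero transF.
pose P : set (set F) := [set J | J = set0 \/ good J].
have [C CP totC|I [PI maxI]] := @Zorn_bigcup F P.
  pose C' := [set X | C X /\ good X].
  have UE : \bigcup_(X in C) X = \bigcup_(X in C') X.
    apply/seteqP; split=> a [X]; last by case=> CX _; exists X.
    by move=> CX Xa; exists X => //; split=> //; case: (CP X CX) => // X0; rewrite X0 in Xa.
  have [[X CX]|nC] := pselect (C' !=set0).
    right; rewrite UE; apply: good_union; first by exists X.
      by move=> ? [].
    by move=> ? ? [? _] [? _]; exact: totC.
  left; rewrite UE; apply/seteqP; split=> // a [X CX _]; apply: nC; by exists X.
have gI : good I.
  case: PI => // I0; exfalso; apply: (maxI [set a | a = 0]); last by right.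
  by rewrite I0; split=> // /(_ 0 erefl).
exists I; split=> // J gJ IJ; apply: contrapT => nJI.
by apply: (maxI J); [split|right].
Qed.

(** By compactness, matrices G(t) in the closed images of the fibres can be
    chosen to be locally constant in t, that is to be the values of a matrix
    with coefficients in kbar (x)_k kbar; then the condition M = G cuts out a
    smaller heap. *)
Lemma good_extend I n (M : 'I_n -> 'I_n -> F) : good I -> is_rep M ->
  exists J, [/\ good J, I `<=` J & forall i j, exists t, J (M i j - kk_str t)].
Proof.
move=> [idI properI heapI] repM.
have [G lG GP] := @locst_choice k kbar iota k_perfect alg _
  (fun t (G : 'M[kbar]_n * 'M[kbar]_n) => img_pt M I t G.1 G.2)
  (fun s => let: ex_intro g (ex_intro g' h) := img_pt_exists M (properI s) in
    ex_intro _ (g, g') (img_pt_near heapI repM properI h)).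
have xy := @tensor_comm _ _ _ iota iota.
have /choice[tau tauP] (p : 'I_n * 'I_n) : exists r : kk,
    forall s (R' : comPzRingType) (f : {rmorphism kk -> R'}),
    agree_at (tensor_inl iota iota) (tensor_inr iota iota) s f ->
    f r = f (tensor_inl iota iota ((G s).1 p.1 p.2)).
  apply: (galois_glue k_perfect alg xy).
  exact: (locst_comp (fun g : 'M[kbar]_n * 'M[kbar]_n => _ (g.1 p.1 p.2)) lG).
pose X : set F := [set a | exists i j, a = M i j - kk_str (tau (i, j))].
have kkE (R : comPzRingType) (x y : {rmorphism kbar -> R}) (u v : gr_arrow F x y) r :
    u (kk_str r) = v (kk_str r).
  suff e : rcomp u kk_str = rcomp v kk_str.
    exact: (congr1 (fun f : {rmorphism kk -> R} => f r) e).
  apply: tensor_hom_ext => c.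
    by rewrite !rcompE kk_strl !ar_target.
  by rewrite !rcompE kk_strr !ar_source.
exists (ideal_gen (I `|` X)); split; last first.
- by move=> i j; exists (tau (i, j)); apply: ig_base; right; exists i, j.
- by move=> a Ia; apply: ig_base; left.
split; first exact: ideal_gen_ideal.
- move=> t t1; apply: (img_fibre_proper heapI repM (properI t) (GP t)).
  set K := ideal_gen _; have idK : is_ideal K := ideal_gen_ideal _.
  have fK a : fibre I t a -> K a by move=> fa; apply: ig_base; left.
  move: t1; apply: ideal_gen_min => // a [|[c ->]]; last first.
    by apply: fK; apply: ig_base; right; exists c.
  apply: ideal_gen_min => // {}a [Ia|[i [j ->]]].
    by apply: fK; apply: fibre_sub.
  rewrite -(subrK (d0 ((G t).1 i j)) (M i j)) -addrA; apply: idealD => //.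
    by apply: ig_base; right; exists i, j.
  apply: fK; apply/(quot_map0 (fibre_ideal I t)).
  pose f := rcomp (fibre_map I t) kk_str.
  have ft : agree_at (tensor_inl iota iota) (tensor_inr iota iota) t f.
    have [_ h] := (fibre_agree I t (fibre_map I t)).1 (@fibre_map_kills _ _ _ F I t).
    by move=> c; have := h c; rewrite /f !rcompE kk_strl kk_strr.
  have := tauP (i, j) t _ f ft.
  rewrite /f !rcompE kk_strl => e.
  by rewrite -[LHS]/(fibre_map I t _) rmorphB e subrr.
(* The matrices of u and v are equal, being the values of tau at a pair of
   points that u and v share; so u v^-1 w has the same matrix as w. *)
- move=> R x y z u v w uJ vJ wJ.
  have sub (x' y' : {rmorphism kbar -> R}) (f : gr_arrow F x' y') :
      kills (ideal_gen (I `|` X)) f -> kills I f /\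
      forall i j, f (M i j) = f (kk_str (tau (i, j))).
    move=> fJ; split=> [a Ia|i j]; first by apply: fJ; apply: ig_base; left.
    by apply: subr0_eq; rewrite -rmorphB; apply: fJ; apply: ig_base; right; exists i, j.
  have [uI uM] := sub _ _ _ uJ; have [vI vM] := sub _ _ _ vJ.
  have [wI wM] := sub _ _ _ wJ.
  set e := gr_comp u _; have eI : kills I e by exact: heapI.
  move=> a; apply: (@ideal_gen_min _ _ [set a | e a = 0]).
    exact: ker_ideal (zero_ideal R).
  move=> {}a [/eI //|[i [j ->]]] /=; rewrite rmorphB (kkE _ _ _ e w) -wM.
  have uv : rep_mx M u = rep_mx M v.
    by apply/matrixP => i' j'; rewrite !mxE uM vM (kkE _ _ _ u v).
  have : rep_mx M e = rep_mx M w.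
    rewrite /e !(rep_mx_comp repM) uv mulmxA -(rep_mx_comp repM) gr_comprV.
    by rewrite (rep_mx_id repM) mul1mx.
  by move=> /matrixP/(_ i j); rewrite !mxE => ->; rewrite subrr.
Qed.

(** A non-zero value of r at s would be invertible, and the fibre at s empty. *)
Lemma kk_str_proper I (r : kk) : good I -> I (kk_str r) -> r = 0.
Proof.
move=> [_ properI _] Ir.
apply: (galois_separate k_perfect alg (@tensor_comm _ _ _ iota iota)) => s R f fs.
have loc (S : comPzRingType) (g : {rmorphism kk -> S}) :
    agree_at (tensor_inl iota iota) (tensor_inr iota iota) s g ->
    g r = g (tensor_inl _ _ (kk_pt s r)).
  move=> gs; suff e : g = rcomp (rcomp g (tensor_inl _ _)) (kk_pt s).
    exact: (congr1 (fun h : {rmorphism kk -> S} => h r) e).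
  apply: tensor_hom_ext => c; first by rewrite !rcompE kk_ptl.
  by rewrite !rcompE kk_ptr; exact: gs.
have [c0|c0] := eqVneq (kk_pt s r) 0.
  by rewrite loc // c0 !rmorph0.
exfalso; apply: (properI s); apply/(quot_map0 (fibre_ideal I s)).
have [_ h] := (fibre_agree I s (fibre_map I s)).1 (@fibre_map_kills _ _ _ F I s).
pose g := rcomp (fibre_map I s) kk_str.
have gs : agree_at (tensor_inl iota iota) (tensor_inr iota iota) s g.
  by move=> c; have := h c; rewrite /g !rcompE kk_strl kk_strr.
have g0 : g r = 0 by apply/(quot_map0 (fibre_ideal I s)); exact: fibre_sub.
have : g (tensor_inl _ _ (kk_pt s r)) = 0 by rewrite -loc.
move=> e.
rewrite -[LHS]/(fibre_map I s 1) -(rmorph1 kk_str) -[LHS]/(g 1).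
by rewrite -(rmorph1 (tensor_inl iota iota)) -(mulVf c0) !rmorphM e mulr0.
Qed.

Record gr_section := GrSection {
  sec_hom :> {rmorphism F -> kk};
  sec0 : forall c, sec_hom (d0 c) = tensor_inl iota iota c;
  sec1 : forall c, sec_hom (d1 c) = tensor_inr iota iota c }.

(** Let I be a maximal good ideal. By maximality, good_extend shows that
    modulo I every matrix coefficient comes from kbar (x)_k kbar; since
    matrix coefficients span the functions on F, so does every function, and
    from one element only. *)
Theorem transitive_section : is_transitive F -> inhabited gr_section.
Proof.
move=> /good_max[I [gI maxI]].
have gen_I n (M : 'I_n -> 'I_n -> F) : is_rep M ->
    forall i j, exists t, I (M i j - kk_str t).
  move=> repM i j; have [J [gJ IJ JP]] := good_extend gI repM.
  by have [t Jt] := JP i j; exists t; exact: maxI Jt.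
have idI := good_ideal gI.
have /choice[r rP] a : exists t, I (a - kk_str t).
  have [n [M [repM [b [c aE]]]]] := rep_spanning a.
  have /choice[tau tauP] (p : 'I_n * 'I_n) := gen_I n M repM p.1 p.2.
  exists (\sum_j (\sum_i tensor_inl _ _ (b i) * tau (i, j)) * tensor_inr _ _ (c j)).
  rewrite {1}aE rmorph_sum -sumrB; apply: (ideal_sum idI) => j _.
  rewrite rmorphM kk_strr -mulrBl mulrC; apply: (idealM idI).
  rewrite rmorph_sum -sumrB; apply: (ideal_sum idI) => i _.
  rewrite rmorphM kk_strl -mulrBr; apply: (idealM idI).
  exact: (tauP (i, j)).
have uniq a t : I (a - kk_str t) -> r a = t.
  move=> h; apply: subr0_eq; apply: (kk_str_proper gI).
  rewrite rmorphB -(subrK a (kk_str _)) -addrA; apply: (idealD idI) => //.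
  by rewrite -opprB; apply: (idealN idI).
have rB : zmod_morphism r.
  move=> a b; apply: uniq.
  have -> : a - b - kk_str (r a - r b) = (a - kk_str (r a)) - (b - kk_str (r b)).
    rewrite rmorphB !opprB [LHS]addrACA [RHS]addrACA; congr (_ + _).
    exact: addrC.
  exact: (idealB idI).
have rM : monoid_morphism r.
  split=> [|a b]; first by apply: uniq; rewrite rmorph1 subrr; exact: ideal0.
  apply: uniq; rewrite rmorphM -(subrK (kk_str (r a) * b) (a * b)) -addrA.
  rewrite -mulrBl -mulrBr; apply: (idealD idI); last exact: (idealM idI).
  by rewrite mulrC; exact: (idealM idI).
pose r' : {rmorphism F -> kk} := HB.pack r
  (GRing.isZmodMorphism.Build F kk r rB) (GRing.isMonoidMorphism.Build F kk r rM).
split; apply: (@GrSection r') => c; apply: uniq.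
  by rewrite kk_strl subrr; exact: ideal0.
by rewrite kk_strr subrr; exact: ideal0.
Qed.
End GroupoidSection.

(** * Krull topologies and continuous actions *)

Lemma cont_fst (X Y : topologicalType) : continuous (@fst X Y).
Proof. by move=> p; exact: cvg_fst. Qed.

Lemma cont_snd (X Y : topologicalType) : continuous (@snd X Y).
Proof. by move=> p; exact: cvg_snd. Qed.

Section KrullContinuity.
Variables (k : fieldType) (kbar : closedFieldType) (iota : {rmorphism k -> kbar}).

Local Notation gal := (gal iota).

Lemma locst_app (X : topologicalType) (Y Z : Type) (G : X -> Y -> Z) (h : X -> Y) :
  locst h -> (forall y, locst (G ^~ y)) -> locst (fun x => G x (h x)).
Proof.
by move=> lh lG x; apply: filterS2 (lh x) (lG (h x) x) => x' /= -> ->.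
Qed.

Lemma locst_sum (X : topologicalType) (R : comPzRingType) (J : Type) (r : seq J)
  (f : X -> J -> R) : (forall j, locst (f ^~ j)) ->
  locst (fun x => \sum_(j <- r) f x j).
Proof.
move=> lf; elim: r => [|j r IH] x.
  by apply: filterS filterT => y _ /=; rewrite !big_nil.
by apply: filterS2 (lf j x) (IH x) => y /=; rewrite !big_cons => -> ->.
Qed.

Lemma locst_cont (X Y : topologicalType) (Z : Type) (g : X -> Y) (f : Y -> Z) :
  continuous g -> locst f -> locst (f \o g).
Proof. by move=> cg lf x; exact: cg x _ (lf (g x)). Qed.

Lemma nbhs_kpt (B : comPzRingType) (str : {rmorphism kbar -> B}) (z : kpt str)
    (A : set (kpt str)) :
  nbhs z A <-> exists bs : seq B, forall w : kpt str, map w bs = map z bs -> A w.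
Proof.
rewrite -(krull_nbhs (@pt_fun _ _ str)) nbhsE.
by split=> [[U [oU Us] UA]|[U oU [Us UA]]]; exists U.
Qed.

Lemma kpt_locst (B : comPzRingType) (str : {rmorphism kbar -> B}) b :
  locst (fun z : kpt str => z b).
Proof. by move=> z; apply/nbhs_kpt; exists [:: b] => w [] /=. Qed.

Lemma gal_locst c : locst (fun s : gal => s c).
Proof. by move=> z; apply/nbhs_gal; exists [:: c] => w [] /=. Qed.

Lemma kpt_cont (X : topologicalType) (B : comPzRingType)
  (str : {rmorphism kbar -> B}) (f : X -> kpt str) :
  (forall b, locst (fun x => f x b)) -> continuous f.
Proof.
move=> lf x A /nbhs_kpt[bs bsA].
by apply: filterS (locst_map bs lf x) => y /= /bsA.
Qed.

Lemma gal_cont (X : topologicalType) (f : X -> gal) :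
  (forall c, locst (fun x => f x c)) -> continuous f.
Proof.
move=> lf x A /nbhs_gal[cs csA].
by apply: filterS (locst_map cs (f := fun x => f x) lf x) => y /= /csA.
Qed.

Lemma locst_galV (X : topologicalType) (f : X -> gal) :
  (forall c, locst (fun x => f x c)) -> forall c, locst (fun x => (f x)^-1%g c).
Proof.
move=> lf c x; apply: filterS (lf ((f x)^-1%g c) x) => y /=.
by rewrite galKV => e; rewrite -{1}e galVK.
Qed.

Lemma gal_topological : is_topological_group gal.
Proof.
split.
  apply: gal_cont => c; rewrite /=.
  apply: (@locst_app _ _ _ (fun p : gal * gal => p.1 : kbar -> kbar)
    (fun p : gal * gal => p.2 c)).
    exact: (@locst_cont _ _ _ snd (fun s : gal => s c) (@cont_snd _ _) (gal_locst c)).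
  move=> y.
  exact: (@locst_cont _ _ _ fst (fun s : gal => s y) (@cont_fst _ _) (gal_locst y)).
by apply: gal_cont => c; apply: locst_galV; exact: gal_locst.
Qed.
End KrullContinuity.

Section ContinuousAction.
Variables (M : groupTopType) (B : comPzRingType) (act : M -> {rmorphism B -> B}).

Lemma nbhs_spec (A : comPzRingType) (p : spec A) (U : set (spec A)) :
  nbhs p U <-> exists b, ~ prime_set p b /\ forall q, ~ prime_set q b -> U q.
Proof.
rewrite nbhsE; split=> [[V [[J ->] /= nJp] VU]|[b [pb bU]]].
  have [b /not_implyP[Jb pb]] : exists b, ~ (J b -> prime_set p b).
    by apply: contrapT => /forallNP h; apply: nJp => x; apply: contrapT.
  by exists b; split=> // q qb; apply: VU => /= /(_ b Jb).
exists [set q | ~ prime_set q b]; last by move=> q /= /bU.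
split=> //; exists [set b]; apply/seteqP; split=> q /= qb.
  by move=> /(_ b erefl).
by move=> h; apply: qb => _ ->.
Qed.

Lemma germ_pull_frac (A C : comPzRingType) (f : {rmorphism A -> C}) (p : spec C) a s :
  ~ prime_set (spec_map f p) s ->
  germ_pull f p (germ_frac (spec_map f p) a s) = germ_frac p (f a) (f s).
Proof.
move=> ps; apply/seteqP; split=> [[b t]|bt h].
  move=> [a' [s' [[/= ps' [u [pu e]]] [/= pt [w [pw e']]]]]]; split=> //=.
  exists (f u * w * f s'); split.
    by move=> /primeM[/primeM[]|].
  have /(congr1 f) := e; rewrite !rmorphM => fe.
  transitivity (f u * (f a * f s') * (w * t)); first by ring.
  rewrite fe; transitivity (f u * f s * (w * (f a' * t))); first by ring.
  by rewrite e'; ring.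
exists a, s; split=> //; split=> //.
by exists 1; rewrite !mul1r; split=> //; exact: prime1.
Qed.

Lemma germ_frac_eq (A : comPzRingType) (p : spec A) (a b : A) :
  germ_frac p a 1 = germ_frac p b 1 -> exists u, ~ prime_set p u /\ u * (a - b) = 0.
Proof.
move=> e; have : germ_frac p a 1 (a, 1).
  split=> /=; first exact: prime1.
  by exists 1; rewrite !mul1r mulr1; split=> //; exact: prime1.
by rewrite e => -[_ [u [pu /= ue]]]; exists u; split=> //; ring: ue.
Qed.

(** A section is near a point a fraction a / s on the complement of the zeros
    of some t; the images of a, s and t are constant near m0. *)
Lemma locst_action :
  (forall b, act 1%g b = b) -> (forall m n b, act (m * n)%g b = act n (act m b)) ->
  (forall b, locst (fun m => act m b)) -> continuous_action act.
Proof.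
move=> act1 actM lact; split=> //.
  move=> [m0 z0] A /nbhs_spec[b [pb bA]].
  apply: filterS (_ : nbhs (m0, z0) [set mz | act mz.1 b = act m0 b /\
      ~ prime_set mz.2 (act m0 b)]).
    by move=> [m z] /= [e nz]; apply: bA; rewrite /= e.
  exists ([set m | act m b = act m0 b], [set z | ~ prime_set z (act m0 b)]).
    by split; [exact: lact|apply/nbhs_spec; exists (act m0 b)].
  by move=> [m z] [].
move=> U f oU fU m0 z0 Uz0.
have [V [a [s [oV Vz0 VU Vf]]]] := fU _ Uz0.
have [t [nt tV]] : exists t, ~ prime_set (spec_map (act m0) z0) t /\
    forall q, ~ prime_set q t -> V q.
  by apply/nbhs_spec; apply: open_nbhs_nbhs; split.
pose N0 := [set m | [/\ act m t = act m0 t, act m a = act m0 a & act m s = act m0 s]].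
have : nbhs m0 N0.
  apply: filterS3 (lact t m0) (lact a m0) (lact s m0) => m /= e1 e2 e3.
  by split.
rewrite nbhsE => -[N [oN Nm0] NN0].
pose W := [set z | ~ prime_set z (act m0 t)].
have WV m z : N m -> W z -> V (spec_map (act m) z).
  by move=> /NN0[e _ _] Wz; apply: tV; rewrite /= e.
have frac m z : N m -> W z ->
    germ_pull (act m) z (f (spec_map (act m) z)) = germ_frac z (act m0 a) (act m0 s)
    /\ ~ prime_set z (act m0 s).
  move=> Nm Wz; have [ns ->] := Vf _ (WV m z Nm Wz).
  by rewrite germ_pull_frac //; have [_ <- <-] := NN0 _ Nm.
exists N, W, (fun z => germ_frac z (act m0 a) (act m0 s)); split=> //.
  exists [set act m0 t]; apply/seteqP; split=> z /= nz.
    by move=> /(_ _ erefl).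
  by move=> h; apply: nz => _ ->.
split.
  move=> z Wz; exists W, (act m0 a), (act m0 s); split=> //.
    exists [set act m0 t]; apply/seteqP; split=> z' /= nz.
      by move=> /(_ _ erefl).
    by move=> h; apply: nz => _ ->.
  by move=> z' Wz'; split=> //; have [] := frac m0 z' Nm0 Wz'.
move=> m z Nm Wz; split; first exact/VU/WV.
by have [] := frac m z Nm Wz.
Qed.

(** The continuity of an action gives, around every point of the spectrum, a
    neighbourhood of m on which the images of b have constant germs; the
    spectrum being quasi-compact, these images are constant near m. *)
Lemma action_locst b : continuous_action act -> locst (fun m => act m b).
Proof.
move=> [_ _ _ sheaf] m0.
have sec : is_section setT (fun p => germ_frac p b 1).
  move=> p _; exists setT, b, 1; split=> //; first exact: openT.
  by move=> q _; split=> //; exact: prime1.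
pose I : set B := [set t | nbhs m0 [set m | forall z, ~ prime_set z t ->
  germ_frac z (act m b) 1 = germ_frac z (act m0 b) 1]].
have idI : is_ideal I.
  split.
  - by apply: filterS filterT => m _ z /(_ (prime0 z)).
  - move=> s t Is It; apply: filterS2 Is It => m ms mt z zst.
    have [zs|zs] := pselect (prime_set z s); last exact: ms.
    by apply: mt => zt; apply: zst; exact: primeD.
  - by move=> s t It; apply: filterS It => m mt z zst; apply: mt => zt;
      apply: zst; exact: primeMl.
have I1 : I 1.
  apply: contrapT => nI1; have [z0 Iz0] := proper_prime idI nI1.
  have [N [V [g [oN Nm0 oV Vz0 [_ gP]]]]] := sheaf setT _ openT sec m0 z0 Logic.I.
  have [t [nt tV]] : exists t, ~ prime_set z0 t /\ forall q, ~ prime_set q t -> V q.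
    by apply/nbhs_spec; apply: open_nbhs_nbhs; split.
  apply: nt; apply: Iz0; have : nbhs m0 N by apply: open_nbhs_nbhs; split.
  apply: filterS => m Nm z /tV Vz.
  have pull m' : N m' -> germ_frac z (act m' b) 1 = g z.
    move=> Nm'; have [_ <-] := gP m' z Nm' Vz.
    by rewrite germ_pull_frac ?rmorph1 //; exact: prime1.
  by rewrite !pull.
apply: filterS I1 => m mP /=.
apply: subr0_eq; apply: contrapT => ne.
pose A := [set u | u * (act m b - act m0 b) = 0].
have idA : is_ideal A.
  split=> [|u v eu ev|u v ev]; rewrite /A /mkset; first exact: mul0r.
    by rewrite mulrDl [u * _]eu [v * _]ev addr0.
  by rewrite -mulrA [v * _]ev mulr0.
have [|z Az] := proper_prime idA; first by rewrite /A /= mul1r.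
have [|u [zu ue]] := germ_frac_eq (mP z _); first exact: prime1.
by apply: zu; exact: Az.
Qed.
End ContinuousAction.

(** * The points of a transitive groupoid form a Galois extended group *)

Section GroupoidData.
Variables (k : fieldType) (kbar : closedFieldType) (iota : {rmorphism k -> kbar}).
Variables (alg : algebraic_extension iota) (F : groupoid iota).

Local Notation gal := (gal iota).
Local Notation d0 := (gr_d0 F).
Local Notation d1 := (gr_d1 F).
Local Notation pts := (gr_kpt alg F).
Local Notation D := (diag_group F).
Local Notation incl := (@gr_incl _ _ _ alg F).

Lemma pts_locst a : locst (fun u : pts => u a).
Proof. exact: kpt_locst. Qed.

Lemma pts_cont (X : topologicalType) (f : X -> pts) :
  (forall a, locst (fun x => f x a)) -> continuous f.
Proof. exact: kpt_cont. Qed.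

Lemma gr_mulS a : exists s : seq (F * F), forall u v : pts,
  (u * v)%g a = \sum_(p <- s) u p.1 * gr_gamma u (v p.2).
Proof.
by have [s sE] := gr_compS a; exists s => u v; exact: sE.
Qed.

Lemma gr_gamma_locst (X : topologicalType) (f : X -> pts) :
  (forall a, locst (fun x => f x a)) -> forall c, locst (fun x => gr_gamma (f x) c).
Proof. by move=> lf c; exact: (lf (d1 c)). Qed.

Lemma pts_topological : is_topological_group pts.
Proof.
have l1 a : locst (fun p : pts * pts => p.1 a).
  exact: (@locst_cont _ _ _ fst (fun s : pts => s a) (@cont_fst _ _) (pts_locst a)).
have l2 a : locst (fun p : pts * pts => p.2 a).
  exact: (@locst_cont _ _ _ snd (fun s : pts => s a) (@cont_snd _ _) (pts_locst a)).
split; apply: pts_cont => a.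
  have [s sE] := gr_mulS a.
  have -> : (fun p : pts * pts => (p.1 * p.2)%g a) =
      fun p => \sum_(q <- s) p.1 q.1 * gr_gamma p.1 (p.2 q.2).
    by apply/funext => p; exact: sE.
  apply: locst_sum => q; apply: locst2 => //.
  by apply: (@locst_app _ _ _ (fun p : pts * pts => gr_gamma p.1 : kbar -> kbar)
    (fun p : pts * pts => p.2 q.2)) => // c; exact: (gr_gamma_locst l1).
have -> : (fun u : pts => (u^-1)%g a) =
    fun u : pts => (gr_gamma u)^-1%g (u (antipode F a)).
  by apply/funext => u; rewrite /= gr_inv_antipode.
apply: (@locst_app _ _ _ (fun u : pts => (gr_gamma u)^-1%g : kbar -> kbar)
    (fun u : pts => u (antipode F a))) => [|c]; first exact: pts_locst.
by apply: locst_galV; apply: gr_gamma_locst; exact: pts_locst.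
Qed.

Lemma diag_surj (b : diag_ring F) : exists a, b = diag_proj F a.
Proof.
rewrite -(reprK b) -[\pi _]pr_reval.
elim: (repr b) => [a|||e1 [a1 h1] e2 [a2 h2]|e1 [a1 h1] e2 [a2 h2]|e [a h]] /=.
- by exists a.
- by exists 0; rewrite rmorph0.
- by exists 1; rewrite rmorph1.
- by exists (a1 + a2); rewrite rmorphD h1 h2.
- by exists (a1 * a2); rewrite rmorphM h1 h2.
- by exists (- a); rewrite rmorphN h.
Qed.

Lemma gr_inclE (z : ag_kpt D) a : incl z a = z (diag_proj F a).
Proof. by []. Qed.

Lemma gr_gamma_incl (z : ag_kpt D) : gr_gamma (incl z) = 1%g.
Proof. by apply: gal_ext => c; exact: ar_source. Qed.

Lemma gr_inclM : {morph incl : z w / (z * w)%g}.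
Proof.
move=> z w; apply: pt_ext => a.
transitivity (gr_comp (diag_arrow z) (diag_arrow w) a); first exact: diag_ptE.
by apply: gr_comp_eq => // b; rewrite /= -[RHS]/(gr_gamma (incl z) _) gr_gamma_incl.
Qed.

Lemma gr_projM : {morph @gr_gamma _ _ _ alg F : u v / (u * v)%g}.
Proof. by move=> u v; apply: gal_ext => c; exact: gr_gammaM. Qed.

Lemma gr_incl_cont : continuous (incl).
Proof. by apply: pts_cont => a; exact: kpt_locst. Qed.

Lemma gr_incl_inj : injective (incl).
Proof.
move=> z w e; apply: diag_pt_ext => a.
exact: (congr1 (fun u : pts => u a) e).
Qed.

Lemma gr_exact (u : pts) : gr_gamma u = 1%g <-> exists z, incl z = u.
Proof.
split=> [g1|[z <-]]; last exact: gr_gamma_incl.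
have src c : u (d1 c) = rid kbar c by exact: (congr1 (fun s : gal => s c) g1).
pose w := @Arrow kbar F d0 d1 _ (rid kbar) (rid kbar) u (pt_str u) src.
by exists (diag_pt w); apply: pt_ext => a; exact: diag_ptE.
Qed.

(** The embedding in the group of points of F carries the operations and the
    topology. *)
Lemma diag_topological : is_topological_group (ag_kpt D).
Proof.
have [mulc invc] := pts_topological.
have inc := gr_incl_cont.
have incV (z : ag_kpt D) : incl z^-1%g = ((incl z)^-1)%g.
  apply: (mulgI (incl z)); rewrite -gr_inclM !mulgV.
  by apply: (mulgI (incl 1%g)); rewrite -gr_inclM !mulg1.
split; apply: kpt_cont => b; have [a ->] := diag_surj b.
  have -> : (fun p : ag_kpt D * ag_kpt D => (p.1 * p.2)%g (diag_proj F a)) =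
      (fun u : pts => u a) \o ((fun p : pts * pts => (p.1 * p.2)%g) \o
        (fun p : ag_kpt D * ag_kpt D => (incl p.1, incl p.2))).
    by apply/funext => p; rewrite /= -[RHS]/((incl p.1 * incl p.2)%g a) -gr_inclM.
  apply: locst_cont; last exact: pts_locst.
  move=> p; apply: continuous_comp; last exact: mulc.
  move=> A [[U V] /= [nU nV] UVA].
  exists (incl @^-1` U, incl @^-1` V); first by split; exact: inc.
  by move=> [y z] /= [Uy Vz]; apply: UVA.
have -> : (fun z : ag_kpt D => (z^-1)%g (diag_proj F a)) =
    (fun u : pts => u a) \o ((fun u : pts => (u^-1)%g) \o incl).
  by apply/funext => z; rewrite -gr_inclE incV.
apply: locst_cont; last exact: pts_locst.
by move=> p; apply: continuous_comp; [exact: inc|exact: invc].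
Qed.

Lemma gr_incl_open (U : set (ag_kpt D)) : open U ->
  exists V : set pts, open V /\ U = incl @^-1` V.
Proof.
move=> oU; pose V := \bigcup_(W in [set W : set pts | open W /\ incl @^-1` W `<=` U]) W.
exists V; split; first by apply: bigcup_open => W [].
apply/seteqP; split=> [z Uz|z [W [_ WU] Wz]]; last exact: WU.
have /nbhs_kpt[bs bsU] : nbhs z U by apply: open_nbhs_nbhs; split.
have /choice[pre preE] b := diag_surj b.
pose W0 := [set u : pts | map u (map pre bs) = map (incl z) (map pre bs)].
have : nbhs (incl z) W0 by apply/nbhs_kpt; exists (map pre bs).
rewrite nbhsE => -[W [oW Wz] WW0]; exists W => //; split=> // w Ww; apply: bsU.
have e (v : ag_kpt D) : map v bs = map (incl v) (map pre bs).
  by rewrite -map_comp; apply: eq_map => b /=; rewrite {1}(preE b).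
by rewrite !e; exact: (WW0 _ Ww).
Qed.

Section Conjugation.
Variables (R : comPzRingType) (x : {rmorphism kbar -> R}).

Fact conj_at_target (v : pts) c :
  rcomp (rcomp x (gr_gamma v)^-1%g) v (d0 c) = rcomp x (gr_gamma v)^-1%g c.
Proof. by rewrite /= (pt_str v). Qed.

Fact conj_at_source (v : pts) c :
  rcomp (rcomp x (gr_gamma v)^-1%g) v (d1 c) = x c.
Proof. by congr (x _); exact: (galVK (gr_gamma v)). Qed.

Definition conj_at (v : pts) : gr_arrow F (rcomp x (gr_gamma v)^-1%g) x :=
  @Arrow kbar F d0 d1 _ (rcomp x (gr_gamma v)^-1%g) x
    (rcomp (rcomp x (gr_gamma v)^-1%g) v) (conj_at_target v) (conj_at_source v).

(** The action is defined by its effect on the universal point of the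
    diagonal; naturality of the composition transfers the formula to all
    points. *)
Lemma gr_actE (u : pt (diag_str F) x) (v : pts) a :
  u (gr_act v (diag_proj F a)) =
    gr_comp (gr_comp (conj_at v) (diag_arrow u)) (gr_inv (conj_at v)) a.
Proof.
rewrite [X in u X]diag_ptE.
have := congr1 (fun t : gr_arrow F _ _ => t a)
  (gr_nat_comp u (gr_comp (conj_arrow v) (diag_univ F)) (gr_inv (conj_arrow v))).
move=> /= ->; rewrite gr_nat_comp gr_nat_inv.
have cE : arrow_map u (conj_arrow v) =1 conj_at v.
  by move=> b; exact: (pt_str u).
apply: gr_comp_eq; last exact: gr_inv_eq.
exact: gr_comp_eq.
Qed.
End Conjugation.

Lemma diag_hom_eq (R : comPzRingType) (f g : {rmorphism diag_ring F -> R}) :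
  (forall a, f (diag_proj F a) = g (diag_proj F a)) -> forall b, f b = g b.
Proof. by move=> fg b; have [a ->] := diag_surj b. Qed.

Definition univ_pt : pt (diag_str F) (diag_str F) :=
  @Pt _ _ (diag_str F) _ (diag_str F) (rid _) (fun=> erefl).

Lemma gr_act1 b : gr_act (1%g : pts) b = b.
Proof.
apply: (@diag_hom_eq _ (gr_act (1%g : pts)) (rid _)) => a.
rewrite [LHS](gr_actE univ_pt).
pose i := gr_id F (diag_str F).
have cE : conj_at (diag_str F) (1%g : pts) =1 i.
  have g1 : gr_gamma (1%g : pts) = 1%g by apply: gal_ext => e; exact: gr_gamma1.
  move=> c; rewrite /i gr_idE.
  transitivity (diag_str F ((gr_gamma (1%g : pts))^-1%g (counit F c))) => //.
  by rewrite g1 invg1.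
transitivity (gr_comp (gr_comp i (diag_arrow univ_pt)) (gr_inv i) a).
  by apply: gr_comp_eq; [exact: gr_comp_eq|exact: gr_inv_eq].
by rewrite gr_compl1 -(gr_invE (gr_compl1 i)) gr_compr1.
Qed.

Lemma gr_actM (m n : pts) b : gr_act (m * n)%g b = gr_act n (gr_act m b).
Proof.
apply: (@diag_hom_eq _ (gr_act (m * n)%g) (rcomp (gr_act n) (gr_act m))) => a.
rewrite [LHS](gr_actE univ_pt).
rewrite -[RHS]/(gr_act n (gr_act m (diag_proj F a))).
pose w : pt (diag_str F) (conj_str n) := diag_pt (gr_comp (gr_comp (conj_arrow n)
  (diag_univ F)) (gr_inv (conj_arrow n))).
rewrite [RHS](gr_actE w) diag_ptK.
set cm := conj_at _ m; set cn := conj_arrow n; set U := diag_univ F.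
have cE : conj_at (diag_str F) (m * n)%g =1 gr_comp cm cn.
  move=> c; pose s : {rmorphism kbar -> diag_ring F} :=
    rcomp (diag_str F) (gr_gamma (m * n)%g)^-1%g.
  transitivity (arrow_map s (gr_comp (kpt_arrow m) (translate (gr_gamma m) n)) c) => //.
  have sE e : s (gr_gamma m e) = conj_str n e.
    congr (diag_str F _); rewrite gr_projM invgM.
    by rewrite -[LHS]/((gr_gamma n)^-1%g ((gr_gamma m)^-1%g (gr_gamma m e))) galVK.
  rewrite gr_nat_comp; apply: gr_comp_eq => e; last exact: sE.
  transitivity (conj_str n ((gr_gamma m)^-1%g (m e))) => //.
  by rewrite -sE galKV.
transitivity (gr_comp (gr_comp (gr_comp cm cn) U) (gr_inv (gr_comp cm cn)) a).
  by apply: gr_comp_eq; [exact: gr_comp_eq|exact: gr_inv_eq].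
have -> : gr_inv (gr_comp cm cn) = gr_comp (gr_inv cn) (gr_inv cm).
  symmetry; apply: gr_invE; rewrite gr_compA -(gr_compA cm cn) gr_comprV gr_compr1.
  exact: gr_comprV.
by rewrite !gr_compA.
Qed.

(** By gr_compS, the conjugate of the universal point is a finite sum of
    products of values of v and of its inverse. *)
Lemma gr_act_locst b : locst (fun v : pts => gr_act v b).
Proof.
have [a ->] := diag_surj b.
have -> : (fun v : pts => gr_act v (diag_proj F a)) = fun v =>
    gr_comp (gr_comp (conj_at (diag_str F) v) (diag_arrow univ_pt))
      (gr_inv (conj_at (diag_str F) v)) a.
  by apply/funext => v; exact: (gr_actE univ_pt).
have lc c : locst (fun v : pts => conj_at (diag_str F) v c).
  apply: (locst_comp (diag_str F)).
  apply: (@locst_app _ _ _ (fun u : pts => (gr_gamma u)^-1%g : kbar -> kbar)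
    (fun u : pts => u c)) => [|e]; first exact: pts_locst.
  by apply: locst_galV; apply: gr_gamma_locst; exact: pts_locst.
have [s sE] := gr_compS a.
have /choice[t tE] (c : F) := gr_compS c.
suff lS : locst (fun v : pts => \sum_(p <- s) (\sum_(q <- t p.1)
    conj_at (diag_str F) v q.1 * diag_arrow univ_pt q.2) *
      conj_at (diag_str F) v (antipode F p.2)).
  move=> v; apply: filterS (lS v) => v' /= e.
  rewrite !sE; have aux w : \sum_(p <- s) gr_comp (conj_at (diag_str F) w)
      (diag_arrow univ_pt) p.1 * gr_inv (conj_at (diag_str F) w) p.2 =
    \sum_(p <- s) (\sum_(q <- t p.1) conj_at (diag_str F) w q.1 *
      diag_arrow univ_pt q.2) * conj_at (diag_str F) w (antipode F p.2).
    by apply: eq_bigr => p _; rewrite tE gr_inv_antipode.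
  by rewrite !aux.
apply: locst_sum => p; apply: locst2 => //; apply: locst_sum => q.
by apply: locst2 => //; exact: locst_cst.
Qed.

Lemma gr_act_str (v : pts) c :
  gr_act v (diag_str F c) = diag_str F ((gr_gamma v)^-1%g c).
Proof. exact: (pt_str (diag_pt (gr_comp (gr_comp (conj_arrow v) (diag_univ F)) (gr_inv (conj_arrow v))))). Qed.

Lemma sigma_pt_arrow (v : pts) (R : comPzRingType) (x : {rmorphism kbar -> R})
  (u : pt (diag_str F) x) h :
  diag_arrow (@sigma_pt _ _ _ (gr_gamma v) _ _ (diag_str F) (diag_str F) (gr_act v) h R x u) =
    gr_comp (gr_comp (conj_at x v) (diag_arrow u)) (gr_inv (conj_at x v)).
Proof. by apply: arrow_ext => a; exact: gr_actE. Qed.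

Lemma gr_sigma (v : pts) : @sigma_automorphism _ _ _ (gr_gamma v) D (gr_act v).
Proof.
have h : @sigma_morphism _ _ _ (gr_gamma v) _ _ (ag_str D) (ag_str D) (gr_act v).
  exact: gr_act_str.
apply: (@Build_sigma_automorphism _ _ _ _ _ _ h) => [|R x u w].
  exists (gr_act (v^-1)%g) => b; rewrite -gr_actM ?mulgV ?mulVg gr_act1 //.
apply: (can_inj (@diag_arrowK _ _ _ F R _)).
rewrite /= /diag_mul diag_ptK !sigma_pt_arrow diag_ptK.
set c := conj_at x v; set U := diag_arrow u; set W := diag_arrow w.
rewrite -!gr_compA; congr (gr_comp c (gr_comp U _)).
by rewrite !gr_compA gr_compV gr_compl1.
Qed.

Section SectionPoints.
Variable r : gr_section F.

Fact sec_pt_str (t : gal) c : rcomp (kk_pt t) r (d0 c) = rid kbar c.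
Proof. by rewrite rcompE sec0 kk_ptl. Qed.

Definition sec_pt (t : gal) : pts := @Pt _ _ d0 _ (rid kbar) _ (sec_pt_str t).

Lemma sec_pt_gamma t : gr_gamma (sec_pt t) = t.
Proof. by apply: gal_ext => c; rewrite -[LHS]/(kk_pt t (r (d1 c))) sec1 kk_ptr. Qed.

Lemma sec_pt_cont : continuous sec_pt.
Proof.
apply: pts_cont => a; apply: (locst_presented (f := @kk_pt _ _ iota)) => -[c|c].
  have -> : (fun t => kk_pt t (tensor_inl iota iota c)) = fun=> c.
    by apply/funext => t; exact: kk_ptl.
  exact: locst_cst.
have -> : (fun t => kk_pt t (tensor_inr iota iota c)) = fun t : gal => t c.
  by apply/funext => t; exact: kk_ptr.
exact: gal_locst.
Qed.
End SectionPoints.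

(** A section of F gives a continuous section of F(kbar) over Gal; the other
    axioms are formal. *)
Lemma galois_groupoid_data (r : gr_section F) : is_galois_extended (groupoid_data alg F).
Proof.
apply: (@Build_is_galois_extended _ _ _ (groupoid_data alg F) _ _ _ gr_sigma) => /=.
- split.
  + exact: diag_topological.
  + exact: pts_topological.
  + exact: gal_topological.
  + exact: gr_inclM.
  + exact: gr_projM.
  + exact: gr_incl_cont.
  + by apply: gal_cont => c; apply: gr_gamma_locst; exact: pts_locst.
  + exact: gr_incl_inj.
  + exact: gr_exact.
  + exact: gr_incl_open.
  + move=> s; exists setT, (sec_pt r); split=> [||| t _]; first exact: openT.
    + by [].
    + by apply: continuous_subspaceT; exact: sec_pt_cont.
    + exact: sec_pt_gamma.
- by apply: locst_action; [exact: gr_act1|exact: gr_actM|exact: gr_act_locst].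
- by move=> e c; rewrite [LHS]gr_act_str gal_fix.
- move=> e z; apply: (mulIg e); rewrite -mulgA mulVg mulg1; apply: pt_ext => a.
  set sz := sigma_kpt _ z.
  pose E := kpt_arrow e; pose Z := translate (gr_gamma e) (incl z).
  transitivity (gr_comp E Z a); last by [].
  pose cz := conj_at (rid kbar) e.
  pose Y := gr_comp (gr_comp cz (diag_arrow z)) (gr_inv cz).
  have szE b : incl sz b = gr_gamma e (Y b).
    by congr (gr_gamma e _); exact: (gr_actE z).
  pose Y' := arrow_map (gr_gamma e) Y.
  have cE : arrow_map (gr_gamma e) cz =1 E by move=> b; exact: galKV.
  transitivity (gr_comp Y' (arrow_map (gr_gamma e) cz) a).
    apply: gr_comp_eq => [b|b]; first exact: szE.
    rewrite cE; exact: (congr1 (fun s : gal => s (e b)) (gr_gamma_incl sz)).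
  rewrite -gr_nat_comp /Y -gr_compA gr_compV gr_compr1 gr_nat_comp.
  exact: gr_comp_eq.
- move=> z R x u; pose f : {rmorphism diag_ring F -> R} := rcomp u (gr_act (incl z)).
  apply: (@diag_hom_eq _ f (ag_conj (kpt_const z x) u)) => a.
  rewrite [LHS]gr_actE.
  pose w : pt (diag_str F) x := kpt_const z x.
  have -> : ag_conj (D := D) w u = diag_pt (gr_comp (diag_arrow (diag_pt (gr_comp
    (diag_arrow w) (diag_arrow u)))) (diag_arrow (diag_pt (gr_inv (diag_arrow w))))).
    by [].
  rewrite diag_ptE !diag_ptK.
  have cE : conj_at x (incl z) =1 diag_arrow (kpt_const z x).
    move=> b; congr (x _); rewrite gr_gamma_incl invg1 //.
  by apply: gr_comp_eq; [exact: gr_comp_eq|exact: gr_inv_eq].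
Qed.
End GroupoidData.

(** * Flatness over kbar (x)_k kbar, and primes of that ring *)

Lemma spec_ext (A : comPzRingType) (p q : spec A) :
  (forall a, prime_set p a <-> prime_set q a) -> p = q.
Proof.
case: p q => [P p0 pD pM p1 pP] [Q q0 qD qM q1 qP] /= h.
have e : P = Q by apply/seteqP; split=> a /h.
by subst Q; congr Spec; exact: Prop_irrelevance.
Qed.

Lemma field_zero_prime (K : fieldType) :
  exists p : spec K, forall a, prime_set p a <-> a = 0.
Proof.
have [|p p0] := proper_prime (zero_ideal K); first by move=> /eqP; rewrite oner_eq0.
exists p => a; split=> [pa|->]; last exact: prime0.
apply/eqP; apply: contrapT => /negP a0; apply: (@prime1 _ p).
by rewrite -(mulVf a0); exact: primeMl.
Qed.

Section FlatOverKK.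
Variables (k : fieldType) (kbar : closedFieldType) (iota : {rmorphism k -> kbar}).
Hypotheses (k_perfect : perfect_field k) (alg : algebraic_extension iota).

Local Notation gal := (gal iota).
Local Notation kk := (kk iota).
Local Notation inl_kk := (tensor_inl iota iota).
Local Notation inr_kk := (tensor_inr iota iota).
Local Notation agree_kk := (agree_at inl_kk inr_kk).

(** The locus of t being an intersection of open and closed subsets where the
    ring is kbar, such a function takes the value 1 in a neighbourhood of t. *)
Definition near1 (t : gal) (e : kk) :=
  forall (R : comPzRingType) (f : {rmorphism kk -> R}), agree_kk t f -> f e = 1.

Lemma near1M t e e' : near1 t e -> near1 t e' -> near1 t (e * e').
Proof. by move=> h h' R f ft; rewrite rmorphM h // h' ?mul1r. Qed.

Lemma near1_1 t : near1 t 1.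
Proof. by move=> R f _; exact: rmorph1. Qed.

Lemma agree_kk_pt t (R : comPzRingType) (f : {rmorphism kk -> R}) r :
  agree_kk t f -> f r = f (inl_kk (kk_pt t r)).
Proof.
move=> ft; suff e : f = rcomp (rcomp f inl_kk) (kk_pt t).
  exact: (congr1 (fun h : {rmorphism kk -> R} => h r) e).
apply: tensor_hom_ext => c; first by rewrite !rcompE kk_ptl.
by rewrite !rcompE kk_ptr; exact: ft.
Qed.

Lemma kk_local (t : gal) (S : comPzRingType) (phi : {rmorphism kk -> S}) (r : S) :
  ideal_gen [set a | exists c, a = phi (inr_kk c - inl_kk (t c))] r ->
  exists2 e, phi e * r = 0 & near1 t e.
Proof. exact: (galois_local k_perfect alg (@tensor_comm _ _ _ iota iota)). Qed.

Lemma kk_local_pt (t : gal) r : exists2 e, e * (r - inl_kk (kk_pt t r)) = 0 & near1 t e.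
Proof.
pose J := ideal_gen [set a | exists c, a = rid kk (inr_kk c - inl_kk (t c))].
have [|e er e1] := @kk_local t kk (rid kk) (r - inl_kk (kk_pt t r)); last by exists e.
pose hJ : is_ideal J := ideal_gen_ideal _.
apply/(quot_map0 hJ); rewrite rmorphB; apply/eqP; rewrite subr_eq0; apply/eqP.
apply: agree_kk_pt => c; apply: subr0_eq; rewrite -rmorphB.
by apply/quot_map0; apply: ig_base; exists c.
Qed.

Lemma kk_cover (I : set kk) : is_ideal I -> (forall t, exists2 e, I e & near1 t e) ->
  I 1.
Proof.
move=> hI cov; apply: (galois_cover k_perfect alg (@tensor_comm _ _ _ iota iota) hI).
by move=> t; have [e Ie e1] := cov t; exists e.
Qed.

(** At a prime, the two maps from kbar differ by an automorphism t, so that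
    the residue field is kbar and the prime is the kernel of the point t. *)
Lemma kk_prime (p : spec kk) : exists t, forall r, prime_set p r <-> kk_pt t r = 0.
Proof.
have hp := prime_ideal p.
have [t tP] : exists t, forall e, near1 t e -> ~ prime_set p e.
  apply: contrapT => /forallNP h; apply: (@prime1 _ p); apply: kk_cover => // t.
  apply: contrapT => ne; apply: (h t) => e e1 pe; apply: ne; by exists e.
exists t => r; split=> [pr|r0].
  apply/eqP; apply: contrapT => /negP c0.
  apply: (tP (inl_kk (kk_pt t r)^-1 * r)); last exact: primeMl.
  move=> R f ft; rewrite rmorphM (agree_kk_pt r ft) -!rmorphM mulVf //.
  by rewrite !rmorph1.
have [e er e1] := kk_local_pt t r.
have : prime_set p (e * r).
  by move: er; rewrite r0 rmorph0 subr0 => ->; exact: prime0.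
by move=> /primeM[/(tP _ e1)|].
Qed.

Section Flatness.
Variables (S : comPzRingType) (phi : {rmorphism kk -> S}).
Variables (M N : lmodType kk) (f : {linear M -> N}).
Hypothesis f_inj : injective f.

Definition scale_sum (e : kk) (s : seq (S * M)) := [seq (phi e * am.1, am.2) | am <- s].

Definition image_sum (s : seq (S * M)) := [seq (am.1, f am.2) | am <- s].

Definition balanced (P : lmodType kk) (Q : zmodType) (beta : S -> P -> Q) :=
  [/\ forall m, {morph beta^~ m : a b / a + b}, forall a, {morph beta a : m n / m + n} &
      forall a r m, beta (a * phi r) m = beta a (r *: m)].

Lemma balanced0l (P : lmodType kk) (Q : zmodType) (beta : S -> P -> Q) m :
  balanced beta -> beta 0 m = 0.
Proof. by case=> bD _ _; apply: (addrI (beta 0 m)); rewrite -bD !addr0. Qed.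

Lemma balanced_image (Q : zmodType) (beta : S -> N -> Q) :
  balanced beta -> balanced (fun a m => beta a (f m)).
Proof.
case=> bDl bDr bZ; split=> [m a b|a m n|a r m]; first exact: bDl.
  by rewrite linearD bDr.
by rewrite bZ linearZ.
Qed.

Lemma scale_sum_image e s : tensor_sum_eq0 phi (image_sum s) ->
  tensor_sum_eq0 phi (image_sum (scale_sum e s)).
Proof.
move=> h Q beta bDl bDr bZ; rewrite /image_sum /scale_sum -map_comp big_map /=.
have := h Q (fun a n => beta (phi e * a) n).
rewrite /image_sum big_map /=; apply.
- by move=> m a b; rewrite mulrDr bDl.
- by move=> a m n; rewrite bDr.
- by move=> a r m; rewrite mulrA bZ.
Qed.

(** At the point t the local ring is kbar; an element is zero in the fibre at
    t when it is killed by a function equal to 1 near t. *)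
Definition vanish (t : gal) : set N := [set n | exists2 e, near1 t e & e *: n = 0].

Lemma vanishD t m n : vanish t m -> vanish t n -> vanish t (m + n).
Proof.
move=> [e e1 em] [e' e'1 en]; exists (e * e'); first exact: near1M.
by rewrite scalerDr mulrC -!scalerA em scaler0 add0r scalerA mulrC -scalerA en scaler0.
Qed.

Lemma vanishZ t r n : vanish t n -> vanish t (r *: n).
Proof.
by move=> [e e1 en]; exists e => //; rewrite scalerA mulrC -scalerA en scaler0.
Qed.

(** In the fibre at t, a relation in S (x) N between the f m comes, by linear
    algebra over kbar, from a relation in S (x) M; it then holds near t. *)
Lemma flat_near t (s : seq (S * M)) : tensor_sum_eq0 phi (image_sum s) ->
  exists2 e, near1 t e & tensor_sum_eq0 phi (scale_sum e s).
Proof.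
have [n] := ubnP (size s); elim: n s => // n IH [|[a m] s] sn hs.
  by exists 1; [exact: near1_1|move=> Q beta _ _ _; rewrite big_nil].
pose comb (c : 'I_(size s) -> kbar) (g : S * M -> N) : N :=
  \sum_i inl_kk (c i) *: g (tnth (in_tuple s) i).
pose W : set N := [set x | exists c, vanish t (x - comb c (fun am => f am.2))].
have combD c c' g : comb (fun i => c i + c' i) g = comb c g + comb c' g.
  by rewrite -big_split; apply: eq_bigr => i _; rewrite rmorphD scalerDl.
have combZ e c g : comb (fun i => e * c i) g = inl_kk e *: comb c g.
  by rewrite scaler_sumr; apply: eq_bigr => i _; rewrite rmorphM scalerA.
have [[c [e e1 ec]]|nW] := pselect (W (f m)).
  (* m is locally a combination of the other elements *)
  have em : e *: m = e *: \sum_i inl_kk (c i) *: (tnth (in_tuple s) i).2.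
    apply: f_inj; rewrite 2!linearZ; apply: subr0_eq; rewrite -scalerBr -[RHS]ec.
    congr (_ *: (_ - _)); rewrite linear_sum.
    by apply: eq_bigr => i _; rewrite linearZ.
  pose s' := [seq (a * phi (e * inl_kk (c i)) + phi e * (tnth (in_tuple s) i).1,
    (tnth (in_tuple s) i).2) | i <- enum 'I_(size s)].
  have s'E (Q : zmodType) (beta : S -> M -> Q) : balanced beta ->
      \sum_(am <- s') beta am.1 am.2 = \sum_(am <- scale_sum e ((a, m) :: s)) beta am.1 am.2.
    move=> bal; have [bDl bDr bZ] := bal.
    have b0 x : beta x 0 = 0 by apply: (addrI (beta x 0)); rewrite -bDr !addr0.
    rewrite /s' /scale_sum [LHS]big_map [LHS]big_enum.
    rewrite [RHS]big_cons [X in _ = _ + X]big_map.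
    rewrite [X in _ = _ + X](big_tnth _ _ s) /= [phi e * a]mulrC bZ em scaler_sumr.
    have -> : beta a (\sum_i e *: (inl_kk (c i) *: (tnth (in_tuple s) i).2)) =
        \sum_i beta a (e *: (inl_kk (c i) *: (tnth (in_tuple s) i).2)).
      apply: (big_morph (beta a)) => //; exact: bDr.
    rewrite -big_split; apply: eq_bigr => i _ /=.
    by rewrite bDl bZ scalerA.
  have [||e' e'1 e'P] := IH s'.
  - by rewrite /s' size_map size_enum_ord.
  - move=> Q beta bDl bDr bZ.
    have := scale_sum_image e hs bDl bDr bZ.
    rewrite /image_sum ![\sum_(_ <- map (fun am : S * M => (am.1, f am.2)) _) _]big_map /=.
    by have := s'E Q _ (balanced_image (And3 bDl bDr bZ)) => /= ->.
  exists (e' * e); first exact: near1M.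
  move=> Q beta bDl bDr bZ.
  have bal' : balanced (fun x y => beta (phi e' * x) y).
    split=> [y x z|x y z|x r y]; first by rewrite mulrDr bDl.
      by rewrite bDr.
    by rewrite mulrA bZ.
  have := s'E Q _ bal'; have := e'P Q beta bDl bDr bZ.
  rewrite /scale_sum !big_map => -> /esym.
  move=> h; rewrite -[RHS]h; apply: eq_bigr => am _ /=.
  by rewrite rmorphM mulrA.
(* otherwise a functional that kills the others shows that a vanishes near t *)
have sW : is_subspace (fun c n => inl_kk c *: n) W.
  split.
  - exists (fun=> 0); exists 1; first exact: near1_1.
    by rewrite /comb big1 ?subr0 ?scaler0 // => i _; rewrite rmorph0 scale0r.
  - move=> x y [c vx] [c' vy]; exists (fun i => c i + c' i).
    by rewrite combD opprD addrACA; exact: vanishD.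
  - move=> e x [c vx]; exists (fun i => e * c i).
    by rewrite combZ -scalerBr; exact: vanishZ.
have [|c c' v|c c' v|v|l [lD lZ lW l1]] := linear_functional _ _ _ _ sW nW.
- by move=> c v w; rewrite scalerDr.
- by rewrite rmorphD scalerDl.
- by rewrite rmorphM scalerA.
- by rewrite rmorph1 scale1r.
have vW x : vanish t x -> W x.
  move=> vx; exists (fun=> 0); rewrite /comb big1 ?subr0 // => i _.
  by rewrite rmorph0 scale0r.
have lpt r x : l (r *: x) = kk_pt t r * l x.
  rewrite -lZ -[r in LHS](subrK (inl_kk (kk_pt t r))) scalerDl lD.
  rewrite [X in X + _]lW ?add0r //; apply: vW.
  have [e er e1] := kk_local_pt t r; exists e => //.
  by rewrite scalerA er scale0r.
pose J := ideal_gen [set b | exists c, b = phi (inr_kk c - inl_kk (t c))].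
pose hJ : is_ideal J := ideal_gen_ideal _.
pose pi := quot_map hJ.
have piE r : pi (phi r) = pi (phi (inl_kk (kk_pt t r))).
  have at_t : agree_kk t (rcomp pi phi).
    move=> c; apply: subr0_eq; rewrite -rmorphB.
    by apply/quot_map0; apply: ig_base; exists c.
  exact: agree_kk_pt at_t.
have Ja : J a.
  apply/(quot_map0 hJ).
  have := hs _ (fun b n => pi (b * phi (inl_kk (l n)))).
  rewrite /image_sum big_map big_cons big_seq big1 /= => [|am ams].
    rewrite l1 !rmorph1 mulr1 addr0; apply.
    - by move=> x b b'; rewrite mulrDl rmorphD.
    - by move=> b x y; rewrite lD !rmorphD mulrDr rmorphD.
    - move=> b r x.
      rewrite -[LHS]/(pi (b * phi r * phi (inl_kk (l x)))).
      rewrite -[RHS]/(pi (b * phi (inl_kk (l (r *: x))))).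
      by rewrite lpt !rmorphM piE mulrA.
  suff -> : l (f am.2) = 0 by rewrite !rmorph0 mulr0 rmorph0.
  apply: lW; have /seq_tnthP[i amE] : am \in s by [].
  exists (fun j => (j == i)%:R); exists 1; first exact: near1_1.
  rewrite /comb (bigD1 i) //= eqxx rmorph1 scale1r big1 => [|j /negPf->].
    by rewrite scale1r addr0 -amE subrr.
  by rewrite rmorph0 scale0r.
have [e ea e1] := kk_local Ja.
have hs' : tensor_sum_eq0 phi (image_sum (scale_sum e s)).
  move=> Q beta bDl bDr bZ.
  have := scale_sum_image e hs bDl bDr bZ.
  rewrite /image_sum /scale_sum -!map_comp !big_map big_cons /= ea.
  by rewrite balanced0l ?add0r.
have [|e' e'1 e'P] := IH (scale_sum e s) _ hs'; first by rewrite size_map.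
exists (e' * e); first exact: near1M.
move=> Q beta bDl bDr bZ; have := e'P Q beta bDl bDr bZ.
rewrite /scale_sum !big_map big_cons /= => h.
rewrite rmorphM -mulrA ea mulr0 balanced0l // add0r -[RHS]h.
by apply: eq_bigr => am _; rewrite mulrA.
Qed.
End Flatness.

(** The local rings of kbar (x)_k kbar are all equal to kbar, so that every
    module is flat. *)
Lemma kk_flat (S : comPzRingType) (phi : {rmorphism kk -> S}) : flat phi.
Proof.
move=> M N f f_inj s hs.
pose I : set kk := [set e | tensor_sum_eq0 phi (scale_sum phi e s)].
have : I 1.
  apply: kk_cover; last by move=> t; have [e e1 eP] := flat_near f_inj t hs; exists e.
  split=> [|x y hx hy|x y hy] Q beta bDl bDr bZ; rewrite /scale_sum big_map /=.
  - rewrite big1 // => am _; rewrite rmorph0 mul0r.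
    exact: balanced0l (And3 bDl bDr bZ).
  - have := hx Q beta bDl bDr bZ; have := hy Q beta bDl bDr bZ.
    rewrite /scale_sum !big_map /= => hy' hx'.
    transitivity (\sum_(am <- s) beta (phi x * am.1) am.2 +
      \sum_(am <- s) beta (phi y * am.1) am.2); last by rewrite hx' hy' addr0.
    rewrite -big_split; apply: eq_bigr => am _ /=.
    by rewrite rmorphD mulrDl bDl.
  - have := hy Q (fun a m => beta (phi x * a) m).
    rewrite /scale_sum big_map /= => hy'; rewrite -[RHS]hy'.
    + by apply: eq_bigr => am _; rewrite rmorphM mulrA.
    + by move=> m a b; rewrite mulrDr bDl.
    + by move=> a m n; rewrite bDr.
    + by move=> a r m; rewrite mulrA bZ.
move=> h Q beta bDl bDr bZ; have := h Q beta bDl bDr bZ.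
rewrite /scale_sum big_map /= => h'; rewrite -[RHS]h'; apply: eq_bigr => am _.
by rewrite rmorph1 mul1r.
Qed.
End FlatOverKK.

(** * The groupoid of a Galois extended group *)

(** Points over x and over x' have different types even if x and x' are
    equal, hence the pointwise equalities. *)
Lemma ag_mul_eq (kbar : closedFieldType) (D : affine_group kbar) (R : comPzRingType)
    (x x' : {rmorphism kbar -> R}) (u v : pt (ag_str D) x) (u' v' : pt (ag_str D) x') :
  u =1 u' -> v =1 v' -> ag_mul u v =1 ag_mul u' v'.
Proof.
move=> uu vv; have ex : x = x'.
  by apply: rmorph_ext => c; rewrite -(pt_str u) uu pt_str.
by subst x'; rewrite (pt_ext uu) (pt_ext vv).
Qed.

Lemma ag_mulI (kbar : closedFieldType) (D : affine_group kbar) (R : comPzRingType)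
    (x : {rmorphism kbar -> R}) (w : pt (ag_str D) x) : injective (ag_mul w).
Proof.
by move=> u v e; rewrite -[u]ag_mul1 -[v]ag_mul1 -(ag_mulV w) -!ag_mulA e.
Qed.

Lemma ag_one_map (kbar : closedFieldType) (D : affine_group kbar) (R S : comPzRingType)
    (f : {rmorphism R -> S}) (x : {rmorphism kbar -> R}) :
  pt_map f (@ag_one _ D _ x) = ag_one D (rcomp f x).
Proof.
by apply: (@ag_mulI _ _ _ _ (pt_map f (ag_one D x))); rewrite -ag_nat_mul ag_mul1 ag_mulr1.
Qed.

Section TopologicalGroup.
Variables (G : groupTopType) (topG : is_topological_group G) (T : topologicalType).

Lemma contM (f g : T -> G) : continuous f -> continuous g ->
  continuous (fun t => f t * g t)%g.
Proof.
move=> fc gc t; apply: (continuous_comp (f := fun t => (f t, g t))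
  (g := fun xy : G * G => (xy.1 * xy.2)%g)); last exact: topG.1.
by apply: cvg_pair; [exact: fc|exact: gc].
Qed.

Lemma contV (f : T -> G) : continuous f -> continuous (fun t => (f t)^-1)%g.
Proof. by move=> fc t; apply: continuous_comp; [exact: fc|exact: topG.2]. Qed.
End TopologicalGroup.

Section GroupoidOfExtension.
Variables (k : fieldType) (kbar : closedFieldType) (iota : {rmorphism k -> kbar}).
Hypotheses (k_perfect : perfect_field k) (alg : algebraic_extension iota).
Variables (X : extended_data iota) (galX : is_galois_extended X).

Local Notation gal := (gal iota).
Local Notation D := (ed_D X).
Local Notation E := (ed_E X).
Local Notation str := (ag_str D).
Local Notation incl := (@ed_incl _ _ _ X).
Local Notation proj := (@ed_proj _ _ _ X).
Local Notation act := (@ed_act _ _ _ X).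

Let ext := ge_ext galX.

Lemma proj1 : proj 1%g = 1%g.
Proof. by apply: (mulgI (proj 1%g)); rewrite -(te_projM ext) !mulg1. Qed.

Lemma projV e : proj (e^-1)%g = (proj e)^-1%g.
Proof. by apply: (mulgI (proj e)); rewrite -(te_projM ext) !mulgV proj1. Qed.

Lemma proj_incl z : proj (incl z) = 1%g.
Proof. by apply/(te_exact ext); exists z. Qed.

(** Continuous sections near each point are patched along a partition of the
    profinite space Gal into open and closed sets. *)
Lemma extension_section : exists q : gal -> E,
  [/\ continuous q, forall s, proj (q s) = s & q 1%g = 1%g].
Proof.
pose Q t (v : gal -> E) := exists U : set gal,
  [/\ open U, U t, {within U, continuous v} & forall t, U t -> proj (v t) = t].
have [s|g lg gP] := locst_choice k_perfect alg (Q := Q).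
  have [U [v [oU Us cv pv]]] := te_section ext s.
  exists v; apply: filterS (open_nbhs_nbhs (conj oU Us)) => t Ut.
  by exists U.
pose q0 t := g t t.
have pq0 t : proj (q0 t) = t by have [U [_ Ut _ /(_ _ Ut)]] := gP t.
have cq0 : continuous q0.
  move=> t A At; have [U [oU Ut cv _]] := gP t.
  have ct : {for t, continuous (g t)}.
    by move: cv; rewrite continuous_open_subspace //; apply; exact/mem_set.
  by apply: filterS2 (lg t) (ct A At) => t' /= e; rewrite /q0 e.
exists (fun t => (q0 1 )^-1 * q0 t)%g; split=> [|s|]; last exact: mulVg.
  by apply: (contM (te_group ext)) => //; exact: cst_continuous.
by rewrite (te_projM ext) projV !pq0 invg1 mul1g.
Qed.

Definition lift_gal : gal -> E := sval (cid extension_section).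
Local Notation q := lift_gal.

Lemma lift_gal_cont : continuous q.
Proof. by have [] := svalP (cid extension_section). Qed.
Lemma lift_galK s : proj (q s) = s.
Proof. by have [] := svalP (cid extension_section). Qed.
Lemma lift_gal1 : q 1%g = 1%g.
Proof. by have [] := svalP (cid extension_section). Qed.

Fact kernel_point e : exists z : ag_kpt D, proj e = 1%g -> incl z = e.
Proof.
have [p1|np] := pselect (proj e = 1%g); last by exists 1%g.
by have /(te_exact ext)[z <-] := p1; exists z.
Qed.

(** The value is meaningful for e in the kernel of the projection. *)
Definition ker_pt e : ag_kpt D := sval (cid (kernel_point e)).

Lemma ker_ptK e : proj e = 1%g -> incl (ker_pt e) = e.
Proof. exact: (svalP (cid (kernel_point e))). Qed.

Lemma inclK z : ker_pt (incl z) = z.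
Proof. by apply: (te_incl_inj ext); rewrite ker_ptK ?proj_incl. Qed.

Lemma ker_ptM e e' : proj e = 1%g -> proj e' = 1%g ->
  ker_pt (e * e')%g = (ker_pt e * ker_pt e')%g.
Proof.
move=> pe pe'; apply: (te_incl_inj ext).
by rewrite (te_inclM ext) !ker_ptK // (te_projM ext) pe pe' mulg1.
Qed.

Lemma ker_pt_cont (T : topologicalType) (f : T -> E) :
  continuous f -> (forall t, proj (f t) = 1%g) -> continuous (ker_pt \o f).
Proof.
move=> cf pf t A; rewrite nbhsE => -[U [oU Ut] UA].
have [V [oV UV]] := te_incl_open ext oU.
have : nbhs t (f @^-1` V).
  apply: cf; apply: open_nbhs_nbhs; split=> //.
  by rewrite -(ker_ptK (pf t)) -[V _]/((incl @^-1` V) _) -UV.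
apply: filterS => t' /= Vt'; apply: UA; rewrite UV /=.
by rewrite ker_ptK.
Qed.

Section OverRing.
Variable R : comPzRingType.
Implicit Types x y z : {rmorphism kbar -> R}.

Definition ker_at e x : pt str x := kpt_const (ker_pt e) x.

Lemma ker_atM e e' x : proj e = 1%g -> proj e' = 1%g ->
  ker_at (e * e')%g x = ag_mul (ker_at e x) (ker_at e' x).
Proof.
move=> pe pe'; apply: pt_ext => b; rewrite -[LHS]/(x (ker_pt (e * e')%g b)) ker_ptM //.
have := congr1 (fun u : pt str _ => u b) (ag_nat_mul x (ker_pt e) (ker_pt e')).
by move=> /= ->; apply: ag_mul_eq.
Qed.

Lemma ker_at1 x : ker_at 1%g x = ag_one D x.
Proof.
apply: (@ag_mulI _ _ _ _ (ker_at 1%g x)).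
by rewrite -ker_atM ?proj1 // mulg1 ag_mulr1.
Qed.

(** Points over y are carried to points over x by e when y is x twisted by the
    image of e in Gal. *)
Fact twist_str e x y (h : forall c, y c = x (proj e c)) (d : pt str y) c :
  rcomp d (act e) (str c) = x c.
Proof. by rewrite rcompE (sa_sigma (ge_sigma galX e)) pt_str h galKV. Qed.

Definition twist e x y (h : forall c, y c = x (proj e c)) (d : pt str y) : pt str x :=
  Pt (twist_str h d).

Lemma twist_eq e e' x y h h' (d : pt str y) : e = e' ->
  @twist e x y h d = @twist e' x y h' d.
Proof. by move=> ee; apply: pt_ext => b; rewrite /= ee. Qed.

Lemma twistM e x y (h : forall c, y c = x (proj e c)) (d d' : pt str y) :
  twist h (ag_mul d d') = ag_mul (twist h d) (twist h d').
Proof.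
apply: pt_ext => b.
have := congr1 (fun u : pt str _ => u b) (sa_mul (ge_sigma galX e) d d').
by move=> /= ->; apply: ag_mul_eq.
Qed.

Lemma twist1 e x y (h : forall c, y c = x (proj e c)) : twist h (ag_one D y) = ag_one D x.
Proof.
by apply: (@ag_mulI _ _ _ _ (twist h (ag_one D y))); rewrite -twistM !ag_mulr1.
Qed.

Lemma twist_comp e e' x y z h h' h'' (d : pt str z) :
  @twist e x y h (@twist e' y z h' d) = @twist (e * e')%g x z h'' d.
Proof. by apply: pt_ext => b; rewrite /= (ca_mul (ge_act galX)). Qed.

Lemma twist_id e x h (d : pt str x) : e = 1%g -> @twist e x x h d = d.
Proof. by move=> e1; apply: pt_ext => b; rewrite /= e1 (ca_one (ge_act galX)). Qed.

Lemma twist_ker e e' x y (h : forall c, y c = x (proj e c)) : proj e' = 1%g ->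
  twist h (ker_at e' y) = ker_at (e * e' * e^-1)%g x.
Proof.
move=> pe'; apply: pt_ext => b.
have kE : ker_pt (e * e' * e^-1)%g = sigma_kpt (sa_sigma (ge_sigma galX e)) (ker_pt e').
  by rewrite -{1}(ker_ptK pe') -(ge_conj galX) inclK.
rewrite -[RHS]/(x (ker_pt (e * e' * e^-1)%g b)) kE.
by rewrite -[LHS]/(y (ker_pt e' (act e b))) h.
Qed.

Lemma twist_inner e x h (d : pt str x) : proj e = 1%g ->
  @twist e x x h d = ag_mul (ag_mul (ker_at e x) d) (ag_inv (ker_at e x)).
Proof.
move=> pe; apply: pt_ext => b.
by rewrite -[LHS]/(d (act e b)) -{1}(ker_ptK pe) (ge_inner galX).
Qed.
End OverRing.

(** The factor set of the extension defined by the section. *)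
Definition cocycle s t : E := (q s * q t * (q (s * t))^-1)%g.

Lemma proj_cocycle s t : proj (cocycle s t) = 1%g.
Proof. by rewrite /cocycle !(te_projM ext) projV !lift_galK mulgV. Qed.

Lemma cocycle_locst b : locst (fun st : gal * gal => ker_pt (cocycle st.1 st.2) b).
Proof.
have topE := te_group ext.
have cq := lift_gal_cont.
have c : continuous (fun st : gal * gal => cocycle st.1 st.2).
  apply: (contM topE).
    by apply: (contM topE) => p; apply: continuous_comp;
      [exact: cont_fst|exact: cq|exact: cont_snd|exact: cq].
  apply: (contV topE) => p; apply: (continuous_comp (f := fun st : gal * gal => (st.1 * st.2)%g)).
    have [h _] := gal_topological iota; exact: h.
  exact: cq.
apply: (@locst_cont _ _ _ (ker_pt \o (fun st : gal * gal => cocycle st.1 st.2))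
  (fun z : ag_kpt D => z b)); last exact: kpt_locst.
by apply: ker_pt_cont => // -[s t]; exact: proj_cocycle.
Qed.

(** Local constancy in s is uniform in t because Gal is compact. *)
Lemma cocycle_uniform b (s0 : gal) :
  nbhs s0 [set s | forall t, ker_pt (cocycle s t) b = ker_pt (cocycle s0 t) b].
Proof.
pose P (A : set gal) := nbhs s0 [set s | forall t, A t ->
  ker_pt (cocycle s t) b = ker_pt (cocycle s0 t) b].
suff : P setT by rewrite /P; apply: filterS => s h t; exact: h.
apply: (gal_compact k_perfect alg) => [A B AB|A B|t0]; rewrite /P.
- by apply: filterS => s /= h t /AB; exact: h.
- by move=> PA PB; apply: filterS2 PA PB => s h h' t [/h|/h'].
- have [[U V] /= [Us Vt] UV] := cocycle_locst b (s0, t0).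
  have U0 := nbhs_singleton Us.
  exists V => //; apply: filterS Us => s sU t tV.
  have /= -> := UV (s, t) (conj sU tV).
  by have /= -> := UV (s0, t) (conj U0 tV).
Qed.

Section Factors.
Variables (R : comPzRingType) (x y z : {rmorphism kbar -> R}).
Hypothesis xy : forall c, x (iota c) = y (iota c).
Hypothesis yz : forall c, y (iota c) = z (iota c).

Fact alpha_locst (d : pt str y) b : locst (fun s => rcomp d (act (q s)) b).
Proof.
apply: (@locst_comp _ _ _ (fun s => act (q s) b) d).
apply: (@locst_cont _ _ _ q (fun e => act e b)); first exact: lift_gal_cont.
exact: action_locst (ge_act galX).
Qed.

(** Conjugation by the section, as a map on points in any kbar-algebra: at the
    locus y = x o s it is the twist by the lift of s. *)
Definition alpha_hom (d : pt str y) : {rmorphism D -> R} :=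
  glue_hom k_perfect alg xy (alpha_locst d).

Fact alpha_str (d : pt str y) c : alpha_hom d (str c) = x c.
Proof.
apply: (galois_separate2 k_perfect alg xy) => s R' f fs.
rewrite (glue_homE _ _ _ _ _ fs) rcompE (sa_sigma (ge_sigma galX (q s))) pt_str fs.
by rewrite lift_galK galKV.
Qed.

Definition alpha (d : pt str y) : pt str x := Pt (alpha_str d).

Fact factor_locst_in s b : locst (fun t => rcomp x (ker_pt (cocycle s t)) b).
Proof.
move=> t; have [[U V] /= [Us Vt] UV] := cocycle_locst b (s, t).
apply: filterS Vt => t' tV /=; congr (x _).
exact: (UV (s, t') (conj (nbhs_singleton Us) tV)).
Qed.

Definition factor_in s : {rmorphism D -> R} :=
  glue_hom k_perfect alg yz (factor_locst_in s).

Fact factor_locst b : locst (fun s => factor_in s b).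
Proof.
move=> s; apply: filterS (cocycle_uniform b s) => s' h /=.
apply: (galois_separate2 k_perfect alg yz) => t R' f ft.
by rewrite /factor_in !(glue_homE _ _ _ _ _ ft) !rcompE h.
Qed.

(** The factor set, as a map on points in any kbar-algebra: it is glued in t
    and then in s. *)
Definition factor_hom : {rmorphism D -> R} := glue_hom k_perfect alg xy factor_locst.

Lemma factor_homE s t (R' : comPzRingType) (f : {rmorphism R -> R'}) b :
  agree_at x y s f -> agree_at y z t f ->
  f (factor_hom b) = f (x (ker_pt (cocycle s t) b)).
Proof. by move=> fs ft; rewrite (glue_homE _ _ _ _ _ fs) (glue_homE _ _ _ _ _ ft). Qed.

Fact factor_str c : factor_hom (str c) = x c.
Proof.
apply: (galois_separate2 k_perfect alg xy) => s R' f fs.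
suff h b : f (factor_hom b) = f (factor_in s b).
  apply: (galois_separate2 k_perfect alg (x := rcomp f y) (y := rcomp f z)) => [e|t R'' g gt].
    by rewrite !rcompE yz.
  rewrite h; have ft : agree_at y z t (rcomp g f) by move=> e; exact: gt.
  by rewrite -[LHS]/(rcomp g f (factor_in s (str c))) (glue_homE _ _ _ _ _ ft) !rcompE pt_str.
exact: glue_homE fs.
Qed.

Definition factor : pt str x := Pt factor_str.

(** An arrow from y to x is to be a product d q(x, y), where q is the
    section. Moving d' to the left of q(x, y) by conjugation, and q(x, y)
    q(y, z) to q(x, z) by the factor set, gives this coefficient for the
    composite of d q(x, y) and d' q(y, z). *)
Definition pt_comp (d : pt str x) (d' : pt str y) : pt str x :=
  ag_mul (ag_mul d (alpha d')) factor.

Fact agree_twist s (R' : comPzRingType) (f : {rmorphism R -> R'}) :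
  agree_at x y s f -> forall c, rcomp f y c = rcomp f x (proj (q s) c).
Proof. by move=> fs c; rewrite lift_galK; exact: fs. Qed.

Lemma pt_compE s t (R' : comPzRingType) (f : {rmorphism R -> R'})
    (fs : agree_at x y s f) (ft : agree_at y z t f) (d : pt str x) (d' : pt str y) :
  pt_map f (pt_comp d d') =
  ag_mul (ag_mul (pt_map f d) (twist (agree_twist fs) (pt_map f d')))
    (ker_at (cocycle s t) (rcomp f x)).
Proof.
rewrite /pt_comp !ag_nat_mul; congr ag_mul; last first.
  by apply: pt_ext => b; exact: factor_homE.
by congr ag_mul; apply: pt_ext => b; exact: glue_homE fs.
Qed.
End Factors.

Lemma cocycleA s t u :
  (q s * cocycle t u * (q s)^-1 * cocycle s (t * u) =
   cocycle s t * cocycle (s * t) u)%g.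
Proof. by rewrite /cocycle !mulgA !divgK. Qed.

Lemma proj_cocycleJ s t u : (proj (q s * cocycle t u * (q s)^-1) = 1)%g.
Proof.
by rewrite 2!(te_projM ext) projV proj_cocycle mulg1 mulgV.
Qed.

Section Laws.
Variables (R : comPzRingType).
Implicit Types x y z w : {rmorphism kbar -> R}.

Lemma separate3 x y z w (r r' : R) : (forall c, x (iota c) = y (iota c)) ->
  (forall c, y (iota c) = z (iota c)) -> (forall c, z (iota c) = w (iota c)) ->
  (forall (s t u : gal) (R' : comPzRingType) (f : {rmorphism R -> R'}),
    agree_at x y s f -> agree_at y z t f -> agree_at z w u f -> f r = f r') -> r = r'.
Proof.
move=> xy yz zw h.
apply: (galois_separate2 k_perfect alg xy) => s R1 f1 h1.
apply: (galois_separate2 k_perfect alg (x := rcomp f1 y) (y := rcomp f1 z)) => [c|].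
  by rewrite !rcompE yz.
move=> t R2 f2 h2.
apply: (galois_separate2 k_perfect alg (x := rcomp f2 (rcomp f1 z))
  (y := rcomp f2 (rcomp f1 w))) => [c|u R3 f3 h3].
  by rewrite !rcompE zw.
apply: (h s t u _ (rcomp f3 (rcomp f2 f1))) => c.
- by rewrite !rcompE h1.
- by rewrite !rcompE; congr (f3 _); exact: h2.
- exact: h3.
Qed.

Lemma agree_comp x y z (s t : gal) (R' : comPzRingType) (f : {rmorphism R -> R'}) :
  agree_at x y s f -> agree_at y z t f -> agree_at x z (s * t)%g f.
Proof. by move=> fs ft c; rewrite ft fs. Qed.

(** Both triple products become, at a locus where all the points are twists of
    one, the same expression by the cocycle identity. *)
Lemma pt_compA x y z w xy yz zw yw xz (d : pt str x) (d' : pt str y) (d'' : pt str z) :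
  @pt_comp R x y w xy yw d (@pt_comp R y z w yz zw d' d'') =
  @pt_comp R x z w xz zw (@pt_comp R x y z xy yz d d') d''.
Proof.
apply: pt_ext => b; apply: (separate3 xy yz zw) => s t u R' f fs ft fu.
have ftu := agree_comp ft fu; have fst := agree_comp fs ft.
rewrite -[LHS]/(pt_map f (pt_comp xy yw d (pt_comp yz zw d' d'')) b).
rewrite -[RHS]/(pt_map f (pt_comp xz zw (pt_comp xy yz d d') d'') b).
congr (_ b : R'); congr (@pt_hom _ _ _ _ _ _).
rewrite (pt_compE _ _ fs ftu) (pt_compE _ _ ft fu) (pt_compE _ _ fst fu).
rewrite (pt_compE _ _ fs ft) !twistM.
have hst c : rcomp f z c = rcomp f x (proj (q s * q t)%g c).
  by rewrite (te_projM ext) !lift_galK; exact: fst.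
have h1 c : rcomp f x c = rcomp f x (proj (cocycle s t) c).
  by rewrite proj_cocycle.
have hc c : rcomp f z c = rcomp f x (proj (cocycle s t * q (s * t))%g c).
  by rewrite (te_projM ext) proj_cocycle mul1g lift_galK; exact: fst.
rewrite (twist_comp _ _ hst) (twist_eq hst hc); last by rewrite /cocycle divgK.
rewrite -(twist_comp h1 (agree_twist fst)) twist_inner ?proj_cocycle //.
rewrite twist_ker ?proj_cocycle // -!ag_mulA -ker_atM ?proj_cocycle ?proj_cocycleJ //.
rewrite cocycleA ker_atM ?proj_cocycle //.
by rewrite [ag_mul (ag_inv _) _]ag_mulA ag_mulV ag_mul1.
Qed.

(** If s moves c, the invertible element x (c - s c) vanishes at the locus x
    = x o s, which is therefore empty. *)
Lemma agree_self x (s : gal) (R' : comPzRingType) (f : {rmorphism R -> R'}) :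
  agree_at x x s f -> s = 1%g \/ forall r r' : R', r = r'.
Proof.
move=> fs; have [s1|/existsNP[c sc]] := pselect (forall c, s c = c).
  by left; apply: gal_ext => c; exact: s1.
right; suff R0 : (1 : R') = 0 by move=> r r'; rewrite -[r]mul1r -[r']mul1r R0 !mul0r.
have d0 : c - s c != 0 by rewrite subr_eq0; apply/eqP => e; apply: sc.
have e : rcomp f x (c - s c) = 0.
  by apply/eqP; rewrite rmorphB subr_eq0; apply/eqP; exact: fs.
by rewrite -(rmorph1 (rcomp f x)) -(mulVf d0) rmorphM e mulr0.
Qed.

Lemma pt_comp1 x y xx xy (d : pt str x) :
  @pt_comp R x x y xx xy (ag_one D x) d = d.
Proof.
apply: pt_ext => b; apply: (separate3 xx xy (w := y)) => // s t _ R' f fs ft _.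
have [s1|all_eq] := agree_self fs; last exact: all_eq.
rewrite -[LHS]/(pt_map f _ b) (pt_compE _ _ fs ft) ag_one_map ag_mul1.
rewrite twist_id ?s1 ?lift_gal1 // /cocycle lift_gal1 !mul1g mulgV ker_at1 ag_mulr1 //.
Qed.

Lemma pt_compr1 x y xy yy (d : pt str x) :
  @pt_comp R x y y xy yy d (ag_one D y) = d.
Proof.
apply: pt_ext => b; apply: (separate3 xy yy (w := y)) => // s t _ R' f fs ft _.
have [t1|all_eq] := agree_self ft; last exact: all_eq.
rewrite -[LHS]/(pt_map f _ b) (pt_compE _ _ fs ft) ag_one_map twist1 ag_mulr1.
by rewrite t1 /cocycle lift_gal1 !mulg1 mulgV ker_at1 ag_mulr1.
Qed.
End Laws.

Lemma pt_comp_nat (R S : comPzRingType) (f : {rmorphism R -> S})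
    (x y z : {rmorphism kbar -> R}) xy yz xy' yz' (d : pt str x) (d' : pt str y) :
  pt_map f (@pt_comp R x y z xy yz d d') =
  @pt_comp S (rcomp f x) (rcomp f y) (rcomp f z) xy' yz' (pt_map f d) (pt_map f d').
Proof.
apply: pt_ext => b; apply: (separate3 xy' yz' (w := rcomp f z)) => // s t _ R' g gs gt _.
have gs' : agree_at x y s (rcomp g f) by move=> c; exact: gs.
have gt' : agree_at y z t (rcomp g f) by move=> c; exact: gt.
rewrite -[RHS]/(pt_map g _ b) (pt_compE _ _ gs gt).
rewrite -[LHS]/(pt_map (rcomp g f) _ b) (pt_compE _ _ gs' gt').
by apply: ag_mul_eq => // a; apply: ag_mul_eq.
Qed.

(** Functions on the product over k of D and Spec kbar, whose points (d, y),
    with d over x, stand for the arrows d q(x, y). *)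
Definition sg_ring := tensor (rcomp str iota) iota.
Definition sg_d0 : {rmorphism kbar -> sg_ring} := rcomp (tensor_inl _ _) str.
Definition sg_d1 : {rmorphism kbar -> sg_ring} := tensor_inr _ _.

Local Notation inD := (tensor_inl (rcomp str iota) iota).
Local Notation sg_arrow := (@arrow kbar sg_ring sg_d0 sg_d1 _).

Fact sg_k c : sg_d0 (iota c) = sg_d1 (iota c).
Proof. exact: (tensor_comm (rcomp str iota) iota c). Qed.

Section SgArrows.
Variables (R : comPzRingType) (x y : {rmorphism kbar -> R}).

Lemma sg_arrow_k (u : sg_arrow x y) c : x (iota c) = y (iota c).
Proof. by rewrite -(ar_target u) sg_k ar_source. Qed.

Definition sg_pt (u : sg_arrow x y) : pt str x :=
  @Pt _ _ str _ x (rcomp u inD) (ar_target u).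

Hypothesis xy : forall c, x (iota c) = y (iota c).
Variable d : pt str x.

Fact mk_arrow_k c : d (rcomp str iota c) = y (iota c).
Proof. by rewrite rcompE pt_str. Qed.

Fact mk_arrow_target c : tensor_lift mk_arrow_k (sg_d0 c) = x c.
Proof. by rewrite rcompE tensor_liftl pt_str. Qed.

Fact mk_arrow_source c : tensor_lift mk_arrow_k (sg_d1 c) = y c.
Proof. by rewrite tensor_liftr. Qed.

Definition mk_arrow : sg_arrow x y := Arrow mk_arrow_target mk_arrow_source.

Lemma mk_arrowK : sg_pt mk_arrow = d.
Proof. by apply: pt_ext => b; rewrite -[LHS]/(mk_arrow (inD b)) [LHS]tensor_liftl. Qed.
End SgArrows.

Lemma sg_arrow_ext (R : comPzRingType) (x y : {rmorphism kbar -> R}) (u v : sg_arrow x y) :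
  sg_pt u = sg_pt v -> u = v.
Proof.
move=> e; apply: arrow_ext => a.
suff -> : (u : {rmorphism sg_ring -> R}) = v by [].
apply: tensor_hom_ext => [b|c]; first exact: (congr1 (fun p : pt str x => p b) e).
exact: etrans (ar_source u c) (esym (ar_source v c)).
Qed.

Section Structure.
Variables (R : comPzRingType) (x y z : {rmorphism kbar -> R}).

Fact sg_comp_k (u : sg_arrow x y) (v : sg_arrow y z) c : x (iota c) = z (iota c).
Proof. by rewrite (sg_arrow_k u) (sg_arrow_k v). Qed.

Definition sg_comp (u : sg_arrow x y) (v : sg_arrow y z) : sg_arrow x z :=
  mk_arrow (sg_comp_k u v) (pt_comp (sg_arrow_k u) (sg_arrow_k v) (sg_pt u) (sg_pt v)).

Definition sg_id : sg_arrow x x := mk_arrow (fun c => erefl (x (iota c))) (ag_one D x).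

(** The inverse is read off from the equation that its product with u be
    trivial. *)
Definition sg_inv (u : sg_arrow x y) : sg_arrow y x :=
  mk_arrow (fun c => esym (sg_arrow_k u c))
    (ag_inv (ag_mul (alpha (fun c => esym (sg_arrow_k u c)) (sg_pt u))
       (factor (fun c => esym (sg_arrow_k u c)) (sg_arrow_k u)))).
End Structure.

Fact sg_compA (R : comPzRingType) (x y z t : {rmorphism kbar -> R})
    (u : sg_arrow x y) (v : sg_arrow y z) (w : sg_arrow z t) :
  sg_comp u (sg_comp v w) = sg_comp (sg_comp u v) w.
Proof.
apply: sg_arrow_ext; rewrite !mk_arrowK; exact: pt_compA.
Qed.

Fact sg_compl1 (R : comPzRingType) (x y : {rmorphism kbar -> R}) (u : sg_arrow x y) :
  sg_comp (sg_id x) u = u.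
Proof. by apply: sg_arrow_ext; rewrite !mk_arrowK pt_comp1. Qed.

Fact sg_compr1 (R : comPzRingType) (x y : {rmorphism kbar -> R}) (u : sg_arrow x y) :
  sg_comp u (sg_id y) = u.
Proof. by apply: sg_arrow_ext; rewrite !mk_arrowK pt_compr1. Qed.

Fact sg_compV (R : comPzRingType) (x y : {rmorphism kbar -> R}) (u : sg_arrow x y) :
  sg_comp (sg_inv u) u = sg_id y.
Proof.
apply: sg_arrow_ext; rewrite !mk_arrowK /pt_comp -ag_mulA.
rewrite (Prop_irrelevance (sg_arrow_k (sg_inv u)) (fun c => esym (sg_arrow_k u c))).
exact: ag_mulV.
Qed.

Fact sg_comprV (R : comPzRingType) (x y : {rmorphism kbar -> R}) (u : sg_arrow x y) :
  sg_comp u (sg_inv u) = sg_id x.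
Proof.
set v := sg_inv u.
rewrite -[LHS]sg_compl1 -(sg_compV v) -sg_compA; congr (sg_comp _ _).
by rewrite sg_compA sg_compV sg_compl1.
Qed.

Fact sg_nat_comp (R S : comPzRingType) (f : {rmorphism R -> S})
    (x y z : {rmorphism kbar -> R}) (u : sg_arrow x y) (v : sg_arrow y z) :
  arrow_map f (sg_comp u v) = sg_comp (arrow_map f u) (arrow_map f v).
Proof.
apply: sg_arrow_ext; rewrite mk_arrowK.
have -> : sg_pt (arrow_map f (sg_comp u v)) = pt_map f (sg_pt (sg_comp u v)).
  exact: pt_ext.
rewrite mk_arrowK pt_comp_nat; try by move=> c; rewrite !rcompE ?(sg_arrow_k u) ?(sg_arrow_k v).
move=> h h'; rewrite (Prop_irrelevance h (sg_arrow_k (arrow_map f u))).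
rewrite (Prop_irrelevance h' (sg_arrow_k (arrow_map f v))).
by congr (pt_comp _ _ _ _); exact: pt_ext.
Qed.

Definition sg_groupoid : groupoid iota :=
  Groupoid sg_k sg_compA sg_compl1 sg_compr1 sg_compV sg_comprV sg_nat_comp.

(** Flatness is automatic over kbar (x)_k kbar, and over each of its points,
    which are the elements of Gal, the unit of D defines an arrow. *)
Lemma sg_transitive : is_transitive sg_groupoid.
Proof.
split; first exact: kk_flat.
move=> p; have [t tP] := kk_prime k_perfect alg p.
have [p0 p0P] := field_zero_prime kbar.
pose u := mk_arrow (x := rid kbar) (y := t) (fun c => esym (gal_fix t c)) (ag_one D (rid kbar)).
exists (spec_map u p0); apply: spec_ext => r; rewrite tP.
suff -> : kk_pt t r = u (tensor_lift sg_k r) by exact: p0P.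
suff e : kk_pt t = rcomp u (tensor_lift sg_k).
  exact: (congr1 (fun h : {rmorphism kk iota -> kbar} => h r) e).
apply: tensor_hom_ext => c.
  by rewrite rcompE tensor_liftl kk_ptl ar_target.
by rewrite rcompE tensor_liftr kk_ptr ar_source.
Qed.

Definition sg_tgroupoid : transitive_groupoid iota := TransitiveGroupoid sg_transitive.
End GroupoidOfExtension.

(** * Essential surjectivity *)

Section RecoveredExtension.
Variables (k : fieldType) (kbar : closedFieldType) (iota : {rmorphism k -> kbar}).
Hypotheses (k_perfect : perfect_field k) (alg : algebraic_extension iota).
Variables (X : extended_data iota) (galX : is_galois_extended X).

Local Notation gal := (gal iota).
Local Notation D := (ed_D X).
Local Notation E := (ed_E X).
Local Notation str := (ag_str D).
Local Notation incl := (@ed_incl _ _ _ X).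
Local Notation proj := (@ed_proj _ _ _ X).
Local Notation act := (@ed_act _ _ _ X).
Local Notation q := (lift_gal k_perfect alg galX).
Local Notation F := (sg_groupoid k_perfect alg galX).
Local Notation inD := (tensor_inl (rcomp str iota) iota).
Local Notation pts := (gr_kpt alg F).
Local Notation Y := (groupoid_data alg F).
Local Notation mk_arrow := (@mk_arrow _ _ _ X _).
Local Notation pt_comp := (pt_comp k_perfect alg galX).

Let ext := ge_ext galX.

Lemma cocycle1l s : cocycle k_perfect alg galX 1%g s = 1%g.
Proof. by rewrite /cocycle lift_gal1 !mul1g mulgV. Qed.

Lemma cocycle1r s : cocycle k_perfect alg galX s 1%g = 1%g.
Proof. by rewrite /cocycle lift_gal1 !mulg1 mulgV. Qed.

(** For arrows between equal points only the automorphism 1 matters, at which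
    both the twist and the factor set are trivial. *)
Lemma pt_comp_self (R : comPzRingType) (x : {rmorphism kbar -> R})
    (xx xx' : forall c, x (iota c) = x (iota c)) (d d' : pt str x) : pt_comp xx xx' d d' = ag_mul d d'.
Proof.
apply: pt_ext => b.
apply: (separate3 k_perfect alg xx xx' (w := x)) => // s t _ R' f fs ft _.
have [s1|all_eq] := agree_self fs; last exact: all_eq.
have [t1|all_eq] := agree_self ft; last exact: all_eq.
rewrite -[LHS]/(pt_map f _ b) (pt_compE _ _ _ _ _ fs ft).
rewrite twist_id; last by rewrite s1 lift_gal1.
by rewrite t1 cocycle1r ker_at1 ag_mulr1 -ag_nat_mul.
Qed.

Definition sg_diag : {rmorphism D -> diag_ring F} := rcomp (diag_proj F) inD.

Fact sg_diag_kbar : @is_kbar_hom _ (diag_group F) D sg_diag.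
Proof. by []. Qed.

Fact sg_diag_group : is_group_hom sg_diag_kbar.
Proof.
move=> R x u v; apply: pt_ext => b.
rewrite -[LHS]/(diag_mul u v (diag_proj F (inD b))) [LHS]diag_ptE.
rewrite -[LHS]/(sg_pt (sg_comp k_perfect alg galX (diag_arrow u) (diag_arrow v)) b).
rewrite mk_arrowK pt_comp_self.
by apply: ag_mul_eq.
Qed.

Fact diag_sg_rel c : (rid D) (rcomp str iota c) = str (iota c).
Proof. by []. Qed.

Fact diag_sg_coeq c : tensor_lift diag_sg_rel (gr_d0 F c) = tensor_lift diag_sg_rel (gr_d1 F c).
Proof. by rewrite [LHS]tensor_liftl [RHS]tensor_liftr. Qed.

Definition diag_sg : {rmorphism diag_ring F -> D} := coeq_lift diag_sg_coeq.

Lemma sg_diagK : cancel sg_diag diag_sg.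
Proof.
move=> b; rewrite -[LHS]/(diag_sg (diag_proj F (inD b))) [LHS]coeq_liftE.
exact: tensor_liftl.
Qed.

Lemma diag_sgK : cancel diag_sg sg_diag.
Proof.
apply: (@diag_hom_eq _ _ _ F _ (rcomp sg_diag diag_sg) (rid _)) => a.
rewrite rcompE -[RHS]/(diag_proj F a) [diag_sg _]coeq_liftE.
suff e : rcomp sg_diag (tensor_lift diag_sg_rel) = diag_proj F.
  exact: (congr1 (fun h : {rmorphism F -> diag_ring F} => h a) e).
apply: tensor_hom_ext => c; first by rewrite rcompE tensor_liftl.
rewrite rcompE tensor_liftr -[LHS]/(diag_proj F (gr_d0 F c)).
exact: coeq_mapE.
Qed.

Lemma sg_diag_bij : bijective sg_diag.
Proof. by exists diag_sg; [exact: sg_diagK|exact: diag_sgK]. Qed.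

Definition D_part (u : pts) : ag_kpt D := @Pt _ _ str _ (rid kbar) (rcomp u inD) (pt_str u).

(** The arrow d q(x, y) over kbar stands for the element d q(s) of E. *)
Definition E_of (u : pts) : E := (incl (D_part u) * q (gr_gamma u))%g.

Lemma proj_E_of u : proj (E_of u) = gr_gamma u.
Proof. by rewrite (te_projM ext) proj_incl // mul1g lift_galK. Qed.

Fact E_ofM : {morph E_of : u v / (u * v)%g}.
Proof.
move=> u v; rewrite /E_of gr_projM.
set s := gr_gamma u; set t := gr_gamma v.
have fs : agree_at (rid kbar) s s (rid kbar) by [].
have ft : agree_at s (rcomp s t) t (rid kbar) by [].
have -> : D_part (u * v)%g = (D_part u * sigma_kpt (sa_sigma (ge_sigma galX (q s))) (D_part v)
    * ker_pt galX (cocycle k_perfect alg galX s t))%g.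
  apply: pt_ext => b.
  rewrite -[LHS]/(sg_pt (sg_comp k_perfect alg galX (kpt_arrow u) (translate s v)) b).
  rewrite mk_arrowK -[LHS]/(pt_map (rid kbar) _ b) (pt_compE _ _ _ _ _ fs ft).
  apply: ag_mul_eq => // a; apply: ag_mul_eq => // a'.
  by rewrite -[LHS]/(s (v (inD (act (q s) a')))) -[RHS]/(proj (q s) _) lift_galK.
rewrite 2!(te_inclM ext) (ge_conj galX) ker_ptK ?proj_cocycle // /cocycle.
by rewrite !mulgA !divgK.
Qed.

Fact E_of_cont : continuous E_of.
Proof.
have cD : continuous D_part.
  by apply: kpt_cont => b; exact: (pts_locst (alg := alg) (F := F) (inD b)).
apply: (contM (te_group ext)).
  by move=> u; apply: (continuous_comp (f := D_part)); [exact: cD|exact: (te_incl_cont ext)].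
move=> u; apply: (continuous_comp (f := @gr_gamma _ _ _ alg F)); last exact: lift_gal_cont.
by apply: gal_cont; apply: gr_gamma_locst => a; exact: pts_locst.
Qed.

Fact E_of_incl (z : ag_kpt (diag_group F)) :
  E_of (gr_incl alg z) = incl (hom_pt sg_diag_kbar z : ag_kpt D).
Proof.
rewrite /E_of gr_gamma_incl lift_gal1 mulg1; congr (incl _).
by apply: pt_ext => b.
Qed.

(** Multiplied on the right by the constant arrow of u, both sides become the
    product of that arrow and the universal point. *)
Fact E_of_act (u : pts) b : gr_act u (sg_diag b) = sg_diag (act (E_of u) b).
Proof.
rewrite [LHS](gr_actE (univ_pt F)).
set x := diag_str F; set s := gr_gamma u; set C := conj_at x u.
set del := diag_arrow (univ_pt F).
set x' := rcomp x (s^-1)%g in C *.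
have ps : forall c, x c = x' (proj (q s) c).
  by move=> c; rewrite lift_galK -[RHS]/(x ((s^-1)%g (s c))) galVK.
have pE : forall c, x c = x' (proj (E_of u) c).
  by move=> c; rewrite proj_E_of -[RHS]/(x ((s^-1)%g (s c))) galVK.
have fs : agree_at x' x s (rid (diag_ring F)).
  by move=> c; rewrite -[LHS]/(x c) -[RHS]/(x ((s^-1)%g (s c))) galVK.
have f1 : agree_at x x (1%g : gal) (rid (diag_ring F)) by [].
have f1' : agree_at x' x' (1%g : gal) (rid (diag_ring F)) by [].
have x'k : forall c, x' (iota c) = x' (iota c) by [].
pose M : gr_arrow F x' x' := mk_arrow x'k (twist galX pE (sg_pt del)).
suff CM : gr_comp C del = gr_comp M C.
  rewrite CM -gr_compA gr_comprV gr_compr1.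
  rewrite -[LHS]/(sg_pt (M : @arrow _ (sg_ring X) (sg_d0 X) (sg_d1 X) _ _ _) b).
  by rewrite mk_arrowK.
apply: sg_arrow_ext; rewrite !mk_arrowK; apply: pt_ext => a.
rewrite -[LHS]/(pt_map (rid _) _ a) (pt_compE _ _ _ _ _ fs f1).
rewrite -[RHS]/(pt_map (rid _) _ a) (pt_compE _ _ _ _ _ f1' fs).
rewrite cocycle1l cocycle1r !ker_at1 !ag_mulr1.
have p1 : forall c, x' c = x' (proj (incl (D_part u)) c).
  by move=> c; rewrite proj_incl.
have -> : twist galX pE (sg_pt del) = ag_mul (ag_mul (ker_at galX (incl (D_part u)) x')
    (twist galX ps (sg_pt del))) (ag_inv (ker_at galX (incl (D_part u)) x')).
  rewrite -(twist_inner galX p1) ?proj_incl // twist_comp; exact: twist_eq.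
set K := ker_at galX _ x'; set W := twist galX ps _.
transitivity (ag_mul (ag_mul (ag_mul K W) (ag_inv K)) K a); last first.
  apply: ag_mul_eq => // e; rewrite -[RHS]/(x' (u (inD (act (q 1%g) e)))).
  rewrite lift_gal1 (ca_one (ge_act galX)) -[LHS]/(x' (ker_pt galX (incl (D_part u)) e)).
  by rewrite inclK.
rewrite -[ag_mul (ag_mul (ag_mul _ _) _) _]ag_mulA ag_mulV ag_mulr1.
apply: ag_mul_eq => // e.
by rewrite -[RHS]/(x' (ker_pt galX (incl (D_part u)) e)) inclK.
Qed.

Definition recover : extended_hom Y X :=
  @ExtendedHom _ _ _ Y X sg_diag E_of sg_diag_kbar sg_diag_group E_ofM E_of_cont
    proj_E_of E_of_incl E_of_act.

Fact of_E_k e c : ker_pt galX (e * (q (proj e))^-1)%g (rcomp str iota c) = proj e (iota c).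
Proof. by rewrite rcompE pt_str gal_fix. Qed.

Fact of_E_str e c : tensor_lift (of_E_k e) (gr_d0 F c) = rid kbar c.
Proof. by rewrite [LHS]tensor_liftl pt_str. Qed.

Definition of_E e : pts := @Pt _ _ (gr_d0 F) _ (rid kbar) (tensor_lift (of_E_k e)) (of_E_str e).

Lemma proj_divq e : proj (e * (q (proj e))^-1)%g = 1%g.
Proof. by rewrite (te_projM ext) (projV galX) lift_galK mulgV. Qed.

Lemma of_EK : cancel of_E E_of.
Proof.
move=> e; rewrite /E_of.
have -> : gr_gamma (of_E e) = proj e.
  apply: gal_ext => c.
  by rewrite -[LHS]/(tensor_lift (of_E_k e) (tensor_inr _ _ c)) tensor_liftr.
have -> : D_part (of_E e) = ker_pt galX (e * (q (proj e))^-1)%g.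
  by apply: pt_ext => b; rewrite -[LHS]/(tensor_lift (of_E_k e) (inD b)) tensor_liftl.
by rewrite ker_ptK ?proj_divq // divgK.
Qed.

Lemma E_ofK : cancel E_of of_E.
Proof.
move=> u; apply: pt_ext => a.
suff e : tensor_lift (of_E_k (E_of u)) = u.
  exact: (congr1 (fun h : {rmorphism F -> kbar} => h a) e).
apply: tensor_hom_ext => c.
  by rewrite tensor_liftl proj_E_of /E_of mulgK inclK.
by rewrite tensor_liftr proj_E_of.
Qed.

Lemma of_E_cont : continuous of_E.
Proof.
have cp : continuous proj := te_proj_cont ext.
apply: pts_cont; apply: locst_presented => -[b|c].
  have -> : (fun e => of_E e (inD b)) = fun e => ker_pt galX (e * (q (proj e))^-1)%g b.
    by apply/funext => e; exact: tensor_liftl.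
  apply: (@locst_cont _ _ _ (ker_pt galX \o (fun e => e * (q (proj e))^-1)%g)
    (fun z : ag_kpt D => z b)); last exact: kpt_locst.
  apply: ker_pt_cont; last exact: proj_divq.
  apply: (contM (te_group ext)); first by move=> e; exact: cvg_id.
  apply: (contV (te_group ext)) => e; apply: (continuous_comp (f := proj)); first exact: cp.
  exact: lift_gal_cont.
have -> : (fun e => of_E e (tensor_inr (rcomp str iota) iota c)) = fun e => proj e c.
  by apply/funext => e; exact: tensor_liftr.
exact: (@locst_cont _ _ _ proj (fun s : gal => s c) cp (gal_locst c)).
Qed.
End RecoveredExtension.

Section InvertibleHom.
Variables (k : fieldType) (kbar : closedFieldType) (iota : {rmorphism k -> kbar}).
Variables (X Y : extended_data iota) (f : extended_hom X Y).
Hypothesis bijD : bijective (eh_D f).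
Variable g : ed_E Y -> ed_E X.
Hypotheses (gK : cancel g (eh_E f)) (fK : cancel (eh_E f) g) (g_cont : continuous g).

Local Notation h := (rinv bijD).

Fact inv_kbar : is_kbar_hom h.
Proof. by move=> c; rewrite -(eh_kbar f) [LHS]rinvK. Qed.

Fact inv_pt (R : comPzRingType) (x : {rmorphism kbar -> R}) (u : pt (ag_str (ed_D Y)) x) :
  hom_pt (eh_kbar f) (hom_pt inv_kbar u) = u.
Proof. by apply: pt_ext => b; congr (u _); exact: rinvK. Qed.

Fact pt_inv (R : comPzRingType) (x : {rmorphism kbar -> R}) (u : pt (ag_str (ed_D X)) x) :
  hom_pt inv_kbar (hom_pt (eh_kbar f) u) = u.
Proof. by apply: pt_ext => b; congr (u _); exact: rinvKV. Qed.

Fact inv_group : is_group_hom inv_kbar.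
Proof. by move=> R x u v; rewrite -{1}(inv_pt u) -{1}(inv_pt v) -(eh_group f) pt_inv. Qed.

Fact inv_mul : {morph g : x y / (x * y)%g}.
Proof. by move=> x y; apply: (can_inj fK); rewrite (eh_mul f) !gK. Qed.

Fact inv_proj e : ed_proj (g e) = ed_proj e.
Proof. by rewrite -(eh_proj f) gK. Qed.

Fact inv_incl (z : ag_kpt (ed_D Y)) :
  g (ed_incl z) = ed_incl (hom_pt inv_kbar z : ag_kpt (ed_D X)).
Proof. by apply: (can_inj fK); rewrite (eh_incl f) gK inv_pt. Qed.

Fact inv_act e b : ed_act e (h b) = h (ed_act (g e) b).
Proof.
apply: (can_inj (rinvK bijD)); rewrite [RHS]rinvKV.
have := eh_act f (g e) (h b); rewrite gK => <-.
by congr (ed_act _ _); exact: rinvKV.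
Qed.

Definition extended_inv : extended_hom Y X :=
  ExtendedHom inv_group inv_mul g_cont inv_proj inv_incl inv_act.
End InvertibleHom.

(** * Full faithfulness *)

Section Sections.
Variables (k : fieldType) (kbar : closedFieldType) (iota : {rmorphism k -> kbar}).
Hypotheses (k_perfect : perfect_field k) (alg : algebraic_extension iota).

Local Notation gal := (gal iota).
Local Notation kk := (kk iota).
Local Notation inl_kk := (tensor_inl iota iota).
Local Notation inr_kk := (tensor_inr iota iota).

Lemma arrow_k (F : groupoid iota) (R : comPzRingType) (x y : {rmorphism kbar -> R})
  (u : gr_arrow F x y) c : x (iota c) = y (iota c).
Proof. by rewrite -(ar_target u) gr_k ar_source. Qed.

Section SectionPoints.
Variables (F : groupoid iota) (r : gr_section F).

Section OverRing.
Variables (R : comPzRingType) (x y : {rmorphism kbar -> R}).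
Hypothesis xy : forall c, x (iota c) = y (iota c).

Fact sec_arrow_target c : rcomp (tensor_lift xy) r (gr_d0 F c) = x c.
Proof. by rewrite rcompE sec0 tensor_liftl. Qed.

Fact sec_arrow_source c : rcomp (tensor_lift xy) r (gr_d1 F c) = y c.
Proof. by rewrite rcompE sec1 tensor_liftr. Qed.

Definition sec_arrow : gr_arrow F x y :=
  @Arrow _ F (gr_d0 F) (gr_d1 F) _ x y _ sec_arrow_target sec_arrow_source.
End OverRing.

Lemma sec_arrow_map (R S : comPzRingType) (f : {rmorphism R -> S})
    (x y : {rmorphism kbar -> R}) xy xy' :
  arrow_map f (@sec_arrow R x y xy) = @sec_arrow S (rcomp f x) (rcomp f y) xy'.
Proof.
apply: arrow_ext => a.
suff e : rcomp f (tensor_lift xy) = tensor_lift xy'.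
  exact: (congr1 (fun h : {rmorphism kk -> S} => h (r a)) e).
by apply: tensor_hom_ext => c; rewrite rcompE ?tensor_liftl ?tensor_liftr.
Qed.

(** At the locus y = x o t, the morphism from kbar (x)_k kbar given by x and
    y factors through its point t. *)
Lemma sec_arrow_local (R : comPzRingType) (x y : {rmorphism kbar -> R}) xy (t : gal) :
  (forall c, y c = x (t c)) -> @sec_arrow R x y xy =1 rcomp x (sec_pt alg r t).
Proof.
move=> yt a; rewrite -[LHS]/(tensor_lift xy (r a)) (agree_kk_pt (t := t)).
  by rewrite tensor_liftl.
by move=> c; rewrite tensor_liftl tensor_liftr.
Qed.
End SectionPoints.

Section ConstantArrow.
Variables (F : groupoid iota) (R : comPzRingType) (x : {rmorphism kbar -> R}).

Lemma const_arrowM (y z : {rmorphism kbar -> R}) (v w : gr_kpt alg F)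
    (u : gr_arrow F x y) (u' : gr_arrow F y z) :
  u =1 rcomp x v -> u' =1 rcomp y w -> gr_comp u u' =1 rcomp x (v * w)%g.
Proof.
move=> uv uw a.
have yE c : y c = x (gr_gamma v c) by rewrite -(ar_source u) uv.
have := congr1 (fun t : gr_arrow F _ _ => t a)
  (gr_nat_comp x (kpt_arrow v) (translate (gr_gamma v) w)).
move=> /= e; rewrite -[RHS]/(x (gr_comp (kpt_arrow v) (translate (gr_gamma v) w) a)) e.
by apply: gr_comp_eq => b; rewrite ?uv // uw; exact: yE.
Qed.

Lemma const_arrowV (y : {rmorphism kbar -> R}) (v : gr_kpt alg F) (u : gr_arrow F x y) :
  u =1 rcomp x v -> gr_inv u =1 rcomp y (v^-1)%g.
Proof.
move=> uv.
have yE c : y c = x (gr_gamma v c) by rewrite -(ar_source u) uv.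
have xE c : x c = y (gr_gamma v^-1%g c).
  by rewrite gr_gammaV yE galKV.
have zE c : rcomp y (gr_gamma v^-1%g) c = x c by rewrite xE.
pose w := @Arrow _ F (gr_d0 F) (gr_d1 F) _ y x (rcomp y v^-1%g)
  (fun c => congr1 y (pt_str (v^-1)%g c)) zE.
suff <- : w = gr_inv u by [].
apply: gr_invE; apply: arrow_ext => a.
rewrite (const_arrowM uv (w := v^-1%g)) // mulgV.
have := congr1 (fun t : gr_arrow F _ _ => t a) (gr_nat_id F x (rid kbar)).
by move=> /= e; rewrite -[LHS]/(x (gr_id F (rid kbar) a)) e; apply: gr_id_eq.
Qed.
End ConstantArrow.

(** Locally an arrow is the product of an automorphism of its target and of a
    value of the section, and the latter is determined by its kbar-points. *)
Lemma points_faithful (F F' : groupoid iota) (r : gr_section F) (f g : groupoid_hom F F') :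
  diag_hom f =1 diag_hom g -> kpt_hom (alg := alg) f =1 kpt_hom g -> f = g.
Proof.
move=> fgD fgE; apply: groupoid_hom_ext => a.
pose u := arrow_univ F.
pose q := sec_arrow r (arrow_k u).
have [d uE] : exists d : gr_arrow F (gr_d0 F) (gr_d0 F), u = gr_comp d q.
  by exists (gr_comp u (gr_inv q)); rewrite -gr_compA gr_compV gr_compr1.
rewrite -[LHS]/(hom_arrow (gh_kbar f) u a) -[RHS]/(hom_arrow (gh_kbar g) u a).
rewrite uE !gh_comp; apply: gr_comp_eq => b.
  rewrite -[LHS]/(d (f b)) -[RHS]/(d (g b)) -!(diag_ptE d).
  by rewrite -!diag_homE fgD.
rewrite -[LHS]/(tensor_lift (arrow_k u) (r (f b))) -[RHS]/(tensor_lift (arrow_k u) (r (g b))).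
congr (tensor_lift _ _).
apply: (galois_separate2 k_perfect alg (@tensor_comm _ _ _ iota iota)) => t R h ht.
rewrite (agree_kk_pt _ ht) [RHS](agree_kk_pt _ ht); congr (h (inl_kk _)).
exact: (congr1 (fun z : gr_kpt alg F' => z b) (fgE (sec_pt alg r t))).
Qed.

Section Fullness.
Variables (F F' : groupoid iota) (r : gr_section F).
Variable e : extended_hom (groupoid_data alg F) (groupoid_data alg F').

Local Notation h := (eh_D e).
Local Notation l := (eh_E e).

Fact image_locst a : locst (fun t => rcomp inl_kk (l (sec_pt alg r t) : gr_kpt alg F') a).
Proof.
apply: (@locst_comp _ _ _ (fun t => (l (sec_pt alg r t) : gr_kpt alg F') a) inl_kk).
apply: (@locst_cont _ _ _ (l \o sec_pt alg r) (fun v : gr_kpt alg F' => v a)).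
  by move=> t; apply: continuous_comp; [exact: sec_pt_cont|exact: eh_cont].
exact: pts_locst.
Qed.

(** The points l(q(t)) of F', glued over Gal. *)
Definition image_hom : {rmorphism F' -> kk} :=
  glue_hom k_perfect alg (@tensor_comm _ _ _ iota iota) image_locst.

Lemma image_homE t (R : comPzRingType) (f : {rmorphism kk -> R}) a :
  agree_at inl_kk inr_kk t f ->
  f (image_hom a) = f (inl_kk ((l (sec_pt alg r t) : gr_kpt alg F') a)).
Proof. exact: glue_homE. Qed.

Fact image_sec0 c : image_hom (gr_d0 F' c) = inl_kk c.
Proof.
apply: (galois_separate2 k_perfect alg (@tensor_comm _ _ _ iota iota)) => t R f ft.
by rewrite (image_homE _ ft) pt_str.
Qed.

Fact image_sec1 c : image_hom (gr_d1 F' c) = inr_kk c.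
Proof.
apply: (galois_separate2 k_perfect alg (@tensor_comm _ _ _ iota iota)) => t R f ft.
rewrite (image_homE _ ft) ft.
rewrite -[l _ (gr_d1 F' c)]/(gr_gamma (l (sec_pt alg r t) : gr_kpt alg F') c).
have gl : gr_gamma (l (sec_pt alg r t) : gr_kpt alg F') = t.
  exact: etrans (eh_proj e (sec_pt alg r t)) (sec_pt_gamma alg r t).
by rewrite gl.
Qed.

Definition image_sec : gr_section F' := GrSection image_sec0 image_sec1.

Lemma image_sec_pt t : sec_pt alg image_sec t = l (sec_pt alg r t).
Proof.
apply: pt_ext => a; rewrite -[LHS]/(kk_pt t (image_hom a)).
by rewrite (image_homE _ (kk_pt_agree t)) kk_ptl.
Qed.

Definition hom_diag (R : comPzRingType) (x : {rmorphism kbar -> R}) (d : gr_arrow F x x) :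
    gr_arrow F' x x :=
  diag_arrow (hom_pt (eh_kbar e) (diag_pt d : pt (ag_str (diag_group F)) x)
    : pt (diag_str F') x).

Section OverRing.
Variables (R : comPzRingType).
Implicit Types x y z : {rmorphism kbar -> R}.

Lemma hom_diagE x (d : gr_arrow F x x) a : hom_diag d a = diag_pt d (h (diag_proj F' a)).
Proof. by []. Qed.

Lemma hom_diagM x (d d' : gr_arrow F x x) :
  hom_diag (gr_comp d d') = gr_comp (hom_diag d) (hom_diag d').
Proof.
have dE : diag_pt (gr_comp d d') = diag_mul (diag_pt d) (diag_pt d').
  by rewrite /diag_mul !diag_ptK.
by rewrite /hom_diag dE (eh_group e) /= /diag_mul diag_ptK.
Qed.

Lemma hom_diag_const x (z : ag_kpt (diag_group F)) (d : gr_arrow F x x) :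
  d =1 rcomp x (gr_incl alg z) -> hom_diag d =1 rcomp x (l (gr_incl alg z) : gr_kpt alg F').
Proof.
move=> dz a; rewrite hom_diagE (eh_incl e) -[RHS]/(x (z (h (diag_proj F' a)))).
by apply: (@diag_hom_eq _ _ _ F _ (diag_pt d) (rcomp x z)) => b; rewrite diag_ptE dz.
Qed.

(** Conjugation by an arrow that comes from a kbar-point v is the action of v. *)
Lemma hom_diag_conj x y (v : gr_kpt alg F) (u : gr_arrow F x y)
    (u' : gr_arrow F' x y) (d : gr_arrow F y y) :
  u =1 rcomp x v -> u' =1 rcomp x (l v : gr_kpt alg F') ->
  hom_diag (gr_comp (gr_comp u d) (gr_inv u)) =
    gr_comp (gr_comp u' (hom_diag d)) (gr_inv u').
Proof.
move=> uv uv'.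
have gl : gr_gamma (l v : gr_kpt alg F') = gr_gamma v := eh_proj e v.
have yE c : y c = x (gr_gamma v c) by rewrite -(ar_source u) uv.
have xE c : x c = rcomp y (gr_gamma v)^-1%g c.
  by rewrite rcompE yE galKV.
have uC : u =1 conj_at y v by move=> a; rewrite uv -[RHS]/(rcomp y (gr_gamma v)^-1%g (v a)) -xE.
have uC' : u' =1 conj_at y (l v : gr_kpt alg F').
  move=> a; rewrite uv' -[RHS]/(y ((gr_gamma (l v : gr_kpt alg F'))^-1%g ((l v : gr_kpt alg F') a))).
  by rewrite gl -[RHS]/(rcomp y (gr_gamma v)^-1%g _) -xE.
apply: arrow_ext => a; rewrite hom_diagE.
transitivity (diag_pt d (gr_act v (h (diag_proj F' a)))).
  apply: (@diag_hom_eq _ _ _ F _ (diag_pt _) (rcomp (diag_pt d) (gr_act v))) => b.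
  rewrite diag_ptE rcompE (gr_actE (diag_pt d)) diag_ptK.
  by apply: gr_comp_eq; [apply: gr_comp_eq|apply: gr_inv_eq].
have := eh_act e v (diag_proj F' a) => /= ->.
rewrite -[LHS]/(hom_pt (eh_kbar e) (diag_pt d : pt (ag_str (diag_group F)) y) (gr_act (l v : gr_kpt alg F') _)).
rewrite [LHS](gr_actE (F := F')).
by apply: gr_comp_eq; [apply: gr_comp_eq|apply: gr_inv_eq].
Qed.

(** The image of d q(x, y) has to be h(d) q'(x, y), where q' is the image of
    the section. *)
Definition image_arrow x y (u : gr_arrow F x y) : gr_arrow F' x y :=
  gr_comp (hom_diag (gr_comp u (gr_inv (sec_arrow r (arrow_k u)))))
    (sec_arrow image_sec (arrow_k u)).

(** At this locus q(x, y) q(y, z) q(x, z)^-1 comes from a kbar-point of the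
    diagonal, where h and l agree. *)
Lemma image_arrow_local x y z xy yz xz (s t : gal) :
  (forall c, y c = x (s c)) -> (forall c, z c = y (t c)) ->
  hom_diag (gr_comp (gr_comp (@sec_arrow F r R x y xy) (@sec_arrow F r R y z yz))
    (gr_inv (@sec_arrow F r R x z xz))) =
  gr_comp (gr_comp (sec_arrow image_sec xy) (sec_arrow image_sec yz))
    (gr_inv (sec_arrow image_sec xz)).
Proof.
move=> ys zt; have zst c : z c = x ((s * t)%g c) by rewrite zt ys.
pose v := (sec_pt alg r s * sec_pt alg r t * (sec_pt alg r (s * t)%g)^-1)%g.
have /gr_exact[w wv] : gr_gamma v = 1%g.
  have V (u : gr_kpt alg F) : gr_gamma (u^-1)%g = (gr_gamma u)^-1%g.
    by apply: gal_ext => c; exact: gr_gammaV.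
  by rewrite /v !gr_projM V !sec_pt_gamma mulgV.
have lV (u : gr_kpt alg F) : l (u^-1)%g = (l u)^-1%g.
  have l1 : l 1%g = 1%g by apply: (mulgI (l 1%g)); rewrite -(eh_mul e) !mulg1.
  by apply: (mulgI (l u)); rewrite -(eh_mul e) !mulgV l1.
have dE : gr_comp (gr_comp (sec_arrow r xy) (sec_arrow r yz)) (gr_inv (sec_arrow r xz))
    =1 rcomp x (gr_incl alg w).
  rewrite wv; apply: const_arrowM.
    by apply: const_arrowM; exact: sec_arrow_local.
  by apply: const_arrowV; exact: sec_arrow_local.
apply: arrow_ext => a; rewrite (hom_diag_const dE) wv /v !(eh_mul e) lV -!image_sec_pt.
symmetry; apply: const_arrowM; first by apply: const_arrowM; exact: sec_arrow_local.
by apply: const_arrowV; exact: sec_arrow_local.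
Qed.
End OverRing.

Lemma hom_diag_map (R S : comPzRingType) (f : {rmorphism R -> S})
    (x : {rmorphism kbar -> R}) (d : gr_arrow F x x) :
  arrow_map f (hom_diag d) = hom_diag (arrow_map f d).
Proof.
apply: arrow_ext => a; rewrite hom_diagE -[LHS]/(f (hom_diag d a)) hom_diagE.
by apply: (@diag_hom_eq _ _ _ F _ (rcomp f (diag_pt d)) (diag_pt (arrow_map f d))) => b;
  rewrite rcompE !diag_ptE.
Qed.

Lemma image_arrow_eq (R : comPzRingType) (x y x' y' : {rmorphism kbar -> R})
    (u : gr_arrow F x y) (u' : gr_arrow F x' y') : u =1 u' -> image_arrow u =1 image_arrow u'.
Proof.
move=> uu; have ex : x = x'.
  by apply: rmorph_ext => c; rewrite -(ar_target u) uu ar_target.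
have ey : y = y' by apply: rmorph_ext => c; rewrite -(ar_source u) uu ar_source.
by subst x' y'; rewrite (arrow_ext uu).
Qed.

Lemma image_arrow_map (R S : comPzRingType) (f : {rmorphism R -> S})
    (x y : {rmorphism kbar -> R}) (u : gr_arrow F x y) :
  arrow_map f (image_arrow u) = image_arrow (arrow_map f u).
Proof.
rewrite /image_arrow gr_nat_comp hom_diag_map gr_nat_comp gr_nat_inv.
by rewrite !(sec_arrow_map _ _ (arrow_k (arrow_map f u))).
Qed.

Lemma image_arrowM_local (R : comPzRingType) (x y z : {rmorphism kbar -> R}) (s t : gal)
    (u : gr_arrow F x y) (v : gr_arrow F y z) :
  (forall c, y c = x (s c)) -> (forall c, z c = y (t c)) ->
  image_arrow (gr_comp u v) = gr_comp (image_arrow u) (image_arrow v).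
Proof.
move=> ys zt; rewrite /image_arrow.
set q := sec_arrow r (arrow_k u); set q1 := sec_arrow r (arrow_k v).
set q2 := sec_arrow r (arrow_k (gr_comp u v)).
set p := sec_arrow image_sec (arrow_k u); set p1 := sec_arrow image_sec (arrow_k v).
set p2 := sec_arrow image_sec (arrow_k (gr_comp u v)).
set d := gr_comp u (gr_inv q); set d1 := gr_comp v (gr_inv q1).
(* With u = d q and v = d1 q1, the product u v q2^-1 is d (q d1 q^-1) (q q1
   q2^-1), a product of three arrows from x to itself. *)
have -> : gr_comp (gr_comp u v) (gr_inv q2) =
    gr_comp (gr_comp d (gr_comp (gr_comp q d1) (gr_inv q)))
      (gr_comp (gr_comp q q1) (gr_inv q2)).
  rewrite /d /d1 -!gr_compA; congr gr_comp.
  rewrite [gr_comp (gr_inv q) (gr_comp q _)]gr_compA gr_compV gr_compl1; congr gr_comp.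
  rewrite [gr_comp (gr_inv q) (gr_comp q _)]gr_compA gr_compV gr_compl1.
  by rewrite [gr_comp (gr_inv q1) (gr_comp q1 _)]gr_compA gr_compV gr_compl1.
rewrite !hom_diagM (hom_diag_conj (v := sec_pt alg r s) (u' := p)).
- rewrite (image_arrow_local _ _ _ ys zt) -/p -/p1 -/p2 -!gr_compA; congr gr_comp.
  congr gr_comp; congr gr_comp.
  by rewrite gr_compV gr_compr1 gr_compA gr_compV gr_compl1.
- exact: sec_arrow_local.
- by move=> a; rewrite -image_sec_pt; exact: sec_arrow_local.
Qed.

Lemma image_arrowM (R : comPzRingType) (x y z : {rmorphism kbar -> R})
    (u : gr_arrow F x y) (v : gr_arrow F y z) :
  image_arrow (gr_comp u v) = gr_comp (image_arrow u) (image_arrow v).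
Proof.
apply: arrow_ext => a.
apply: (separate3 k_perfect alg (arrow_k u) (arrow_k v) (w := z)) => // s t _ R' f fs ft _.
rewrite -[LHS]/(arrow_map f _ a) -[RHS]/(arrow_map f _ a).
rewrite image_arrow_map (gr_nat_comp f u v) (gr_nat_comp f (image_arrow u)) !image_arrow_map.
by rewrite (@image_arrowM_local _ _ _ _ s t).
Qed.

(** The factor q q q^-1 of image_arrow_local is q itself, for q from x to x;
    so the image of q by h is the image of the section. *)
Lemma image_arrow_diag (R : comPzRingType) (x : {rmorphism kbar -> R}) (u : gr_arrow F x x) :
  image_arrow u = hom_diag u.
Proof.
have := @image_arrow_local R x x x (arrow_k u) (arrow_k u) (arrow_k u) 1%g 1%g
  (fun=> erefl) (fun=> erefl).
rewrite -!gr_compA !gr_comprV !gr_compr1 /image_arrow => <-.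
by rewrite -hom_diagM -gr_compA gr_compV gr_compr1.
Qed.

Fact image_univ_over : over_kbar (image_arrow (arrow_univ F)).
Proof. by split=> c; [exact: ar_target|exact: ar_source]. Qed.

Lemma image_univE (R : comPzRingType) (x y : {rmorphism kbar -> R}) (u : gr_arrow F x y) :
  hom_arrow image_univ_over u = image_arrow u.
Proof.
apply: arrow_ext => a; rewrite -[LHS]/(arrow_map u (image_arrow (arrow_univ F)) a).
by rewrite image_arrow_map; apply: image_arrow_eq.
Qed.

Fact image_univ_comp (R : comPzRingType) (x y z : {rmorphism kbar -> R})
    (u : gr_arrow F x y) (v : gr_arrow F y z) :
  hom_arrow image_univ_over (gr_comp u v) =
    gr_comp (hom_arrow image_univ_over u) (hom_arrow image_univ_over v).
Proof. by rewrite !image_univE image_arrowM. Qed.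

(** The morphism is given by the image of the universal arrow, from which the
    image of any arrow is deduced by naturality. *)
Lemma points_full : exists f : groupoid_hom F F', groupoid_data_hom alg f = e.
Proof.
exists (GroupoidHom image_univ_comp); apply: extended_hom_ext => [b|v].
  have [a ->] := diag_surj b.
  rewrite [LHS]diag_homE -[LHS]/(hom_arrow image_univ_over (diag_univ F) a).
  rewrite image_univE image_arrow_diag hom_diagE.
  by rewrite [diag_pt _](diag_arrowK (univ_pt F)).
apply: pt_ext => a; rewrite -[LHS]/(hom_arrow image_univ_over (kpt_arrow v) a) image_univE.
pose s := gr_gamma v; pose w := (v * (sec_pt alg r s)^-1)%g.
have wE : gr_comp (kpt_arrow v) (gr_inv (sec_arrow r (arrow_k (kpt_arrow v)))) =1
    rcomp (rid kbar) w.
  apply: const_arrowM => //.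
  by apply: const_arrowV; exact: sec_arrow_local.
have /gr_exact[z zw] : gr_gamma w = 1%g.
  rewrite /w gr_projM; apply: gal_ext => c.
  by rewrite -[LHS]/(s (gr_gamma (sec_pt alg r s)^-1%g c)) gr_gammaV sec_pt_gamma galKV.
have lw : l v = (l w * l (sec_pt alg r s))%g.
  by rewrite -(eh_mul e) /w divgK.
rewrite -zw in wE; have h := hom_diag_const wE.
rewrite lw -image_sec_pt -[RHS]/(rcomp (rid kbar) _ a).
apply: const_arrowM; last exact: sec_arrow_local.
by move=> b; rewrite h zw.
Qed.
End Fullness.
End Sections.

Section Equivalence.
Variables (C C' : category) (T : functor C C').
Hypothesis faithfulT : forall x y (f g : Defs.hom x y), Defs.fmap T f = Defs.fmap T g -> f = g.
Hypothesis fullT : forall x y (g : Defs.hom (T x) (T y)), exists f, Defs.fmap T f = g.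
Hypothesis surjT : forall y : C', exists x (eps : Defs.hom (T x) y), isomorphism eps.

Lemma fully_faithful_equivalence : is_equivalence T.
Proof.
have [G GP] : exists G : C' -> C, forall y, exists eps : Defs.hom (T (G y)) y, isomorphism eps.
  exists (fun y => sval (cid (surjT y))) => y; exact: (svalP (cid (surjT y))).
have [eps epsP] : exists eps : forall y, Defs.hom (T (G y)) y, forall y, isomorphism (eps y).
  exists (fun y => sval (cid (GP y))) => y; exact: (svalP (cid (GP y))).
have [inv invP] : exists inv : forall y, Defs.hom y (T (G y)), forall y,
    compm (inv y) (eps y) = idm _ /\ compm (eps y) (inv y) = idm _.
  exists (fun y => sval (cid (epsP y))) => y; exact: (svalP (cid (epsP y))).
have [lift liftP] : exists lift : forall x y, Defs.hom (T x) (T y) -> Defs.hom x y,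
    forall x y g, Defs.fmap T (lift x y g) = g.
  exists (fun x y g => sval (cid (@fullT x y g))) => x y g.
  exact: (svalP (cid (fullT g))).
have eps_inv y := (invP y).1; have inv_eps y := (invP y).2.
pose Gm x y (g : Defs.hom x y) : Defs.hom (G x) (G y) :=
  lift _ _ (compm (inv y) (compm g (eps x))).
have Gm1 x : Gm x x (idm x) = idm (G x).
  by apply: faithfulT; rewrite liftP fmap1 comp1m.
have GmM x y z (f : Defs.hom y z) (g : Defs.hom x y) : Gm _ _ (compm f g) = compm (Gm _ _ f) (Gm _ _ g).
  apply: faithfulT; rewrite fmapM !liftP -!compmA; congr (compm _ (compm _ _)).
  by rewrite !compmA inv_eps comp1m.
exists (Functor Gm1 GmM); split.
  exists (fun x => lift _ _ (eps (T x))); split=> [x y f|x].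
    apply: faithfulT; rewrite [LHS]fmapM [RHS]fmapM !liftP.
    by rewrite /= compmA inv_eps comp1m.
  exists (lift _ _ (inv (T x))).
  by split; apply: faithfulT; rewrite fmapM !liftP fmap1; [exact: eps_inv|exact: inv_eps].
exists eps; split=> // x y f.
by rewrite /= liftP compmA inv_eps comp1m.
Qed.
End Equivalence.

Theorem proposition9p4 (k : fieldType) (kbar : closedFieldType)
    (iota : {rmorphism k -> kbar})
    (k_perfect : perfect_field k) (alg : algebraic_extension iota) :
  exists galois : forall F : transitive_groupoid iota,
      is_galois_extended (groupoid_data alg F),
    is_equivalence (points_functor galois).
Proof.
have sec (F : transitive_groupoid iota) : inhabited (gr_section F).
  exact: (transitive_section k_perfect alg (tg_transitive F)).
exists (fun F => let: inhabits r := sec F in galois_groupoid_data alg r).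
apply: fully_faithful_equivalence => [F F' f g fg|F F' e|X].
- have [r] := sec F.
  have {}fg : groupoid_data_hom alg (f : groupoid_hom F F') = groupoid_data_hom alg g := fg.
  apply: (points_faithful k_perfect (alg := alg) r) => [b|v].
    by rewrite -[LHS]/(eh_D (groupoid_data_hom alg (f : groupoid_hom F F')) b) fg.
  by rewrite -[LHS]/(eh_E (groupoid_data_hom alg (f : groupoid_hom F F')) v) fg.
- have [r] := sec F; exact: (points_full k_perfect r e).
- pose gX := ge_axioms X; exists (sg_tgroupoid k_perfect alg gX), (recover k_perfect alg gX).
  pose bijD := sg_diag_bij k_perfect alg gX.
  exists (extended_inv (f := recover k_perfect alg gX) bijD
    (@of_EK _ _ _ k_perfect alg _ gX) (@E_ofK _ _ _ k_perfect alg _ gX)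
    (@of_E_cont _ _ _ k_perfect alg _ gX)).
  split; apply: extended_hom_ext => [b|v].
  + exact: (rinvKV bijD).
  + exact: E_ofK.
  + exact: (rinvK bijD).
  + exact: of_EK.
Qed.
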